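(* Let $X^{-1}$, $X^{+1}$ be right processes on $E^{-1}$, $E^{+1}$, let $K^{-1}$ be a transfer kernel from $X^{-1}$ to $(X^{+1},E^{+1})$ and $K^{+1}$ a transfer kernel from $X^{+1}$ to $(X^{-1},E^{-1})$, and let $X$ be the concatenation of the copies $\widetilde X^n=\{n\}\times X^{(-1)^n}$, $n\in\mathbb N$, via the transfer kernels $\widetilde K^n=\delta_{n+1}\otimes K^{(-1)^n}$, $n\in\mathbb N$. If $X^{-1}=X^{+1}$ and $K^{-1}=K^{+1}$, then $\pi(X)$ is a right process on $E=E^{-1}\cup E^{+1}$, where $\pi:\bigcup_{n\in\mathbb N}\{n\}\times E^{(-1)^n}\to E$ is the projection $\pi(n,x)=x$.
   Context: **Right processes.** Every state space $E$ is a Radon space (homeomorphic to a universally measurable subset of a compact metric space), $\mathcal E$ is the universal completion of its Borel $\sigma$-algebra, and $b\mathcal E$, $p\mathcal E$ are the bounded, resp. non-negative, $\mathcal E$-measurable functions. An isolated cemetery point $\Delta\notin E$ is adjoined to $E$; measurable functions $f$ on $E$ are extended by $f(\Delta)=0$. A Markov process on $E$ is a sextuple $X=(\Omega,\mathcal G,(\mathcal G_t)_{t\ge0},(X_t)_{t\ge0},(\Theta_t)_{t\ge0},(\mathbb P_x)_{x\in E})$ where $(X_t)$ is a right continuous process on $(\Omega,\mathcal G)$ with values in $E\cup\{\Delta\}$, adapted to $(\mathcal G_t)$, with shift operators $\Theta_t:\Omega\to\Omega$ ($X_s\circ\Theta_t=X_{s+t}$), and the $\mathbb P_x$ are probability measures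 with $\mathbb P_x(X_0=x)=1$, $x\mapsto\mathbb P_x(X_t\in B)$ measurable, and $\mathbb E_x(f(X_{s+t})\mid\mathcal G_s)=\mathbb E_{X_s}(f(X_t))$ for all $x\in E$, $s,t\ge0$, $f\in b\mathcal E$ (under $\mathbb P_\Delta$ the path is constantly $\Delta$). The state $\Delta$ is absorbing: with the lifetime $\zeta:=\inf\{t\ge0:X_t=\Delta\}$ one has $X_t=\Delta$ for all $t\ge\zeta$. There is a dead path $[\Delta]\in\Omega$ with $\zeta([\Delta])=0$; put $X_\infty:=\Delta$, $\Theta_\infty:=[\Delta]$. Filtrations are augmented and right continuous. The semigroup is $T_tf(x)=\mathbb E_x(f(X_t))$. For $\alpha\ge0$, a non-negative measurable $f$ is $\alpha$-excessive if $e^{-\alpha t}T_tf\uparrow f$ pointwise as $t\downarrow0$. $X$ is a *right process* if for all $\alpha>0$ and all $\alpha$-excessive $f$, the map $t\mapsto f(X_t)$ is a.s. right continuous. ''A.s.'' means $\mathbb P_x$-a.s. for all $x$. $(\mathcal F_t)$ denotes the (augmented) natural filtration of the process, and for a random time $T$, $\mathcal F_{T-}:=\sigma(\{A\cap\{t<T\}:t\ge0,A\in\mathcal F_t\})$. Objects belonging to $X^{\pm1}$ carry the superscript $\pm1$. **Transfer kernels.** A terminal time for $X$ is an $(\mathcal F_t)$-stopping time $T$ with $t+T\circ\Theta_t=T$ on $\{t<T\}$ (for every $t\ge0$); the lifetime is one. The left germ field $\mathcal F_{[T-]}$ at a terminal time $T$ consists of all $\mathcal F_{T-}$-measurable random variables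 $H$ such that for every $t\ge0$, $H\circ\Theta_t=H$ a.s. on $\{t<T\}$. A transfer kernel from a right process $Y$ (sample space $\Omega^Y$, lifetime $\zeta^Y$) to $(Z,E^Z)$, for a right process $Z$ on $E^Z$, is a probability kernel $K$ from $(\Omega^Y,\mathcal F^Y_{[\zeta^Y-]})$ to $(E^Z,\mathcal E^Z)$. **Copies.** For $n\in\mathbb N$ let $\widetilde X^n=\{n\}\times X^{(-1)^n}$ be the copy of $X^{(-1)^n}$ on $\widetilde E^n:=\{n\}\times E^{(-1)^n}$: it has sample space $\Omega^{(-1)^n}$, $\widetilde X^n_t=(n,X^{(-1)^n}_t)$ before the lifetime, and measures $\widetilde{\mathbb P}^n_{(n,x)}=\mathbb P^{(-1)^n}_x$. The kernel $\widetilde K^n(\omega,\cdot):=\delta_{n+1}\otimes K^{(-1)^n}(\omega,\cdot)$ is a transfer kernel from $\widetilde X^n$ to $(\widetilde X^{n+1},\widetilde E^{n+1})$. **Concatenation.** For right processes $(\widetilde X^n,n\in\mathbb N)$ on disjoint spaces $\widetilde E^n$ (with $\widetilde\Omega^n,\widetilde{\mathcal F}^n,\widetilde\Theta^n_t,\widetilde{\mathbb P}^n_x$, lifetimes $\widetilde\zeta^n$ and dead paths $[\Delta^n]$), let $\Omega:=\prod_n\widetilde\Omega^n$, $\mathcal F:=\bigotimes_n\widetilde{\mathcal F}^n$, $\zeta^{(0)}:=0$, $\zeta^{(n)}(\omega):=\widetilde\zeta^1(\omega^1)+\dots+\widetilde\zeta^n(\omega^n)$. For $\zeta^{(n-1)}(\omega)\le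 t<\zeta^{(n)}(\omega)$ set $X_t(\omega):=\widetilde X^n_{t-\zeta^{(n-1)}(\omega)}(\omega^n)$ and $\Theta_t(\omega):=([\Delta^1],\dots,[\Delta^{n-1}],\widetilde\Theta^n_{t-\zeta^{(n-1)}(\omega)}(\omega^n),\omega^{n+1},\dots)$; for $t\ge\sum_n\widetilde\zeta^n(\omega^n)$ set $X_t(\omega):=\Delta$, $\Theta_t(\omega):=([\Delta^1],[\Delta^2],\dots)$. For $z\in\widetilde E^n$, $\mathbb P_z$ is the probability measure on $(\Omega,\mathcal F)$ with, for all $m\ge n$ and bounded $\widetilde{\mathcal F}^1\otimes\dots\otimes\widetilde{\mathcal F}^m$-measurable $H$, $$\mathbb E_z(H)=\int H(\omega^1,\dots,\omega^m)\,\widetilde{\mathbb P}^m_{z^m}(d\omega^m)\,\widetilde K^{m-1}(\omega^{m-1},dz^m)\cdots\widetilde{\mathbb P}^{n+1}_{z^{n+1}}(d\omega^{n+1})\,\widetilde K^n(\omega^n,dz^{n+1})\,\widetilde{\mathbb P}^n_z(d\omega^n)\,\delta_{[\Delta^{n-1}]}(d\omega^{n-1})\cdots\delta_{[\Delta^1]}(d\omega^1).$$ The concatenation via $(\widetilde K^n)$ is this process $X$ on the topological disjoint union $\widetilde E=\bigcup_n\widetilde E^n$; it is a right process. **The process $\pi(X)$.** $Y_t:=\pi(X_t)$ (with $\pi(\Delta):=\Delta$), with shifts $\Theta_t$, the usual completion/augmentations of the $\sigma$-algebras generated by $Y$, and measures $\hat{\mathbb P}_y:=\mathbb P_z$ restricted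 to the $\sigma$-algebra generated by $Y$, for any $z\in\widetilde E$ with $\pi(z)=y\in E$. That $\pi(X)$ is a right process includes that $\hat{\mathbb P}_y$ does not depend on the choice of $z$. *)

(* Defs.v *)
From HB Require Import structures.
From mathcomp Require Import all_boot all_order all_algebra.
From mathcomp Require Import all_classical all_reals all_analysis.
From mathcomp Require Import measurable_realfun.

Set Implicit Arguments.
Unset Strict Implicit.
Unset Printing Implicit Defensive.

Import Order.TTheory GRing.Theory Num.Theory.
Import numFieldNormedType.Exports.

Local Open Scope classical_set_scope.
Local Open Scope ring_scope.
Local Open Scope ereal_scope.

(** * State spaces *)

#[short(type="pmetricType")]
HB.structure Definition PointedMetric (R : numDomainType) :=
  {M of Pointed M & Metric R M}.

Definition borelType (T : ptopologicalType) := g_sigma_algebraType (@open T).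

Definition universally_measurable (R : realType) (T : ptopologicalType)
    : set (set T) :=
  [set A | forall mu : probability (borelType T) R,
    exists B1 B2 : set (borelType T),
      [/\ measurable B1, measurable B2, B1 `<=` A, A `<=` B2
        & mu (B2 `\` B1) = 0]].

Definition univType (R : realType) (T : ptopologicalType) :=
  g_sigma_algebraType (@universally_measurable R T).

Definition radon_space (R : realType) (T : ptopologicalType) : Prop :=
  exists (M : pmetricType R) (h : T -> M),
    [/\ compact [set: M], injective h,
        forall U : set T, open U <-> exists2 V : set M, open V & h @^-1` V = U
      & universally_measurable R (range h)].

(** * Processes

  The state space with cemetery is [option E], the cemetery being [None]. A
  realization is a process without filtration; its sigma-algebra is the one
  carried by [sample]. Time is [R]: only the values at times [0 <= t] matter. *)

Record realization (R : realType) (E : Type) := Realization {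
  sample_disp : measure_display;
  sample : measurableType sample_disp;
  path : R -> sample -> option E;
  shift : R -> sample -> sample;
  dead : sample;
  law : E -> probability sample R }.

Record process (R : realType) (E : Type) := Process {
  real_of :> realization R E;
  filt : R -> set (set (sample real_of)) }.

Arguments path {R E} _ _ _.
Arguments shift {R E} _ _ _.
Arguments filt {R E} _ _ _.

(* Extension of [f] to the cemetery by [0]. *)
Definition ext (R : realType) (E : Type) (f : E -> \bar R) (x : option E)
  : \bar R := oapp f 0 x.

Section realization_defs.
Context (R : realType) (E : Type) (X : realization R E).

Definition lifetime (w : sample X) : \bar R :=
  ereal_inf [set t%:E | t in [set t : R | (0 <= t)%R /\ path X t w = None]].

Definition semigroup (t : R) (f : E -> \bar R) (x : E) : \bar R :=
  \int[law X x]_w ext f (path X t w).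

(* One measurable exceptional set must serve for all starting points. When the
   sigma-algebra is augmented, this says the same as: [A] holds almost surely
   under the law started from [mu], for every initial distribution [mu]. *)
Definition almost_surely (A : set (sample X)) : Prop :=
  exists N : set (sample X),
    [/\ measurable N, forall x, law X x N = 0 & ~` A `<=` N].

End realization_defs.

Arguments lifetime {R E} _ _.
Arguments almost_surely {R E} _ _.

(** * Augmentation *)

(* The sigma-algebra generated by the [Y t], [t \in I]. Borel sets suffice: for
   a Markov process universally measurable sets of states give the same
   sigma-algebra after augmentation. *)
Definition path_field (R : realType) (E : ptopologicalType) (W : Type)
    (Y : R -> W -> option E) (I : set R) : set (set W) :=
  <<s [set A | exists (t : R) (B : set (borelType E)),
         [/\ I t, measurable B & A = Y t @^-1` (Some @` B)]] >>.

(* [null x B] is to be read as: [B] is null for the process started from [x].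
   For an initial distribution [mu], the null sets relative to [G] are all
   subsets of those sets of [G] that are null when started from [mu]-almost
   every point. *)
Definition null_sets (R : realType) (E : ptopologicalType) (W : Type)
    (G : set (set W)) (null : E -> set W -> Prop)
    (mu : probability (borelType E) R) : set (set W) :=
  [set N | exists B : set W,
    [/\ G B, N `<=` B & {ae mu, forall x, null x B}]].

Definition augmentation (R : realType) (E : ptopologicalType) (W : Type)
    (G : set (set W)) (null : E -> set W -> Prop) (F : set (set W))
    : set (set W) :=
  [set A | forall mu : probability (borelType E) R,
     <<s F `|` null_sets G null mu >> A].

Definition law_null (R : realType) (E : Type) (X : realization R E) (x : E)
  (B : set (sample X)) : Prop := law X x B = 0.

Arguments law_null {R E} _ _ _.

Definition natural_filtration (R : realType) (E : ptopologicalType)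
    (X : realization R E) (t : R) : set (set (sample X)) :=
  augmentation R (path_field (path X) [set s | 0 <= s]%R) (law_null X)
    (path_field (path X) [set s | 0 <= s <= t]%R).

(* All null sets of the sigma-algebra of [sample X] are added, so that the
   exceptional sets of [almost_surely] do not get lost in the concatenation.
   The intrinsic null sets used in [natural_filtration] give the same
   sigma-algebra unless [sample X] has null sets that the path does not see;
   such null sets need not be stable under [shift], which is why they are kept
   out of the germ fields below. *)
Definition natural_field (R : realType) (E : ptopologicalType)
    (X : realization R E) : set (set (sample X)) :=
  augmentation R measurable (law_null X)
    (path_field (path X) [set s | 0 <= s]%R).

Arguments natural_filtration {R E} _ _ _.
Arguments natural_field {R E} _ _.

(** * Right processes *)

(* Right continuity in [option E], the cemetery being isolated. *)
Definition right_continuous_path (R : realType) (E : ptopologicalType)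
    (x : R -> option E) : Prop :=
  forall t : R, (0 <= t)%R ->
    match x t with
    | Some y => forall U, nbhs y U -> \forall s \near t^'+, (Some @` U) (x s)
    | None => \forall s \near t^'+, x s = None
    end.

Record usual_filtration (R : realType) (E : ptopologicalType)
    (X : process R E) : Prop := {
  filt_sigma : forall t : R, (0 <= t)%R -> sigma_algebra [set: sample X] (filt X t);
  filt_mono : forall s t : R, (0 <= s)%R -> (s <= t)%R -> filt X s `<=` filt X t;
  filt_sub : forall t : R, (0 <= t)%R -> filt X t `<=` measurable;
  filt_augmented : forall t : R, (0 <= t)%R ->
    augmentation R measurable (law_null X) (filt X t) `<=` filt X t;
  filt_right : forall t : R, (0 <= t)%R ->
    \bigcap_(s in [set s | t < s]%R) filt X s `<=` filt X t;
  ambient_augmented :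
    augmentation R measurable (law_null X) measurable
      `<=` (measurable : set (set (sample X))) }.

Record markov_process (R : realType) (E : ptopologicalType)
    (X : process R E) : Prop := {
  state_radon : radon_space R E;
  usual : usual_filtration X;
  path_right : forall w, right_continuous_path (fun t => path X t w);
  path_adapted : forall (t : R) (B : set (univType R E)), (0 <= t)%R ->
    measurable B -> filt X t (path X t @^-1` (Some @` B));
  path_shift : forall (s t : R) (w : sample X), (0 <= s)%R -> (0 <= t)%R ->
    path X s (shift X t w) = path X (s + t) w;
  path_absorbed : forall (t : R) (w : sample X), (0 <= t)%R ->
    lifetime X w <= t%:E -> path X t w = None;
  dead_lifetime : lifetime X (dead X) = 0;
  law_start : forall x, law X x [set w | path X 0 w = Some x] = 1;
  law_measurable : forall (t : R) (B : set (univType R E)), (0 <= t)%R ->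
    measurable B ->
    measurable_fun [set: univType R E]
      (fun x : univType R E => law X x (path X t @^-1` (Some @` B)));
  (* The conditional expectation of [f (X (s + t))] given [filt X s] under the
     law started from [x] is [semigroup t f] at [X s]. *)
  markov_property : forall (x : E) (s t : R) (f : E -> R) (A : set (sample X)),
    (0 <= s)%R -> (0 <= t)%R ->
    measurable_fun [set: univType R E] (f : univType R E -> R) ->
    (exists M, forall y, (`|f y| <= M)%R) ->
    filt X s A ->
    \int[law X x]_(w in A) ext (EFin \o f) (path X (s + t) w) =
    \int[law X x]_(w in A) ext (semigroup X t (EFin \o f)) (path X s w) }.

Definition excessive (R : realType) (E : ptopologicalType) (X : process R E)
    (a : R) (f : E -> \bar R) : Prop :=
  [/\ measurable_fun [set: univType R E] (f : univType R E -> \bar R),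
      forall x, 0 <= f x,
      forall x (s t : R), (0 < s)%R -> (s <= t)%R ->
        (expR (- (a * t)))%:E * semigroup X t f x <=
        (expR (- (a * s)))%:E * semigroup X s f x
    & forall x, (expR (- (a * t)))%:E * semigroup X t f x @[t --> 0^'+] --> f x].

Definition right_process (R : realType) (E : ptopologicalType)
    (X : process R E) : Prop :=
  markov_process X /\
  forall (a : R) (f : E -> \bar R), (0 < a)%R -> excessive X a f ->
    almost_surely X [set w : sample X | forall t : R, (0 <= t)%R ->
      ext f (path X s w) @[s --> t^'+] --> ext f (path X t w)].

(** * Transfer kernels *)

Definition strict_past (R : realType) (E : ptopologicalType) (X : process R E)
    (T : sample X -> \bar R) : set (set (sample X)) :=
  <<s [set C | exists (t : R) (A : set (sample X)),
         [/\ (0 <= t)%R, natural_filtration X t A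
           & C = A `&` [set w | t%:E < T w]]] >>.

Arguments strict_past {R E} _ _ _.

Definition left_germ_variable (R : realType) (E : ptopologicalType)
    (X : process R E) (T : sample X -> \bar R) (H : sample X -> R) : Prop :=
  measurable_fun [set: g_sigma_algebraType (strict_past X T)]
    (H : g_sigma_algebraType (strict_past X T) -> R) /\
  forall t : R, (0 <= t)%R ->
    almost_surely X [set w : sample X | t%:E < T w -> H (shift X t w) = H w].

Arguments left_germ_variable {R E} _ _ _.

Definition left_germ_field (R : realType) (E : ptopologicalType)
    (X : process R E) (T : sample X -> \bar R) : set (set (sample X)) :=
  [set A | left_germ_variable X T \1_A].

Arguments left_germ_field {R E} _ _ _.

Definition transfer_kernel (R : realType) (E E' : ptopologicalType)
    (X : process R E) : Type :=
  R.-pker g_sigma_algebraType (left_germ_field X (lifetime X)) ~>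
    univType R E'.

(** * Concatenation

  The legs are numbered from [0]. The disjoint union of the copies
  [{n} * E n] is [{n & E n}], the copying being done by [existT]. *)

Section concatenation.
Context (R : realType) (E : nat -> ptopologicalType).
Context (X : forall n, process R (E n)).
Context (K : forall n, transfer_kernel (E n.+1) (X n)).

Let W := forall n, sample (X n).

(* Cylinder sets over the coordinates selected by [I]. *)
Definition cylinders (I : set nat) : set (set W) :=
  [set C | exists n (A : set (sample (X n))),
     [/\ I n, natural_field (X n) A & C = (fun w : W => w n) @^-1` A]].

Definition concat_sample := g_sigma_algebraType (cylinders [set: nat]).

(* Total lifetime of the first [n] legs. *)
Definition lifetime_sum (n : nat) (w : W) : \bar R :=
  \sum_(i < n) lifetime (X i) (w i).

Definition current_leg (t : R) (w : W) : set nat :=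
  [set n | lifetime_sum n w <= t%:E < lifetime_sum n.+1 w].

Definition concat_path (t : R) (w : W) : option {n & E n} :=
  if pselect (exists n, current_leg t w n) is left h then
    let n := projT1 (cid h) in
    omap (existT (fun n => E n) n)
      (path (X n) (t - fine (lifetime_sum n w)) (w n))
  else None.

Definition concat_shift (t : R) (w : W) : W :=
  if pselect (exists n, current_leg t w n) is left h then
    let n := projT1 (cid h) in
    fun i => if (i < n)%N then dead (X i)
             else if i == n then shift (X i) (t - fine (lifetime_sum i w)) (w i)
             else w i
  else fun i => dead (X i).

(* Iterated integral of [H] over legs [n], ..., [n + k] started from [x] in leg
   [n]; the other coordinates are those of [w]. *)
Fixpoint leg_integral (k n : nat) (x : E n) (w : W) (H : W -> \bar R)
    : \bar R :=
  match k with
  | 0%N => \int[law (X n) x]_v H (dfwith w n v)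
  | k'.+1 => \int[law (X n) x]_v \int[K n v]_y
               leg_integral k' (y : E n.+1) (dfwith w n v) H
  end.

Definition concat_law (P : {n & E n} -> probability concat_sample R) : Prop :=
  forall n (x : E n) (k : nat) (H : W -> R),
    measurable_fun [set: g_sigma_algebraType (cylinders [set i | i <= n + k]%N)]
      (H : g_sigma_algebraType (cylinders [set i | i <= n + k]%N) -> R) ->
    (exists M, forall w, (`|H w| <= M)%R) ->
    \int[P (existT _ n x)]_w (H w)%:E =
    leg_integral k x (fun i => dead (X i)) (EFin \o H).

Definition concatenation (P : {n & E n} -> probability concat_sample R)
    : realization R {n & E n} :=
  @Realization R {n & E n} _ concat_sample concat_path concat_shift
    (fun i => dead (X i)) P.

End concatenation.

(* Leg [0] is the first copy, hence a copy of the process of index [-1]. *)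
Definition alternating_process (R : realType) (E : ptopologicalType)
    (Xm Xp : process R E) (n : nat) : process R E :=
  if odd n then Xp else Xm.

Definition alternating_kernel (R : realType) (E : ptopologicalType)
    (Xm Xp : process R E) (Km : transfer_kernel E Xm)
    (Kp : transfer_kernel E Xp) (n : nat)
    : transfer_kernel E (alternating_process Xm Xp n) :=
  if odd n as b return transfer_kernel E (if b then Xp else Xm) then Kp else Km.

(** * Image of a process under a map of the state spaces *)

Section image.
Context (R : realType) (S : Type) (E : ptopologicalType).
Context (X : realization R S) (pi : S -> E).

Definition image_path (t : R) (w : sample X) : option E := omap pi (path X t w).

(* The law of the image started from [y] comes from the law of [X] started from
   any point above [y]: null sets have to be null for all of these. *)
Definition image_null (y : E) (B : set (sample X)) : Prop :=
  forall z, pi z = y -> law X z B = 0.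

Definition image_field : set (set (sample X)) :=
  augmentation R measurable image_null
    (path_field image_path [set t | 0 <= t]%R).

Definition image_filtration (t : R) : set (set (sample X)) :=
  augmentation R measurable image_null
    (path_field image_path [set s | 0 <= s <= t]%R).

(* [P' (pi z)] is the completion of [law X z] restricted to [image_field]; in
   particular it does not depend on the choice of [z]. *)
Definition image_law (P' : E -> probability (g_sigma_algebraType image_field) R)
    : Prop :=
  forall z A, image_field A -> P' (pi z) A = ((law X z)^*)%mu A.

Definition image_process
    (P' : E -> probability (g_sigma_algebraType image_field) R) : process R E :=
  @Process R E
    (@Realization R E _ (g_sigma_algebraType image_field) image_path
       (shift X) (dead X) P')
    image_filtration.

End image.

Arguments image_path {R S E} _ _ _ _.
Arguments image_field {R S E} _ _ _.
Arguments image_filtration {R S E} _ _ _ _.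

(* Main.v *)
From HB Require Import structures.
From mathcomp Require Import all_boot all_order all_algebra finmap.
From mathcomp Require Import all_classical all_reals all_analysis.
From mathcomp Require Import measurable_realfun.
Require Import Defs.
(** When the two processes and the two kernels coincide, the concatenation
    consists of legs that all are the same process [Y], joined by the same
    kernel [K], and the projection forgets the number of the running leg. The
    projected path is called the revived path below. The result holds because
    the number of the leg carries no information: a leg that is dead from the
    start is invisible in the revived path, and the legs from number [n] on
    have the same joint law as all legs have when started in leg [0]. So the
    law of the revived path depends on the projection of the starting point
    only ([law_any_leg]), and these laws, completed, are the laws of the image
    ([image_law_exists]).

    The Markov property is proved leg by leg. During the first leg it combines
    the Markov property of [Y] at time [t] with the invariance of the transfer
    kernel under shifts before the lifetime: the kernel is a function of the
    left germ at the lifetime, so that the legs to come have the same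
    conditional law for the shifted path ([first_leg_markov]). A later leg is
    reached by conditioning on the first one ([leg_markov]). The law of the
    legs is only universally measurable in the starting point, while the state
    on a leg has to be tested on Borel sets. The property is therefore shown
    as an inequality with Borel majorants, and becomes an equality when it is
    applied to an event and to its complement ([revived_markov_version]).

    The filtration of the image has to be right continuous. The Markov property
    above holds for events known just after time [t], thanks to the right
    continuity of the filtration of [Y]. Hence the conditional probability of
    any path event, given what is known just after [t], has a version that
    depends on the path up to [t] only. For an event known just after [t] this
    version is the indicator of the event, which therefore agrees with an event
    of the past up to a null set ([right_past_trivial], [image_filt_right]).
    The completions are those of path events by sets that are null from almost
    every starting point, and a second completion adds nothing
    ([augmentation_closed]); together with the Markov property on Borel sets
    this yields a Markov process ([image_markov_process]).

    Finally, let [f] be excessive for the image. The image runs at least as long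
    as its first leg, so its semigroup dominates that of [Y]; and the two differ
    on bounded functions by at most the probability that [Y] has died, which is
    small for small times. It follows that [f] is excessive for [Y]
    ([excessive_dominated]). As [Y] is a right process, [f] is almost surely
    right continuous along [Y], hence along every leg at once, and so along the
    revived path ([image_right_process]). *)

Set Implicit Arguments.
Unset Strict Implicit.
Unset Printing Implicit Defensive.

Import Order.TTheory GRing.Theory Num.Theory.
Import numFieldNormedType.Exports.

Local Open Scope classical_set_scope.
Local Open Scope ring_scope.
Local Open Scope ereal_scope.

(** * Completion and augmentation *)

Section agree_off.
Context (T : Type).
Implicit Types A B : set T.

Definition agree_off B A A' := forall w, ~ B w -> (A w <-> A' w).

Lemma agree_off_sym B A A' : agree_off B A A' -> agree_off B A' A.
Proof. by move=> h w /h[? ?]; split. Qed.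

Lemma agree_offS B B' A A' : B `<=` B' -> agree_off B A A' -> agree_off B' A A'.
Proof. by move=> BB' h w B'w; apply: h => /BB'. Qed.

Lemma agree_offC B A A' : agree_off B A A' -> agree_off B (~` A) (~` A').
Proof. by move=> h w /h AA'; rewrite /= AA'. Qed.

Lemma agree_offI B A1 A1' A2 A2' : agree_off B A1 A1' -> agree_off B A2 A2' ->
  agree_off B (A1 `&` A2) (A1' `&` A2').
Proof. by move=> h1 h2 w Bw; rewrite /= (h1 w Bw) (h2 w Bw). Qed.

Lemma agree_off_bigcup (B A A' : nat -> set T) :
  (forall n, agree_off (B n) (A n) (A' n)) ->
  agree_off (\bigcup_n B n) (\bigcup_n A n) (\bigcup_n A' n).
Proof.
by move=> h w Bw; split => -[n _ Anw]; exists n => //;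
  apply/(h n w) => // Bnw; apply: Bw; exists n.
Qed.

End agree_off.

Section null_measure.
Context d (T : measurableType d) (R : realType) (p : {measure set T -> \bar R}).

Lemma measure_nullS (A B : set T) : measurable A -> measurable B -> A `<=` B ->
  p B = 0 -> p A = 0.
Proof.
move=> mA mB AB pB; apply/eqP; rewrite eq_le measure_ge0 andbT -pB.
by apply: le_measure => //; rewrite inE.
Qed.

Lemma measure_null_bigcup (B : nat -> set T) : (forall n, measurable (B n)) ->
  (forall n, p (B n) = 0) -> p (\bigcup_n B n) = 0.
Proof.
move=> mB pB; apply: measure_negligible; first exact: bigcup_measurable.
by apply: negligible_bigcup => k; exists (B k); split.
Qed.

Lemma measure_setU0 (A B : set T) : measurable A -> measurable B ->
  p A = 0 -> p B = 0 -> p (A `|` B) = 0.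
Proof.
move=> mA mB pA pB; apply: measure_negligible; first exact: measurableU.
by apply: negligibleU; [exists A|exists B]; split.
Qed.

Lemma measure_agree_off (A A' B : set T) : measurable A -> measurable A' ->
  measurable B -> p B = 0 -> agree_off B A A' -> p A = p A'.
Proof.
move=> mA mA' mB pB h.
have key (C : set T) : measurable C -> p C = p (C `\` B).
  move=> mC; rewrite -[in LHS](setUIDK C B) measureU //; first last.
  - by apply/seteqP; split => // x [[_ ?] []].
  - exact: measurableD.
  - exact: measurableI.
  rewrite [X in X + _](_ : _ = 0) ?add0e//.
  by apply: (@measure_nullS _ B) => //; exact: measurableI.
rewrite (key A)// (key A')//; congr (p _).
by apply/seteqP; split => w [Aw Bw]; split => //; apply/(h w Bw).
Qed.

End null_measure.

Section completion.
Context d (T : measurableType d) (R : realType) (p : probability T R).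

Lemma outer_agree_off (A A' B : set T) : measurable A' -> measurable B ->
  p B = 0 -> agree_off B A A' -> (p^*)%mu A = p A'.
Proof.
move=> mA' mB pB h; apply/eqP; rewrite eq_le; apply/andP; split.
- rewrite (@measure_agree_off _ _ _ p A' (A' `|` B) B)//; last 2 first.
  + exact: measurableU.
  + by move=> w Bw; split => [|[]]; [left|..].
  rewrite -measurable_mu_extE; last exact: measurableU.
  apply: le_mu_ext => w Aw; have [?|Bw] := pselect (B w); [by right|left].
  exact/(h w Bw).
- rewrite (@measure_agree_off _ _ _ p A' (A' `\` B) B)//; last 2 first.
  + exact: measurableD.
  + by move=> w Bw; split => [|[]].
  rewrite -measurable_mu_extE; last exact: measurableD.
  by apply: le_mu_ext => w [A'w Bw]; exact/(h w Bw).
Qed.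

Variable G : set (set T).
Hypothesis Gcompl : forall A, <<s G>> A -> exists A' B : set T,
  [/\ measurable A', measurable B, p B = 0 & agree_off B A A'].

Definition completed (A : set (g_sigma_algebraType G)) : \bar R := (p^*)%mu A.

Let completed0 : completed set0 = 0.
Proof. exact: mu_ext0. Qed.

Let completed_ge0 A : 0 <= completed A.
Proof. exact: mu_ext_ge0. Qed.

(** Disjoint sets that are measurable up to null sets become measurable and
    stay disjoint once a single null set is removed from all of them. *)
Let completed_additive : semi_sigma_additive completed.
Proof.
move=> F mF tF mUF.
have /choice[A AP] : forall i, exists A', exists B : set T,
  [/\ measurable A', measurable B, p B = 0 & agree_off B (F i) A'].
  by move=> i; exact: Gcompl (mF i).
have /choice[B BP] := AP.
pose C := \bigcup_i B i.
have mC : measurable C by apply: bigcup_measurable => i _; have [] := BP i.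
have pC : p C = 0 by apply: measure_null_bigcup => i; have [] := BP i.
have mA i : measurable (A i `\` C).
  by apply: measurableD => //; have [] := BP i.
have FA i : agree_off C (F i) (A i `\` C).
  move=> w Cw; have [_ _ _ h] := BP i.
  rewrite (h w) => [|Bw]; last by apply: Cw; exists i.
  by split => [|[]].
rewrite (_ : completed _ = p (\bigcup_i (A i `\` C))); last first.
  apply: outer_agree_off pC _ => //; first exact: bigcup_measurable.
  apply: agree_offS (agree_off_bigcup FA).
  by move=> w [_ _].
rewrite (_ : (fun n => _) = (fun n => \sum_(0 <= i < n) p (A i `\` C))).
  apply: measure_semi_sigma_additive => //; last exact: bigcup_measurable.
  move=> i j _ _ [w [[Aiw Cw] [Ajw _]]]; apply: tF => //.
  by exists w; split; apply/(FA _ _ Cw).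
apply/funext => n; apply: eq_bigr => i _.
exact: outer_agree_off pC _.
Qed.

HB.instance Definition _ := isMeasure.Build _ _ _ completed
  completed0 completed_ge0 completed_additive.

Let completedT : completed [set: T] = 1.
Proof. exact: etrans (measurable_mu_extE p (@measurableT _ T)) (probability_setT p). Qed.

HB.instance Definition _ :=
  Measure_isProbability.Build _ _ _ completed completedT.

Lemma completion_exists : exists q : probability (g_sigma_algebraType G) R,
  forall A, q A = (p^*)%mu A.
Proof. by exists completed. Qed.

End completion.

Section sigma_algebras.
Context (T : pointedType).
Implicit Types F G : set (set T).

Lemma sigma_algebra_measurableE F :
  sigma_algebra setT F -> F = @measurable _ (g_sigma_algebraType F).
Proof. by move=> ?; rewrite measurable_g_measurableTypeE. Qed.

Lemma sigma_algebra_generated F : sigma_algebra setT <<s F>>.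
Proof. exact: smallest_sigma_algebra. Qed.

Lemma sigma_algebra_C F A : sigma_algebra setT F -> F A -> F (~` A).
Proof. by case=> _ h _ FA; rewrite -setTD; exact: h. Qed.

Lemma sigma_algebra_T F : sigma_algebra setT F -> F setT.
Proof. by move=> h; rewrite -setC0; apply: sigma_algebra_C => //; case: h. Qed.

Lemma sigma_algebra_U F A B : sigma_algebra setT F -> F A -> F B -> F (A `|` B).
Proof. by move=> /sigma_algebra_measurableE ->; exact: measurableU. Qed.

Lemma sigma_algebra_I F A B : sigma_algebra setT F -> F A -> F B -> F (A `&` B).
Proof. by move=> /sigma_algebra_measurableE ->; exact: measurableI. Qed.

Lemma sigma_algebra_D F A B : sigma_algebra setT F -> F A -> F B -> F (A `\` B).
Proof. by move=> /sigma_algebra_measurableE ->; exact: measurableD. Qed.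

Lemma sigma_algebra_bigcap F (A : nat -> set T) : sigma_algebra setT F ->
  (forall n, F (A n)) -> F (\bigcap_n A n).
Proof. by move=> /sigma_algebra_measurableE ->; exact: bigcapT_measurable. Qed.

Lemma sigma_algebra_preimage (S : Type) (f : S -> T) (H : set (set S)) F :
  sigma_algebra setT H -> (forall A, F A -> H (f @^-1` A)) ->
  forall A, <<s F>> A -> H (f @^-1` A).
Proof.
move=> [H0 HC HU] FH.
suff : <<s F>> `<=` [set A | H (f @^-1` A)] by [].
apply: smallest_sub => //; split => /=.
- by rewrite preimage_set0.
- by move=> A HA; rewrite setTD preimage_setC -setTD; exact: HC.
- by move=> A HA; rewrite preimage_bigcup; exact: HU.
Qed.

End sigma_algebras.

Section augmentation.
Context (R : realType) (E : ptopologicalType) (W : pointedType).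
Variables (G : set (set W)) (null : E -> set W -> Prop).
Hypothesis Gsigma : sigma_algebra setT G.
Hypothesis null0 : forall y, null y set0.
Hypothesis null_bigcup : forall y (B : nat -> set W), (forall n, G (B n)) ->
  (forall n, null y (B n)) -> null y (\bigcup_n B n).

Definition agree_ae (mu : probability (borelType E) R) (A A' : set W) :=
  exists B, [/\ G B, agree_off B A A' & {ae mu, forall y, null y B}].

Lemma agree_ae_refl mu A : agree_ae mu A A.
Proof. by exists set0; split => //; [case: Gsigma|exact: nearW]. Qed.

Lemma agree_ae_bigcup mu (A A' : nat -> set W) :
  (forall n, agree_ae mu (A n) (A' n)) ->
  agree_ae mu (\bigcup_n A n) (\bigcup_n A' n).
Proof.
move=> /choice[B BP]; exists (\bigcup_n B n); split.
- by case: Gsigma => _ _; apply => n; have [] := BP n.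
- by apply: agree_off_bigcup => n; have [] := BP n.
- have h : forall n, {ae mu, forall y, null y (B n)} by move=> n; have [] := BP n.
  move/ae_foralln : h; apply: filterS => y yB; apply: null_bigcup => //.
  by move=> n; have [] := BP n.
Qed.

Lemma augmentation_sigma F : sigma_algebra setT (augmentation R G null F).
Proof.
split.
- by move=> mu; exact: sigma_algebra0.
- by move=> A hA mu; exact: sigma_algebraCD (hA mu).
- by move=> A hA mu; apply: sigma_algebra_bigcup => i; exact: (hA i mu).
Qed.

(** The sets that are close to [F] in this sense form a sigma-algebra, since
    countably many exceptional sets can be joined into one. *)
Lemma augmentationP (F : set (set W)) A : sigma_algebra setT F ->
  augmentation R G null F A <->
  forall mu : probability (borelType E) R,
    exists2 A', F A' & agree_ae mu A A'.
Proof.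
move=> Fsigma; split => [hA mu|hA mu].
- suff : <<s F `|` null_sets G null mu>> `<=`
      [set A | exists2 A', F A' & agree_ae mu A A'] by apply; exact: hA.
  apply: smallest_sub => [|B [FB|[N [GN BN aeN]]]] /=.
  + split => /=.
    * by exists set0; [case: Fsigma|exact: agree_ae_refl].
    * move=> B [A' FA' [N [GN h ae]]]; exists (~` A').
        exact: sigma_algebra_C.
      by exists N; split => //; rewrite setTD; exact: agree_offC.
    * move=> B BA.
      have /choice[A' A'P] : forall n, exists A', F A' /\ agree_ae mu (B n) A'.
        by move=> n; have [A' ? ?] := BA n; exists A'.
      exists (\bigcup_n A' n).
        by case: Fsigma => _ _; apply => n; have [] := A'P n.
      by apply: agree_ae_bigcup => n; have [] := A'P n.
  + by exists B => //; exact: agree_ae_refl.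
  + exists set0; first by case: Fsigma.
    by exists N; split => // w Nw; split => // /BN.
- have [A' FA' [B [GB h ae]]] := hA mu.
  have sg := @sigma_algebra_generated W (F `|` null_sets G null mu).
  have -> : A = (A' `\` (A' `&` B)) `|` (A `&` B).
    apply/seteqP; split => w.
    + move=> Aw; have [Bw|Bw] := pselect (B w); first by right.
      by left; split; [exact/(h w Bw)|move=> []].
    + by move=> [[A'w AB]|[]//]; apply/(h w) => // Bw; apply: AB.
  have inA' : <<s F `|` null_sets G null mu>> A'.
    by apply: sub_sigma_algebra; left.
  have inN (N : set W) : N `<=` B -> <<s F `|` null_sets G null mu>> N.
    by move=> NB; apply: sub_sigma_algebra; right; exists B.
  apply: (sigma_algebra_U sg); last by apply: inN => w [].
  by apply: (sigma_algebra_D sg) => //; apply: inN => w [].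
Qed.

End augmentation.

(** * Mixtures of measures *)

Section ge0_measurable_induction.
Context d (T : measurableType d) (R : realType).
Variable P : (T -> \bar R) -> Prop.
Hypothesis P_indic : forall A, measurable A -> P (fun x => (\1_A x)%:E).
Hypothesis P_add : forall f g : T -> \bar R,
  measurable_fun setT f -> measurable_fun setT g ->
  (forall x, 0 <= f x) -> (forall x, 0 <= g x) -> P f -> P g ->
  P (fun x => f x + g x).
Hypothesis P_scale : forall (k : R) (f : T -> \bar R), (0 <= k)%R ->
  measurable_fun setT f -> (forall x, 0 <= f x) -> P f ->
  P (fun x => k%:E * f x).
Hypothesis P_lim : forall f_ : nat -> T -> \bar R,
  (forall n, measurable_fun setT (f_ n)) -> (forall n x, 0 <= f_ n x) ->
  (forall x, nondecreasing_seq (f_^~ x)) -> (forall n, P (f_ n)) ->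
  P (fun x => limn (f_^~ x)).

Import HBNNSimple.

(** Measurable nonnegative functions are increasing limits of nonnegative
    simple functions. *)
Lemma ge0_measurable_ind (f : T -> \bar R) : measurable_fun setT f ->
  (forall x, 0 <= f x) -> P f.
Proof.
move=> mf f0; pose f_ := nnsfun_approx measurableT mf.
have -> : f = fun x => limn (fun n => (f_ n x)%:E).
  by apply/funext => x; apply/esym/cvg_lim => //; exact: cvg_nnsfun_approx.
apply: (P_lim (f_ := fun n x => (f_ n x)%:E)).
- by move=> n; exact/measurable_EFinP.
- by move=> n x; rewrite lee_fin.
- by move=> x m n mn; rewrite lee_fin; exact/lefP/nd_nnsfun_approx.
- move=> n; set h := f_ n; set s := fset_set (h @` setT).
  have -> : (fun x => (h x)%:E) =
      fun x => (\sum_(i < #|`s|) s`_i * \1_(h @^-1` [set s`_i]) x)%:E.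
    by apply/funext => x; rewrite fimfunEord.
  have mI r : measurable (h @^-1` [set r]) by [].
  have s0 i : (i < #|`s|)%N -> (0 <= s`_i)%R.
    move=> ilt; have : s`_i \in s by exact: mem_nth.
    by rewrite in_fset_set// => /set_mem[x _ <-].
  elim: {-2}(#|`s|) (leqnn #|`s|) => [_|m IH msz].
    rewrite (_ : (fun x => _) = fun x => (\1_set0 x)%:E).
      exact: P_indic.
    by apply/funext => x; rewrite big_ord0 indic0.
  rewrite (_ : (fun x => _) = fun x =>
    (\sum_(i < m) s`_i * \1_(h @^-1` [set s`_i]) x)%:E
      + (s`_m)%:E * (\1_(h @^-1` [set s`_m]) x)%:E); last first.
    by apply/funext => x; rewrite big_ord_recr.
  apply: P_add.
  + apply/measurable_EFinP; apply: measurable_sum => i.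
    by apply: measurable_funM => //; exact: measurable_indic.
  + apply/measurable_funeM/measurable_EFinP; exact: measurable_indic.
  + move=> x; rewrite lee_fin; apply: sumr_ge0 => i _; apply: mulr_ge0 => //.
    by apply: s0; exact: leq_trans (ltnW msz).
  + by move=> x; rewrite mule_ge0// lee_fin; exact: s0.
  + by apply: IH; exact: ltnW.
  + apply: P_scale => //; first exact: s0.
      by apply/measurable_EFinP; exact: measurable_indic.
    exact: P_indic.
Qed.

End ge0_measurable_induction.

Section mixture.
Context d d' (T : measurableType d) (W : measurableType d') (R : realType).
Variables (nu : {measure set T -> \bar R}) (kappa : T -> {measure set W -> \bar R}).
Hypothesis mkappa : forall A, measurable A -> measurable_fun setT (kappa ^~ A).

Definition mixture (A : set W) : \bar R := \int[nu]_t kappa t A.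

Let mixture0 : mixture set0 = 0.
Proof. by rewrite /mixture integral0_eq// => t _; rewrite measure0. Qed.

Let mixture_ge0 A : 0 <= mixture A.
Proof. by apply: integral_ge0 => t _; exact: measure_ge0. Qed.

Let mixture_additive : semi_sigma_additive mixture.
Proof.
move=> F mF tF mUF; rewrite [X in _ --> X](_ : _ =
    \int[nu]_t (\sum_(n <oo) kappa t (F n))); last first.
  apply: eq_integral => t _.
  by apply/esym/cvg_lim => //; exact/measure_semi_sigma_additive.
apply/cvg_closeP; split.
  by apply: is_cvg_nneseries => n _ _; exact: integral_ge0.
by rewrite closeE// integral_nneseries// => n; exact: mkappa.
Qed.

HB.instance Definition _ := isMeasure.Build _ _ _ mixture
  mixture0 mixture_ge0 mixture_additive.

Lemma mixture_measure : exists m : {measure set W -> \bar R},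
  forall A, m A = \int[nu]_t kappa t A.
Proof. by exists mixture. Qed.

Hypothesis mixtureT : mixture [set: W] = 1.

HB.instance Definition _ :=
  Measure_isProbability.Build _ _ _ mixture mixtureT.

Lemma mixture_probability_subproof : exists m : probability W R,
  forall A, m A = \int[nu]_t kappa t A.
Proof. by exists mixture. Qed.

End mixture.

Lemma mixture_probability d d' (T : measurableType d) (W : measurableType d')
    (R : realType) (nu : probability T R) (kappa : T -> probability W R) :
  (forall A, measurable A -> measurable_fun setT (kappa ^~ A)) ->
  exists m : probability W R, forall A, m A = \int[nu]_t kappa t A.
Proof.
move=> mk.
have mk' : forall A, measurable A ->
  measurable_fun setT ((kappa : T -> {measure set W -> \bar R}) ^~ A) by exact: mk.
apply: (mixture_probability_subproof mk').
rewrite /mixture (eq_integral (cst 1)) => [|t _]; last exact: probability_setT.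
by rewrite integral_cst// mul1e; exact: probability_setT.
Qed.

Lemma integral_mixture d d' (T : measurableType d) (W : measurableType d')
    (R : realType) (nu : {measure set T -> \bar R})
    (kappa : T -> {measure set W -> \bar R}) (m : {measure set W -> \bar R}) :
  (forall A, measurable A -> measurable_fun setT (kappa ^~ A)) ->
  (forall A, measurable A -> m A = \int[nu]_t kappa t A) ->
  forall f : W -> \bar R, measurable_fun setT f -> (forall w, 0 <= f w) ->
    \int[m]_w f w = \int[nu]_t \int[kappa t]_w f w.
Proof.
move=> mk mE f mf f0.
have mI g : measurable_fun setT g -> (forall w, 0 <= g w) ->
    measurable_fun setT (fun t => \int[kappa t]_w g w).
  by move=> mg g0; exact: measurable_fun_integral_kernel.
apply: (@ge0_measurable_ind _ W R (fun f =>
  \int[m]_w f w = \int[nu]_t \int[kappa t]_w f w) _ _ _ _ f mf f0) =>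
  {f mf f0} [A mA|f g mf mg f0 g0 fE gE|k f k0 mf f0 fE|f_ mf_ f0_ nd fE].
- rewrite integral_indic// setIT mE//.
  by apply: eq_integral => t _; rewrite integral_indic// setIT.
- transitivity (\int[nu]_t (\int[kappa t]_w f w + \int[kappa t]_w g w)).
    rewrite (ge0_integralD _ measurableT _ mf _ mg)// fE gE.
    rewrite (ge0_integralD _ measurableT _ (mI f mf f0) _ (mI g mg g0)) => [//|t _|t _];
      exact: integral_ge0.
  apply: eq_integral => t _.
  by rewrite (ge0_integralD _ measurableT _ mf _ mg).
- rewrite (ge0_integralZl _ measurableT mf) => [|w _|]; [|exact: f0|exact: k0].
  rewrite fE -(ge0_integralZl _ measurableT (mI f mf f0)); last 2 first.
  + by move=> t _; exact: integral_ge0.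
  + exact: k0.
  apply: eq_integral => t _.
  by rewrite (ge0_integralZl _ measurableT mf) => [//|w _|]; [exact: f0|exact: k0].
- transitivity (\int[nu]_t limn (fun n => \int[kappa t]_w f_ n w)).
    rewrite (monotone_convergence _ measurableT mf_); last 2 first.
    + by move=> n w _; exact: f0_.
    + by move=> w _; exact: nd.
    rewrite (monotone_convergence _ measurableT (fun n => mI _ (mf_ n) (f0_ n))).
    + by congr (limn _); apply/funext => n; exact: fE.
    + by move=> n t _; apply: integral_ge0 => w _; exact: f0_.
    + move=> t _ a b ab; apply: ge0_le_integral => //.
      by move=> w _; exact: nd.
  by apply: eq_integral => t _; rewrite (monotone_convergence _ measurableT mf_).
Qed.

(** * Universally measurable sets *)

Section univ.
Context (R : realType) (E : ptopologicalType).
Notation BE := (borelType E).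
Notation UE := (univType R E).
Implicit Types mu : probability BE R.

(** Equality off a null set is a form of universal measurability that passes
    to complements and countable unions at once. *)
Lemma universally_measurableP (A : set E) : universally_measurable R A <->
  forall mu, exists A' B : set BE,
    [/\ measurable A', measurable B, mu B = 0 & agree_off B A A'].
Proof.
split=> h mu; have [A' [B [mA' mB]]] := h mu.
- move=> A'A AB mu0; exists A', (B `\` A'); split => //.
    exact: measurableD.
  move=> y By; split => [/AB By'|/A'A//].
  by have [//|A'y] := pselect (A' y); exfalso; apply: By.
- move=> mu0 AA'; exists (A' `\` B), (A' `|` B); split.
  + exact: measurableD.
  + exact: measurableU.
  + by move=> y [A'y By]; exact/(AA' y By).
  + move=> y Ay; have [?|By] := pselect (B y); [by right|left].
    exact/(AA' y By).
  + apply: (measure_nullS _ mB) mu0; last first.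
      by move=> y [[A'y|//] h0]; have [//|By] := pselect (B y); exfalso; apply: h0.
    by apply: measurableD; [exact: measurableU|exact: measurableD].
Qed.

Lemma universally_measurable_sigma :
  sigma_algebra [set: E] (@universally_measurable R E).
Proof.
split.
- by apply/universally_measurableP => mu; exists set0, set0; split.
- move=> A /universally_measurableP hA.
  apply/universally_measurableP => mu; have [A' [B [mA' mB mu0 AA']]] := hA mu.
  exists (~` A'), B; split => //; first exact: measurableC.
  by rewrite setTD; exact: agree_offC.
- move=> A hA; apply/universally_measurableP => mu.
  have /choice[A' A'P] : forall n, exists A', exists B : set BE,
      [/\ measurable A', measurable B, mu B = 0 & agree_off B (A n) A'].
    by move=> n; have /universally_measurableP := hA n; exact.
  have /choice[B BP] := A'P.
  exists (\bigcup_n A' n), (\bigcup_n B n); split.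
  + by apply: bigcup_measurable => n _; have [] := BP n.
  + by apply: bigcup_measurable => n _; have [] := BP n.
  + by apply: measure_null_bigcup => n; have [] := BP n.
  + by apply: agree_off_bigcup => n; have [] := BP n.
Qed.

Lemma measurable_univ (A : set UE) :
  measurable A <-> universally_measurable R (A : set E).
Proof.
have h := measurable_g_measurableTypeE universally_measurable_sigma.
by have -> : measurable A = universally_measurable R (A : set E)
  := congr1 (@^~ A) h.
Qed.

Lemma measurable_univP (A : set UE) : measurable A <->
  forall mu, exists A' B : set BE,
    [/\ measurable A', measurable B, mu B = 0 & agree_off B A A'].
Proof. by rewrite measurable_univ universally_measurableP. Qed.

Lemma borel_univ (A : set E) :
  measurable (A : set BE) -> measurable (A : set UE).
Proof. by move=> mA; apply/measurable_univP => mu; exists A, set0; split. Qed.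

Lemma borel_univ_fun d (T : measurableType d) (f : E -> T) :
  measurable_fun setT (f : BE -> T) -> measurable_fun setT (f : UE -> T).
Proof.
move=> mf _ A mA; rewrite setTI; apply: borel_univ.
by have := mf measurableT A mA; rewrite setTI.
Qed.

Lemma univ_extension mu : exists m : probability UE R,
  [/\ forall A, measurable (A : set BE) -> m A = mu A &
      forall A' A B, measurable (A' : set BE) -> measurable (B : set BE) ->
        mu B = 0 -> agree_off B A A' -> m A = mu A'].
Proof.
have [m mE] : exists q : probability UE R, forall A, q A = (mu^*)%mu A.
  apply: (@completion_exists _ BE R mu (@universally_measurable R E)) => A mA.
  exact: (measurable_univP A).1 mA mu.
exists m; split => [A mA|A' A B mA' mB mu0 AA']; rewrite mE.
  exact: measurable_mu_extE.
exact: outer_agree_off AA'.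
Qed.

(** A universally measurable null set is contained in a Borel null set. *)
Lemma univ_ae mu (m : probability UE R) (P : E -> Prop) :
  (forall A, measurable (A : set BE) -> m A = mu A) ->
  {ae m, forall y, P y} -> {ae mu, forall y, P y}.
Proof.
move=> mE [N [mN N0 PN]].
have [A' [B [mA' mB mu0 NA']]] := (measurable_univP N).1 mN mu.
exists (A' `|` B); split.
- exact: measurableU.
- apply: measure_setU0 => //; apply: (etrans (esym (mE _ mA'))); rewrite -N0.
  apply: (@measure_agree_off _ _ _ m _ _ B) => //; try exact: borel_univ.
    exact: etrans (mE _ mB) mu0.
  exact: agree_off_sym.
- move=> y /PN Ny; have [?|By] := pselect (B y); [by right|left].
  exact/(NA' y By).
Qed.

(** The version [u'] may change with the probability: so may the Borel
    approximations of a universally measurable set. *)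
Lemma univ_measurable_ae d (T : measurableType d) (u : E -> T) :
  (forall mu, exists u' : E -> T, measurable_fun setT (u' : UE -> T) /\
    {ae mu, forall y, u y = u' y}) -> measurable_fun setT (u : UE -> T).
Proof.
move=> h _ A mA; rewrite setTI; apply/measurable_univP => mu.
have [u' [mu' [N [mN N0 uN]]]] := h mu.
have := mu' measurableT A mA; rewrite setTI => /measurable_univP.
move=> /(_ mu)[A' [B [mA' mB mu0 NA']]]; exists A', (B `|` N); split => //.
- exact: measurableU.
- exact: measure_setU0.
- move=> y BNy; rewrite -(NA' y) => [|?]; last by apply: BNy; left.
  suff -> : (u @^-1` A) y = (u' @^-1` A) y by [].
  have uy : u y = u' y by apply: contrapT => ?; apply: BNy; right; exact: uN.
  by rewrite /preimage /= uy.
Qed.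

Lemma mnormalize_null (la : {measure set BE -> \bar R}) (p : probability BE R)
  (B : set BE) : la setT < +oo -> measurable B -> mnormalize la p B = 0 ->
  la B = 0.
Proof.
move=> lafin mB; rewrite /mnormalize.
case: ifPn => [/orP[/eqP la0 _|/eqP laoo]|].
- by apply: (measure_nullS mB measurableT) la0.
- by move: lafin; rewrite laoo.
- rewrite negb_or => /andP[la0 laoo] /eqP; rewrite mule_eq0 => /orP[/eqP//|].
  rewrite eqe invr_eq0 fine_eq0 ?(negbTE la0)//.
  by rewrite ge0_fin_numE// ltey.
Qed.

(** Normalization gives a probability with the same null sets, unless the
    measure is zero, when every set is null. *)
Lemma univ_sandwich_measure (la : {measure set BE -> \bar R}) (A : set E) :
  la setT < +oo -> universally_measurable R A ->
  exists A' B : set BE,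
    [/\ measurable A', measurable B, la B = 0 & agree_off B A A'].
Proof.
move=> lafin /universally_measurableP.
move=> /(_ (mnormalize la (dirac point)))[A' [B [mA' mB mu0 AA']]].
by exists A', B; split => //; apply: mnormalize_null mu0.
Qed.

(** A Borel majorant that is almost everywhere equal: the infimum, over the
    rationals, of the functions equal to [q] off a Borel majorant of
    [[u > q]]. *)
Lemma univ_borel_majorant (la : {measure set BE -> \bar R}) (u : E -> \bar R) :
  la setT < +oo -> measurable_fun setT (u : UE -> \bar R) ->
  (forall y, 0 <= u y <= 1) ->
  exists (u' : E -> \bar R) (N : set BE),
    [/\ measurable_fun setT (u' : BE -> \bar R), measurable N, la N = 0,
        forall y, u y <= u' y <= 1 & forall y, ~ N y -> u' y = u y].
Proof.
move=> lafin mu01 u01.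
(* An enumeration of the rationals; codes of no rational give [0]. *)
pose q (n : nat) : R := ratr (odflt 0%R (@choice.unpickle rat n)).
pose A n := [set y | (q n)%:E < u y].
have mA n : universally_measurable R (A n).
  apply/measurable_univ; rewrite (_ : A n = [set: UE] `&` [set y | (q n)%:E < u y]).
    by apply: emeasurable_fun_o_infty.
  by rewrite setTI.
have /choice[A' A'P] : forall n, exists A', exists B : set BE,
    [/\ measurable A', measurable B, la B = 0 & agree_off B (A n) A'].
  by move=> n; exact: univ_sandwich_measure.
have /choice[B BP] := A'P.
pose C n : set BE := A' n `|` B n.
pose v n (y : E) : \bar R := if y \in C n then 1 else (q n)%:E.
have mC n : measurable (C n) by apply: measurableU; have [] := BP n.
have mv n : measurable_fun setT (v n : BE -> \bar R).
  apply: measurable_fun_if => //; first by apply: (measurable_fun_bool true);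
    rewrite setTI preimage_mem_true.
have AC n : A n `<=` C n.
  move=> y Ay; have [By|By] := pselect (B n y); [by right|left].
  by have [_ _ _] := BP n; move=> /(_ y By)[+ _]; apply.
exists (fun y => mine 1 (einfs (fun n => v n y) 0%N)), (\bigcup_n B n); split.
- apply: measurable_mine => //;
  exact: (@measurable_fun_einfs _ _ _ setT (fun n => v n : BE -> \bar R)).
- by apply: bigcup_measurable => n _; have [] := BP n.
- by apply: measure_null_bigcup => n; have [] := BP n.
- move=> y; rewrite ge_min lexx/= andbT le_min; have /andP[_ ->] := u01 y.
  rewrite /= /einfs; apply: le_ereal_inf_tmp => _ [n _ <-].
  rewrite /v; case: ifPn => [_|yC]; first by case/andP: (u01 y).
  rewrite leNgt; apply: contra yC => ulty; apply/mem_set; exact: AC.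
- move=> y Ny; apply/eqP; rewrite eq_le; apply/andP; split; last first.
    rewrite le_min; case/andP: (u01 y) => _ ->.
    rewrite /= /einfs; apply: le_ereal_inf_tmp => _ [n _ <-].
    rewrite /v; case: ifPn => [_|yC]; first by case/andP: (u01 y).
    by rewrite leNgt; apply: contra yC => ulty; apply/mem_set; exact: AC.
  have [u1|] := eqVneq (u y) 1; first by rewrite u1 ge_min lexx.
  case/andP: (u01 y) => u0 ule1 une1.
  have ult1 : u y < 1 by rewrite lt_neqAle une1.
  have ufin : u y \is a fin_num.
    by rewrite ge0_fin_numE//; exact: lt_trans ult1 (ltry _).
  rewrite ge_min; apply/orP; right.
  rewrite -(fineK ufin); apply/lee_addgt0Pr => e e0.
  have /rat_in_itvoo[r] : (fine (u y) < fine (u y) + e)%R by rewrite ltrDl.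
  rewrite in_itv/= => /andP[ur re].
  pose n := choice.pickle r.
  have qn : q n = ratr r by rewrite /q choice.pickleK.
  apply: (@le_trans _ _ (v n y)).
    by apply: ereal_inf_lbound; exists n.
  rewrite /v ifF ?qn; first by rewrite lee_fin ltW.
  apply/negbTE; rewrite notin_setE => -[A'y|By]; last by apply: Ny; exists n.
  have [_ _ _] := BP n; move=> /(_ y) [|_ /(_ A'y)].
    by move=> By; apply: Ny; exists n.
  rewrite /A /= qn -(fineK ufin) lte_fin => /lt_trans /(_ ur).
  by rewrite ltxx.
Qed.

End univ.

(** * Right continuous paths at random times *)

Section radon_topology.
Context (R : realType) (E : ptopologicalType).
Hypothesis Eradon : radon_space R E.

Lemma radon_closed1 (x : E) : closed [set x].
Proof.
have [M [h [_ hinj hopen _]]] := Eradon.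
rewrite -[X in closed X]setCK; apply: open_closedC; apply/hopen.
exists (~` [set h x]).
  apply: closed_openC; apply: accessible_closed_set1.
  exact/hausdorff_accessible/metric_hausdorff.
by apply/seteqP; split => y /= hy; [move=> yx; apply: hy; rewrite yx|move/hinj].
Qed.

Lemma measurable_set1_radon (x : E) : measurable ([set x] : set (borelType E)).
Proof.
rewrite -[X in measurable X]setCK; apply: measurableC.
by apply: sub_sigma_algebra; exact/closed_openC/radon_closed1.
Qed.

(** [F n] is the closure of the set of points whose ball of radius [1 / (n +
    1)], for the metric of the ambient compact space, stays in the open set. *)
Lemma radon_open_exhaustion (U : set E) : open U -> exists F : nat -> set E,
  [/\ forall n, closed (F n), forall n, F n `<=` U
    & forall y, U y -> exists n, nbhs y (F n)].
Proof.
have [M [h [_ hinj hopen _]]] := Eradon.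
move=> /hopen[V Vopen <-].
have hnbhs (y : E) (e : R) : (0 < e)%R -> nbhs y (h @^-1` ball (h y) e).
  move=> e0; rewrite nbhsE; exists (h @^-1` (ball (h y) e)^°).
    split; first by apply/hopen; exists (ball (h y) e)^° => //; exact: open_interior.
    by apply: nbhsx_ballx.
  by move=> z; exact: interior_subset.
pose F n := closure (h @^-1` [set z | ball z (n.+1%:R^-1 : R) `<=` V]).
exists F; split.
- by move=> n; exact: closed_closure.
- move=> n y Fy.
  have n0 : (0 < n.+1%:R^-1 :> R)%R by rewrite invr_gt0.
  have [z [/= zV yz]] := Fy _ (hnbhs y _ n0).
  by apply: zV; exact: ball_sym.
- move=> y Vy.
  have : nbhs (h y) V by exact: open_nbhs_nbhs.
  move=> /nbhs_ballP[e /= e0 eV].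
  have e20 : (0 < e / 2)%R by rewrite divr_gt0.
  have [n _ nP] := near_infty_natSinv_lt (PosNum e20).
  exists n; apply: filterS (hnbhs y _ e20) => z /= yz.
  apply: subset_closure => w /= zw; apply: eV.
  rewrite (splitr e); apply: ball_triangle yz _.
  by apply: le_ball zw; apply: ltW; exact: (nP n (leqnn n)).
Qed.

End radon_topology.

Section random_time.
Context (R : realType) (E : ptopologicalType).

Lemma near_rightP (P : set R) (t : R) : (\forall s \near t^'+, P s) ->
  exists2 e : R, (0 < e)%R & forall s, (t < s)%R -> (s < t + e)%R -> P s.
Proof.
move=> /nbhs_ballP[e /= e0 eP]; exists e => // s ts ste.
by apply: eP => //=; rewrite /ball/= ltr_distlC; rewrite ste andbT ltrBlDr;
  apply: lt_trans ts _; rewrite ltrDl.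
Qed.

Lemma right_continuous_some (x : R -> option E) (t : R) (y : E) (U : set E) :
  (0 <= t)%R -> right_continuous_path x -> x t = Some y -> nbhs y U ->
  \forall s \near t^'+, (Some @` U) (x s).
Proof. by move=> t0 /(_ t t0) + xt; rewrite xt; exact. Qed.

Lemma right_continuous_none (x : R -> option E) (t : R) :
  (0 <= t)%R -> right_continuous_path x -> x t = None ->
  \forall s \near t^'+, x s = None.
Proof. by move=> t0 /(_ t t0) + xt; rewrite xt. Qed.

Hypothesis Eradon : radon_space R E.
Context d (T : measurableType d) (X : R -> T -> option E) (rho : T -> R).
Hypothesis Xright : forall w, right_continuous_path (X^~ w).
Hypothesis Xmeas : forall t (B : set (borelType E)), (0 <= t)%R -> measurable B ->
  measurable (X t @^-1` (Some @` B)).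
Hypothesis mrho : measurable_fun setT rho.
Hypothesis rho0 : forall w, (0 <= rho w)%R.

(** The times [(j + 1) / (k + 1)] just after [rho] tend to [rho] from the
    right. By right continuity the path is in an open set at time [rho]
    exactly when, along these times, it eventually stays in one of the closed
    sets that exhaust the open set. *)
Lemma measurable_random_time (B : set (borelType E)) : measurable B ->
  measurable [set w | (Some @` B) (X (rho w) w)].
Proof.
have mopen (U : set E) : open U -> measurable [set w | (Some @` U) (X (rho w) w)].
  move=> Uopen; have [F [Fclosed FU UF]] := radon_open_exhaustion Eradon Uopen.
  pose S k m : set T := \bigcup_j ([set w | (j%:R <= k.+1%:R * rho w < j.+1%:R)%R]
     `&` (X (j.+1%:R / k.+1%:R) @^-1` (Some @` F m))).
  have SP k m w : S k m w <->
    (Some @` F m) (X ((Num.truncn (k.+1%:R * rho w)).+1%:R / k.+1%:R) w).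
    have kr : (0 <= k.+1%:R * rho w)%R by rewrite mulr_ge0.
    split=> [[j _ [/= jk]]|Fw].
      by rewrite (truncn_def jk).
    by exists (Num.truncn (k.+1%:R * rho w)) => //; split => //=; exact: truncn_itv.
  pose s (k : nat) w : R := ((Num.truncn (k.+1%:R * rho w)).+1%:R / k.+1%:R)%R.
  have sgt k w : (rho w < s k w)%R.
    rewrite /s ltr_pdivlMr// mulrC.
    by have /andP[] := truncn_itv (mulr_ge0 (ler0n R k.+1) (rho0 w)).
  have sle k w : (s k w <= rho w + k.+1%:R^-1)%R.
    rewrite /s ler_pdivrMr// mulrDl mulVf// -natr1 lerD2r [leRHS]mulrC.
    by have /andP[] := truncn_itv (mulr_ge0 (ler0n R k.+1) (rho0 w)).
  have slim w (P : set R) : (\forall u \near (rho w)^'+, P u) ->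
      exists k0, forall k, (k0 <= k)%N -> P (s k w).
    move=> /near_rightP[e e0 eP].
    have [k0 _ k0P] := near_infty_natSinv_lt (PosNum e0).
    exists k0 => k k0k; apply: eP => //.
    by apply: le_lt_trans (sle k w) _; rewrite ltrD2l; exact: k0P.
  rewrite (_ : [set w | _] =
      \bigcup_m \bigcup_k0 \bigcap_(k in [set k | (k0 <= k)%N]) S k m).
    apply: bigcup_measurable => m _; apply: bigcup_measurable => k0 _.
    apply: bigcap_measurable.
      by exists k0 => /=; rewrite leqnn.
    move=> k _.
    apply: bigcup_measurable => j _; apply: measurableI.
      have mk : measurable_fun setT (fun w => k.+1%:R * rho w)%R.
        by apply: measurable_funM.
      rewrite -[X in measurable X]setTI.
      rewrite (_ : [set w | _] = (fun w => k.+1%:R * rho w)%R @^-1` `[j%:R, j.+1%:R[).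
        by apply: mk.
      by apply/seteqP; split => w /=; rewrite in_itv/=.
    apply: Xmeas; first by rewrite divr_ge0.
    rewrite -[X in measurable X]setCK; apply: measurableC.
    by apply: sub_sigma_algebra; exact: closed_openC.
  apply/seteqP; split => w /=.
  - move=> [y Uy yw]; have [m ym] := UF y Uy; exists m => //.
    have [k0 k0P] := slim w _
      (right_continuous_some (rho0 w) (Xright w) (esym yw) ym).
    by exists k0 => // k /= /k0P ?; apply/SP.
  - move=> [m _ [k0 _ wS]].
    case yw : (X (rho w) w) => [y|]; last first.
      have [k1 k1P] := slim w _ (right_continuous_none (rho0 w) (Xright w) yw).
      have /SP[z _ zX] := wS (maxn k0 k1) (leq_maxl _ _).
      by have := k1P (maxn k0 k1) (leq_maxr _ _); rewrite /s -zX.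
    exists y => //; apply: (FU m); apply: (Fclosed m) => V Vy.
    have [k1 k1P] := slim w _ (right_continuous_some (rho0 w) (Xright w) yw Vy).
    have /SP[z Fz zX] := wS (maxn k0 k1) (leq_maxl _ _).
    have [z' Vz' z'X] := k1P (maxn k0 k1) (leq_maxr _ _).
    exists z; split => //.
    by move: z'X; rewrite /s -zX => -[<-].
move=> mB.
suff : <<s @open E>> `<=`
    [set B | measurable [set w | (Some @` B) (X (rho w) w)]] by apply.
apply: smallest_sub => //; split => /=.
- by rewrite (_ : [set _ | _] = set0)//; apply/seteqP; split => w // [].
- move=> A mA; rewrite (_ : [set _ | _] = [set w | (Some @` setT) (X (rho w) w)] `\`
      [set w | (Some @` A) (X (rho w) w)]).
    by apply: measurableD => //; apply: mopen; exact: openT.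
  apply/seteqP; split => w /=.
    move=> [y [_ Ay] yw]; split; first by exists y.
    by move=> [z Az]; rewrite -yw => -[zy]; apply: Ay; rewrite -zy.
  move=> [[y _ yw] Aw]; exists y => //; split => // Ay; apply: Aw.
  by exists y.
- move=> A mA; rewrite (_ : [set _ | _] =
      \bigcup_n [set w | (Some @` A n) (X (rho w) w)]).
    by apply: bigcup_measurable => n _; exact: mA.
  apply/seteqP; split => w /=.
    by move=> [y [n _ Any] yw]; exists n => //; exists y.
  by move=> [n _ [y Any yw]]; exists y => //; exists n.
Qed.

End random_time.

(** * Generating pi-systems and hitting laws *)

Section pi_systems.

(** The sets of equal measure form a Dynkin system; finiteness serves the
    complements. *)
Lemma pi_measure_eq d (T : measurableType d) (R : realType) (G : set (set T))
    (m1 m2 : {measure set T -> \bar R}) :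
  @measurable _ T = <<s G>> -> setI_closed G ->
  m1 setT < +oo -> m1 setT = m2 setT -> (forall A, G A -> m1 A = m2 A) ->
  forall A, measurable A -> m1 A = m2 A.
Proof.
move=> TG GI m1fin mT mG A; rewrite {1}TG.
apply: (@dynkin_induction _ _ G (fun A => m1 A = m2 A)) => //.
- move=> S mS mE.
  have mfin (m : {measure set T -> \bar R}) : m setT < +oo -> m S \is a fin_num.
    move=> mfin; rewrite ge0_fin_numE// (le_lt_trans _ mfin)//.
    by apply: le_measure => //; apply/mem_set.
  have h (m : {measure set T -> \bar R}) : m setT < +oo -> m (~` S) = m setT - m S.
    move=> /mfin mSf; rewrite -(setvU S) measureU//; last by rewrite setICl.
      by rewrite addeK.
    exact: measurableC.
  by rewrite !h -?mT// mE.
- move=> F mF tF mE.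
  rewrite !measure_bigcup//; apply: eq_eseriesr => i _; exact: mE.
Qed.

Lemma pi_kernel_measurable d d' (T : measurableType d) (W : measurableType d')
    (R : realType) (G : set (set W)) (kappa : T -> probability W R) :
  @measurable _ W = <<s G>> -> setI_closed G ->
  (forall A, G A -> measurable_fun setT (kappa ^~ A)) ->
  forall A, measurable A -> measurable_fun setT (kappa ^~ A).
Proof.
move=> WG GI mG A; rewrite {1}WG.
apply: (@dynkin_induction _ _ G (fun A => measurable_fun setT (kappa ^~ A))) => //.
- rewrite (_ : (fun t => _) = cst 1)//.
  by apply/funext => t; exact: probability_setT.
- move=> S mS mk; rewrite (_ : (fun t => _) = fun t => 1 - kappa t S).
    by apply: emeasurable_funB.
  by apply/funext => t; exact: probability_setC.
- move=> F mF tF mk; rewrite (_ : (fun t => _) = fun t => \sum_(n <oo) kappa t (F n)).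
    by apply: ge0_emeasurable_sum.
  by apply/funext => t; rewrite measure_bigcup//; apply: eq_eseriesl => n; rewrite in_setT.
Qed.

End pi_systems.

Section ext_lemmas.
Context (R : realType) (S : Type).

Lemma ext_ge0 (f : S -> \bar R) : (forall y, 0 <= f y) -> forall o, 0 <= ext f o.
Proof. by move=> f0 [y|] /=. Qed.

Lemma ext_indic (B : set S) o :
  ext (fun y => (\1_B y)%:E) o = (\1_(Some @` B) o)%:E :> \bar R.
Proof.
case: o => [y|]; rewrite /ext/= !indicE.
  congr (_%:R%:E); congr nat_of_bool; apply/idP/idP => /set_mem.
    by move=> By; apply/mem_set; exists y.
  by move=> [z Bz [<-]]; exact/mem_set.
by rewrite memNset// => -[].
Qed.

Lemma preimage_some_bigcup (T : Type) (Z : T -> option S) (F : nat -> set S) :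
  Z @^-1` (Some @` \bigcup_n F n) = \bigcup_n (Z @^-1` (Some @` F n)).
Proof.
apply/seteqP; split => w /=.
  by move=> [y [n _ Fy] yw]; exists n => //; exists y.
by move=> [n _ [y Fy yw]]; exists y => //; exists n.
Qed.

End ext_lemmas.

Section hitting_law.
Context d d' (T : measurableType d) (S : measurableType d') (R : realType).
Variables (m : {measure set T -> \bar R}) (D : set T) (Z : T -> option S).
Hypothesis mD : measurable D.
Hypothesis mZ : forall B, measurable B -> measurable (Z @^-1` (Some @` B)).

(** Only the part of [D] where [Z] takes a value in [S] is transported: the
    mass of [Z = None] is dropped. *)
Definition hitting_law (B : set S) : \bar R := m (D `&` Z @^-1` (Some @` B)).

Let hitting_law0 : hitting_law set0 = 0.
Proof.
rewrite /hitting_law (_ : _ `&` _ = set0) ?measure0//.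
by apply/seteqP; split => w // [_ []].
Qed.

Let hitting_law_ge0 B : 0 <= hitting_law B.
Proof. exact: measure_ge0. Qed.

Let hitting_law_additive : semi_sigma_additive hitting_law.
Proof.
move=> F mF tF mUF; rewrite /hitting_law preimage_some_bigcup setI_bigcupr.
apply: measure_semi_sigma_additive.
- by move=> n; apply: measurableI => //; exact: mZ.
- move=> i j _ _ [w [[_ [y Fy yw]] [_ [y' Fy' y'w]]]]; apply: tF => //.
  by exists y; split => //; move: y'w; rewrite -yw => -[<-].
- by apply: bigcup_measurable => n _; apply: measurableI => //; exact: mZ.
Qed.

HB.instance Definition _ := isMeasure.Build _ _ _ hitting_law
  hitting_law0 hitting_law_ge0 hitting_law_additive.

Lemma measurable_ext (f : S -> \bar R) : measurable_fun setT f ->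
  measurable_fun setT (fun w => ext f (Z w)).
Proof.
move=> mf _ A mA; rewrite setTI.
have mfA : measurable (f @^-1` A) by rewrite -[X in measurable X]setTI; exact: mf.
rewrite (_ : _ @^-1` A = Z @^-1` (Some @` (f @^-1` A)) `|`
    (if `[< A 0 >] then ~` (Z @^-1` (Some @` setT)) else set0)).
  apply: measurableU; first exact: mZ.
  by case: ifP => // _; apply: measurableC; exact: mZ.
apply/seteqP; split => w /=.
- case Zw : (Z w) => [y|] /= h; first by left; exists y.
  right; rewrite ifT; last exact/asboolP.
  by move=> [y _]; rewrite Zw.
- move=> [[y Ay <-]//|]; case: asboolP => // A0.
  case Zw : (Z w) => [y|//] h; exfalso; apply: h; by exists y.
Qed.

Lemma integral_hitting_law (f : S -> \bar R) : measurable_fun setT f ->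
  (forall y, 0 <= f y) ->
  \int[m]_(w in D) ext f (Z w) = \int[hitting_law]_y f y.
Proof.
move=> mf f0.
apply: (@ge0_measurable_ind _ S R (fun f =>
  \int[m]_(w in D) ext f (Z w) = \int[hitting_law]_y f y) _ _ _ _ f mf f0) =>
  {f mf f0} [A mA|f g mf mg f0 g0 fE gE|k f k0 mf f0 fE|f_ mf_ f0_ nd fE].
- rewrite integral_indic// setIT; under eq_integral do rewrite ext_indic.
  rewrite (_ : (fun w => _) = fun w => (\1_(Z @^-1` (Some @` A)) w)%:E)//.
  by rewrite integral_indic//; [rewrite /hitting_law setIC|exact: mZ].
- have mm (f' : S -> \bar R) (mf' : measurable_fun setT f') :
    measurable_fun D (fun w => ext f' (Z w)).
    by apply: measurable_funTS; exact: measurable_ext.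
  rewrite (ge0_integralD _ measurableT _ mf _ mg)// -fE -gE.
  rewrite -(ge0_integralD _ mD _ (mm _ mf) _ (mm _ mg)) => [|w _|w _];
    [|exact: ext_ge0..].
  by apply: eq_integral => w _; case: (Z w) => //=; rewrite adde0.
- rewrite (ge0_integralZl _ measurableT mf) => [|w _|]; [|exact: f0|exact: k0].
  have mm : measurable_fun D (fun w => ext f (Z w)).
    by apply: measurable_funTS; exact: measurable_ext.
  rewrite -fE -(ge0_integralZl _ mD mm) => [|w _|]; [|exact: ext_ge0|exact: k0].
  by apply: eq_integral => w _; case: (Z w) => //=; rewrite mule0.
- rewrite (monotone_convergence _ measurableT mf_); last 2 first.
    by move=> n w _; exact: f0_.
    by move=> w _; exact: nd.
  rewrite -(funext fE).
  have mm n : measurable_fun D (fun w => ext (f_ n) (Z w)).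
    by apply: measurable_funTS; exact: measurable_ext.
  rewrite -(monotone_convergence _ mD mm).
  + apply: eq_integral => w _; case: (Z w) => //=.
    by rewrite lim_cst.
  + by move=> n w _; exact: ext_ge0.
  + move=> w _ a b ab; case: (Z w) => //= y; exact: nd.
Qed.

Lemma integral_ext_indic (B : set S) : measurable B ->
  \int[m]_(w in D) ext (fun y => (\1_B y)%:E) (Z w) =
  m (D `&` Z @^-1` (Some @` B)).
Proof.
move=> mB; rewrite integral_hitting_law//; last first.
  by apply/measurable_EFinP; exact: measurable_indic.
by rewrite integral_indic// setIT.
Qed.

Lemma integral_ext1 :
  \int[m]_(w in D) ext (cst 1) (Z w) = m (D `&` Z @^-1` (Some @` setT)).
Proof.
rewrite -integral_ext_indic//; congr integral; apply/funext => w.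
by case: (Z w) => [y|] //=; rewrite indicT.
Qed.

Lemma hitting_law_measure : exists l : {measure set S -> \bar R},
  (forall B, l B = m (D `&` Z @^-1` (Some @` B))) /\
  forall f, measurable_fun setT f -> (forall y, 0 <= f y) ->
  \int[m]_(w in D) ext f (Z w) = \int[l]_y f y.
Proof. by exists hitting_law; split => //; exact: integral_hitting_law. Qed.

End hitting_law.

Lemma image_measure_exists d d' (T : measurableType d) (S : measurableType d')
    (R : realType) (m : {measure set T -> \bar R}) (f : T -> S) :
  measurable_fun setT f -> exists l : {measure set S -> \bar R},
    (forall B, l B = m (f @^-1` B)) /\
    forall g, measurable_fun setT g -> (forall y, 0 <= g y) ->
      \int[l]_y g y = \int[m]_w g (f w).
Proof.
move=> mf; have fE (B : set S) : (Some \o f) @^-1` (Some @` B) = f @^-1` B.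
  apply/seteqP; split => w /=; first by move=> [y By [<-]].
  by move=> Bf; exists (f w).
have mZ (B : set S) : measurable B -> measurable ((Some \o f) @^-1` (Some @` B)).
  by move=> mB; rewrite fE -[X in measurable X]setTI; exact: mf.
have [l [lE lI]] := hitting_law_measure m measurableT mZ.
exists l; split; first by move=> B; rewrite lE setTI fE.
by move=> g mg g0; rewrite -lI.
Qed.

Lemma integral_cst_probability d (T : measurableType d) (R : realType)
    (p : probability T R) (c : \bar R) : \int[p]_w c = c.
Proof.
rewrite (integral_cst p measurableT); apply: etrans (mule1 c).
by congr (_ * _); exact: probability_setT.
Qed.

Lemma probability_lty d (T : measurableType d) (R : realType)
    (p : probability T R) : p setT < +oo.
Proof. by apply: le_lt_trans (ltry 1); apply: probability_le1. Qed.

(** * Path fields and transition semigroups *)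

Section path_fields.
Context (R : realType) (E : ptopologicalType) (W : pointedType).
Implicit Types (Z : R -> W -> option E) (I J : set R).

Lemma path_field_sigma Z I : sigma_algebra setT (path_field Z I).
Proof. exact: sigma_algebra_generated. Qed.

Lemma path_fieldS Z I J : I `<=` J -> path_field Z I `<=` path_field Z J.
Proof.
move=> IJ; apply: sub_sigma_algebra2 => _ [t [B [It mB ->]]].
by exists t, B; split => //; exact: IJ.
Qed.

Lemma path_field_gen Z I t (B : set (borelType E)) : I t -> measurable B ->
  path_field Z I (Z t @^-1` (Some @` B)).
Proof. by move=> It mB; apply: sub_sigma_algebra; exists t, B. Qed.

Lemma path_field_alive Z I t : I t -> path_field Z I (Z t @^-1` (Some @` setT)).
Proof. by move=> It; apply: path_field_gen => //; exact: measurableT. Qed.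

Lemma path_field_preimage (W' : Type) (f : W' -> W) (H : set (set W')) Z I :
  sigma_algebra setT H ->
  (forall t (B : set (borelType E)), I t -> measurable B ->
    H (f @^-1` (Z t @^-1` (Some @` B)))) ->
  forall A, path_field Z I A -> H (f @^-1` A).
Proof.
move=> Hs h; apply: sigma_algebra_preimage => // _ [t [B [It mB ->]]].
exact: h.
Qed.

Lemma path_field_sub Z I (H : set (set W)) : sigma_algebra setT H ->
  (forall t (B : set (borelType E)), I t -> measurable B ->
    H (Z t @^-1` (Some @` B))) ->
  path_field Z I `<=` H.
Proof. by move=> Hs h A; apply: (@path_field_preimage W id). Qed.

Lemma path_field_determined Z I A w w' : path_field Z I A ->
  (forall t, I t -> Z t w = Z t w') -> (A w <-> A w').
Proof.
move=> mA ww'; suff : path_field Z I `<=` [set A | A w <-> A w'] by apply.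
apply: smallest_sub => [|_ [t [B [It _ ->]]]]; last by rewrite /= ww'.
split => //= [B h|B h].
  by split => -[_ Bw]; split => // /h.
by split => -[n _ Bn]; exists n => //; exact/h.
Qed.

(** Finite intersections of generators, with all times delayed by [s]:
    delaying the times is what the shift by [s] does to such an event. *)
Definition path_rect Z (s : R) (l : seq (R * set E)) : set W :=
  \big[setI/setT]_(p <- l) (Z (s + p.1)%R @^-1` (Some @` p.2)).

Definition borel_constraints I (l : seq (R * set E)) : Prop :=
  forall p, p \in l -> I p.1 /\ measurable (p.2 : set (borelType E)).

Lemma path_rect_cons Z s p l :
  path_rect Z s (p :: l) = Z (s + p.1)%R @^-1` (Some @` p.2) `&` path_rect Z s l.
Proof. by rewrite /path_rect big_cons. Qed.

Lemma path_field_rect Z I (H : set (set W)) s l : sigma_algebra setT H ->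
  (forall t (B : set (borelType E)), I t -> measurable B ->
    H (Z (s + t)%R @^-1` (Some @` B))) ->
  borel_constraints I l -> H (path_rect Z s l).
Proof.
move=> Hs h; elim: l => [_|p l IH hl].
  by rewrite /path_rect big_nil; exact: sigma_algebra_T.
rewrite path_rect_cons; apply: sigma_algebra_I => //.
  by have [Ip mp] := hl p (mem_head _ _); exact: h.
by apply: IH => q ql; apply: hl; rewrite inE ql orbT.
Qed.

Definition time_le (p q : R * set E) := (p.1 <= q.1)%R.

(** Sorting the times loses no rectangle, and lets inductions run through
    them in chronological order. *)
Definition path_rects Z I : set (set W) :=
  [set A | exists l, [/\ sorted time_le l, borel_constraints I l
    & A = path_rect Z 0 l]].

Lemma path_rectsI Z I : setI_closed (path_rects Z I).
Proof.
move=> _ _ [l [sl hl ->]] [l' [sl' hl' ->]].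
exists (sort time_le (l ++ l')); split.
- by apply: sort_sorted => p q; exact: le_total.
- move=> p; rewrite mem_sort mem_cat => /orP[]; [exact: hl|exact: hl'].
- rewrite /path_rect -big_cat; apply: perm_big.
  by rewrite perm_sym perm_sort.
Qed.

Lemma path_rects_generate Z I : path_field Z I = <<s path_rects Z I>>.
Proof.
apply/seteqP; split.
- apply: path_field_sub => [|t B It mB]; first exact: sigma_algebra_generated.
  apply: sub_sigma_algebra; exists [:: (t, B)]; split => //.
    by move=> p; rewrite inE => /eqP ->.
  by rewrite path_rect_cons /path_rect big_nil setIT add0r.
- apply: smallest_sub => [|_ [l [_ hl ->]]]; first exact: path_field_sigma.
  apply: path_field_rect hl => [|t B It mB]; first exact: path_field_sigma.
  by rewrite add0r; exact: path_field_gen.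
Qed.

End path_fields.

Section semigroup_basics.
Context (R : realType) (E : ptopologicalType) (X : realization R E).
Notation UE := (univType R E).
Hypothesis mpath : forall t (B : set UE), (0 <= t)%R -> measurable B ->
  measurable (path X t @^-1` (Some @` B)).
Hypothesis mlaw : forall t (B : set UE), (0 <= t)%R -> measurable B ->
  measurable_fun [set: UE]
    (fun x : UE => law X x (path X t @^-1` (Some @` B))).

Lemma semigroup_ge0 (t : R) (f : E -> \bar R) x : (forall y, 0 <= f y) ->
  0 <= semigroup X t f x.
Proof. by move=> f0; apply: integral_ge0 => w _; exact: ext_ge0. Qed.

Lemma realization_semigroup_measurable t (f : E -> \bar R) : (0 <= t)%R ->
  measurable_fun setT (f : UE -> \bar R) -> (forall y, 0 <= f y) ->
  measurable_fun setT (semigroup X t f : UE -> \bar R).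
Proof.
move=> t0 mf f0.
have /choice[l lP] : forall x : UE, exists l : {measure set UE -> \bar R},
    (forall B, l B = law X x (path X t @^-1` (Some @` B))) /\
    semigroup X t f x = \int[l]_y f y.
  move=> x.
  have [l [lE lI]] := @hitting_law_measure _ _ (sample X) UE R (law X x) setT
    (path X t) measurableT (fun B mB => mpath t0 mB).
  exists l; split; first by move=> B; rewrite lE setTI.
  exact: lI.
rewrite (_ : semigroup X t f = fun x => \int[l x]_y f y).
  apply: measurable_fun_integral_kernel => // B mB.
  rewrite (_ : (fun x => _) = fun x : UE => law X x (path X t @^-1` (Some @` B))).
    exact: (mlaw t0 mB).
  by apply/funext => x; have [-> _] := lP x.
by apply/funext => x; have [_ ->] := lP x.
Qed.

Lemma semigroup_indic t (B : set UE) x : (0 <= t)%R -> measurable B ->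
  semigroup X t (fun y => (\1_B y)%:E) x = law X x (path X t @^-1` (Some @` B)).
Proof.
move=> t0 mB; have mZ (D : set UE) : measurable D ->
  measurable (path X t @^-1` (Some @` D)) by exact: mpath.
by have := integral_ext_indic (law X x) measurableT mZ mB; rewrite setTI.
Qed.

(** Both sides are integrals of [f], for the law of the state at time [s + t]
    and for the mixture of the transition laws by the law of the state at time
    [s]. Two finite measures that agree on Borel sets agree on universally
    measurable ones. *)
Lemma markov_borel_ge0 x s t (f : E -> \bar R) (A : set (sample X)) :
  (0 <= s)%R -> (0 <= t)%R ->
  measurable_fun setT (f : UE -> \bar R) -> (forall y, 0 <= f y) ->
  measurable A ->
  (forall B : set (borelType E), measurable B ->
    law X x (A `&` path X (s + t)%R @^-1` (Some @` B)) =
    \int[law X x]_(w in A)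
      ext (fun y => law X y (path X t @^-1` (Some @` B))) (path X s w)) ->
  \int[law X x]_(w in A) ext f (path X (s + t)%R w) =
  \int[law X x]_(w in A) ext (semigroup X t f) (path X s w).
Proof.
move=> s0 t0 mf f0 mA hB; have st0 : (0 <= s + t)%R by exact: addr_ge0.
have mZ u (u0 : (0 <= u)%R) (D : set UE) : measurable D ->
  measurable (path X u @^-1` (Some @` D)) by exact: mpath.
have [l [lE lint]] := hitting_law_measure (law X x) mA (mZ s s0).
have [m1 [m1E m1int]] := hitting_law_measure (law X x) mA (mZ _ st0).
have /choice[kap kapP] y : exists k : {measure set UE -> \bar R},
    (forall D, k D = law X y (path X t @^-1` (Some @` D))) /\
    forall g, measurable_fun setT (g : UE -> \bar R) -> (forall z, 0 <= g z) ->
      semigroup X t g y = \int[k]_z g z.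
  have [k [kE kint]] := hitting_law_measure (law X y) measurableT (mZ t t0).
  by exists k; split => [D|g mg g0]; [rewrite kE setTI|exact: kint].
have mkap (D : set UE) : measurable D -> measurable_fun [set: UE] (fun y : UE => kap y D).
  move=> mD; rewrite (_ : (fun y => _) = fun y => law X y (path X t @^-1` (Some @` D))).
    exact: mlaw.
  by apply/funext => y; exact: (kapP y).1.
have [m2 m2E] := mixture_measure l mkap.
have m12 (D : set (borelType E)) : measurable D -> m1 D = m2 D.
  move=> mD; have mUD := borel_univ mD.
  rewrite m1E m2E; apply: (etrans (hB D mD)); rewrite lint //; last exact: mlaw.
  by apply: eq_integral => y _; rewrite (kapP y).1.
rewrite m1int // lint //; last first.
- by move=> y; exact: semigroup_ge0.
- exact: realization_semigroup_measurable.
transitivity (\int[m2]_y f y); last first.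
  rewrite (integral_mixture mkap (fun D _ => m2E D) mf f0).
  by apply: eq_integral => y _; rewrite (kapP y).2.
apply: eq_measure_integral => D mD _.
have mid : measurable_fun [set: UE] (id : UE -> borelType E).
  by apply: borel_univ_fun; exact: measurable_id.
have [lb [lbE _]] := image_measure_exists m1 mid.
have lbT : lb setT < +oo.
  rewrite lbE m1E; apply: le_lt_trans (probability_lty (law X x)).
  by apply: le_measure => //; apply: mem_set;
    [exact: measurableI mA (mZ _ st0 setT measurableT)|exact: measurableT].
have [D' [N [mD' mN N0 DN]]] := univ_sandwich_measure lbT ((measurable_univ D).1 mD).
have mUN := borel_univ mN; have mUD' := borel_univ mD'.
have n1 : m1 N = 0 by rewrite -N0 lbE.
have n2 : m2 N = 0 by rewrite -m12.
transitivity (m1 D'); first exact: measure_agree_off n1 DN.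
by rewrite m12 //; apply/esym; exact: measure_agree_off n2 DN.
Qed.

End semigroup_basics.

Section markov_basics.
Context (R : realType) (E : ptopologicalType) (X : process R E).
Hypothesis mX : markov_process X.
Notation UE := (univType R E).

Lemma path_measurable t (B : set UE) : (0 <= t)%R -> measurable B ->
  measurable (path X t @^-1` (Some @` B)).
Proof.
by move=> t0 mB; apply: (filt_sub (usual mX) t0); exact: (path_adapted mX t0 mB).
Qed.

Lemma path_none_mono s t w : (0 <= s)%R -> (s <= t)%R -> path X s w = None ->
  path X t w = None.
Proof.
move=> s0 st ps; apply: (path_absorbed mX); first exact: le_trans st.
apply: (@le_trans _ _ s%:E); last by rewrite lee_fin.
by apply: ereal_inf_lbound; exists s.
Qed.

Lemma lifetime_ge0 w : 0 <= lifetime X w.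
Proof. by apply: le_ereal_inf_tmp => _ [t [t0 _] <-]; rewrite lee_fin. Qed.

Lemma path_noneP t w : (0 <= t)%R -> path X t w = None <-> lifetime X w <= t%:E.
Proof.
move=> t0; split; last exact: (path_absorbed mX).
by move=> pt; apply: ereal_inf_lbound; exists t.
Qed.

Lemma lifetime_gtP t w : (0 <= t)%R ->
  (Some @` setT) (path X t w) <-> t%:E < lifetime X w.
Proof.
move=> t0; rewrite ltNge; split.
  by move=> [y _ yw]; apply/negP => /(path_noneP w t0); rewrite -yw.
move=> /negP h; case pt : (path X t w) => [y|]; first by exists y.
by exfalso; apply: h; exact/path_noneP.
Qed.

Lemma lifetime_shift t w : (0 <= t)%R -> t%:E < lifetime X w ->
  lifetime X (shift X t w) = lifetime X w - t%:E.
Proof.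
move=> t0 tw; apply/eqP; rewrite eq_le; apply/andP; split.
- rewrite leeBrDr//; apply: le_ereal_inf_tmp => _ [s [s0 ps] <-].
  have ts : (t <= s)%R.
    rewrite leNgt; apply/negP => st; have := path_none_mono s0 (ltW st) ps.
    by move=> /(path_noneP w t0); rewrite leNgt tw.
  rewrite -leeBrDr// -EFinB; apply/path_noneP; first by rewrite subr_ge0.
  by rewrite (path_shift mX) ?subr_ge0// subrK.
- apply: le_ereal_inf_tmp => _ [s [s0 ps] <-].
  rewrite leeBlDr//= -EFinD; apply/path_noneP; first by rewrite addr_ge0.
  by rewrite -(path_shift mX).
Qed.

Lemma measurable_semigroup t (f : E -> \bar R) : (0 <= t)%R ->
  measurable_fun setT (f : UE -> \bar R) -> (forall y, 0 <= f y) ->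
  measurable_fun setT (semigroup X t f : UE -> \bar R).
Proof.
by apply: realization_semigroup_measurable => [u B|u B];
  [exact: path_measurable|exact: (law_measurable mX)].
Qed.

Lemma markov_ge0 x s t (f : E -> \bar R) A : (0 <= s)%R -> (0 <= t)%R ->
  measurable_fun setT (f : UE -> \bar R) -> (forall y, 0 <= f y) ->
  filt X s A ->
  \int[law X x]_(w in A) ext f (path X (s + t)%R w) =
  \int[law X x]_(w in A) ext (semigroup X t f) (path X s w).
Proof.
move=> s0 t0 mf f0 sA; have mA := filt_sub (usual mX) s0 sA.
apply: markov_borel_ge0 => //.
- by move=> u B; exact: path_measurable.
- by move=> u B; exact: (law_measurable mX).
move=> B mB; have mUB := borel_univ mB.
have mZ (D : set UE) : measurable D ->
  measurable (path X (s + t) @^-1` (Some @` D)).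
  by apply: path_measurable; exact: addr_ge0.
rewrite -(integral_ext_indic (law X x) mA mZ (mUB R)).
have := @markov_property _ _ _ mX x s t \1_B A s0 t0 _ _ sA => ->.
- apply: eq_integral => w _; case: (path X s w) => [y|] //=.
  by apply: semigroup_indic => // u D; exact: path_measurable.
- exact: measurable_indic.
- by exists 1%R => y; rewrite indicE; case: (_ \in _); rewrite ?normr0 ?normr1.
Qed.

End markov_basics.

Arguments path_rects {R E W} Z I.

(** * The Markov property for path events *)

Lemma restriction_exists d (T : measurableType d) (R : realType)
    (p : probability T R) (G : set (set T)) : <<s G>> `<=` measurable ->
  exists q : probability (g_sigma_algebraType G) R,
    forall A, <<s G>> A -> q A = p A.
Proof.
move=> GT; have [q qE] : exists q : probability (g_sigma_algebraType G) R,
    forall A, q A = (p^*)%mu A.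
  apply: completion_exists => A sA; exists A, set0; split => //; exact: GT.
exists q => A sA; rewrite qE; apply: measurable_mu_extE; exact: GT.
Qed.

(** The law of a process at a fixed time is in general only a finite measure,
    as the process may be dead. Normalizing it gives an initial distribution. *)
Lemma augmentation_measure (R : realType) (E : ptopologicalType)
    (W : pointedType) (G : set (set W)) (null : E -> set W -> Prop)
    (F : set (set W)) (A : set W) (la : {measure set (borelType E) -> \bar R}) :
  sigma_algebra setT G -> (forall y, null y set0) ->
  (forall y (B : nat -> set W), (forall n, G (B n)) ->
    (forall n, null y (B n)) -> null y (\bigcup_n B n)) ->
  sigma_algebra setT F -> augmentation R G null F A ->
  la setT < +oo ->
  exists A' B, [/\ F A', G B, agree_off B A A' & {ae la, forall y, null y B}].
Proof.
move=> Gs n0 nU Fs hA lafin.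
have [A' FA' [B [GB AA' [N [mN N0 BN]]]]] :=
  (augmentationP _ Gs n0 nU A Fs).1 hA (mnormalize la (dirac point)).
exists A', B; split => //; exists N; split => //.
exact: mnormalize_null N0.
Qed.

Section markov_path_fields.
Context (R : realType) (E : ptopologicalType) (X : process R E).
Hypothesis mX : markov_process X.
Notation UE := (univType R E).
Notation nonneg := [set t : R | (0 <= t)%R].
Notation pf := (path_field (path X) nonneg).
Notation alive t := (path X t @^-1` (Some @` setT)).

Lemma pf_measurable : pf `<=` measurable.
Proof.
apply: path_field_sub => [|t B t0 mB].
  exact: sigma_algebra_measurable.
by apply: path_measurable => //; exact: borel_univ.
Qed.

Lemma measurable_ext_path t (f : E -> \bar R) : (0 <= t)%R ->
  measurable_fun setT (f : UE -> \bar R) ->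
  measurable_fun setT (fun w => ext f (path X t w)).
Proof.
move=> t0 mf; have mZ (B : set UE) : measurable B ->
  measurable (path X t @^-1` (Some @` B)) by exact: path_measurable.
exact: (measurable_ext mZ).
Qed.

Lemma integral_ext1_path x t (A : set (sample X)) : (0 <= t)%R ->
  measurable A ->
  \int[law X x]_(w in A) ext (cst 1) (path X t w) = law X x (A `&` alive t).
Proof.
move=> t0 mA; have mZ (B : set UE) : measurable B ->
  measurable (path X t @^-1` (Some @` B)) by exact: path_measurable.
exact: (integral_ext1 _ mA mZ).
Qed.

Lemma ae_start x : law X x (~` (path X 0 @^-1` [set Some x])) = 0.
Proof.
have m0 : measurable (path X 0 @^-1` [set Some x]).
  rewrite -image_set1; apply: path_measurable => //; apply: borel_univ.
  exact: measurable_set1_radon (state_radon mX) x.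
by rewrite probability_setC// (law_start mX) subee.
Qed.

Lemma integral_start x (g : E -> \bar R) :
  measurable_fun setT (g : UE -> \bar R) -> (forall y, 0 <= g y) ->
  \int[law X x]_w ext g (path X 0 w) = g x.
Proof.
move=> mg g0.
transitivity (\int[law X x]_w (cst (g x) w)); last first.
  exact: integral_cst_probability.
apply: ge0_ae_eq_integral => //.
- exact: measurable_ext_path.
- by move=> w _; exact: ext_ge0.
- by move=> w _; exact: g0.
- exists (~` (path X 0 @^-1` [set Some x])); split; last 1 first.
  + by move=> w; apply: contra_not => /= -> _.
  + apply: measurableC; rewrite -image_set1; apply: path_measurable => //.
    by apply: borel_univ; exact: measurable_set1_radon (state_radon mX) x.
  + exact: ae_start.
Qed.

Lemma semigroup_le1 t (f : E -> \bar R) x : (0 <= t)%R ->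
  measurable_fun setT (f : UE -> \bar R) -> (forall y, 0 <= f y <= 1) ->
  semigroup X t f x <= 1.
Proof.
move=> t0 mf f01; have f0 y : 0 <= f y by case/andP: (f01 y).
rewrite -(integral_cst_probability (law X x) 1); apply: ge0_le_integral => //.
- by move=> w _; exact: ext_ge0.
- exact: measurable_ext_path.
- by move=> w _; case: (path X t w) => [y|] //=; case/andP: (f01 y).
Qed.

(** The finite-dimensional Markov property, by induction on the number of
    times: the constraint at the first time is absorbed in the event, and the
    remaining ones are conditioned at that time, which becomes the new
    reference time [a]. *)
Lemma markov_path_rect_aux l (a : R) B0 : (0 <= a)%R -> path.path (@time_le R E) (a, B0) l ->
  borel_constraints nonneg l ->
  exists h : E -> \bar R, [/\ measurable_fun setT (h : UE -> \bar R),
    forall y, 0 <= h y <= 1 &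
    forall s x A, (0 <= s)%R -> filt X s A ->
      law X x (A `&` alive s `&` path_rect (path X) (s - a) l) =
      \int[law X x]_(w in A) ext h (path X s w)].
Proof.
elim: l a B0 => [|[r B] l IH] a B0 a0.
  move=> _ _; exists (cst 1); split => //.
    by move=> y; rewrite lexx andbT.
  move=> s x A s0 sA.
  have mA := filt_sub (usual mX) s0 sA.
  rewrite integral_ext1_path//.
  by rewrite /path_rect big_nil setIT.
rewrite /= => /andP[/= ar pl] hl; rewrite /time_le/= in ar.
have [/= _ mB] := hl (r, B) (mem_head _ _).
have r0 : (0 <= r)%R := le_trans a0 ar.
have [|h' [mh' h'01 h'P]] := IH r B r0 pl.
  by move=> p pl'; apply: hl; rewrite inE pl' orbT.
have ra0 : (0 <= r - a)%R by rewrite subr_ge0.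
pose g y := (\1_B y)%:E * h' y.
have mg : measurable_fun setT (g : UE -> \bar R).
  apply: emeasurable_funM => //; apply/measurable_EFinP.
  by apply: measurable_indic; exact: borel_univ.
have g0 y : 0 <= g y by rewrite mule_ge0 ?lee_fin//; case/andP: (h'01 y).
have gh y : g y <= h' y.
  rewrite /g indicE; case: (_ \in _); rewrite ?mul1e ?mul0e//.
  by case/andP: (h'01 y).
have g01 y : 0 <= g y <= 1.
  by rewrite g0/=; apply: le_trans (gh y) _; case/andP: (h'01 y).
exists (semigroup X (r - a) g); split.
- exact: measurable_semigroup.
- by move=> y; rewrite semigroup_ge0//=; exact: semigroup_le1.
- move=> s x A s0 sA.
  pose s' := (s + (r - a))%R.
  have s'0 : (0 <= s')%R by rewrite addr_ge0.
  have ss' : (s <= s')%R by rewrite lerDl.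
  have sA' : filt X s' (A `&` path X s' @^-1` (Some @` B)).
    apply: sigma_algebra_I; first exact: (filt_sigma (usual mX)).
      exact: (filt_mono (usual mX) s0 ss').
    by apply: (path_adapted mX s'0); exact: borel_univ.
  rewrite -(markov_ge0 mX)//.
  transitivity (\int[law X x]_(w in A `&` path X s' @^-1` (Some @` B))
      ext h' (path X s' w)).
    rewrite -h'P//; congr (law X x _).
    have -> : (s' - r = s - a)%R by rewrite /s' addrA addrAC addrK.
    rewrite path_rect_cons; apply/seteqP; split => w /=.
    + move=> [[Aw sw] [Bw lw]].
      have E1 : (s - a + r = s')%R by rewrite /s' addrA addrAC.
      rewrite E1 in Bw; split => //; split => //.
      by case: Bw => y By <-; exists y.
    + move=> [[[Aw Bw] s'w] lw].
      have E1 : (s - a + r = s')%R by rewrite /s' addrA addrAC.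
      rewrite E1; split => //; split => //.
      case sw : (path X s w) => [y|]; first by exists y.
      by case: s'w => y _; rewrite (path_none_mono mX s0 ss' sw).
  rewrite integral_mkcondr; apply: eq_integral => w _; rewrite patchE.
  case: ifPn => [|] wB.
    by move/set_mem: wB => [y By yw]; rewrite -yw /= /g indicE mem_set// mul1e.
  case yw : (path X s' w) => [y|//] /=; rewrite /g indicE memNset ?mul0e//.
  by move=> By; move/negP: wB; apply; apply/mem_set; exists y.
Qed.

Lemma path_rect_shift s l : (0 <= s)%R -> borel_constraints nonneg l ->
  shift X s @^-1` path_rect (path X) 0 l = path_rect (path X) s l.
Proof.
move=> s0; elim: l => [_|p l IH hl].
  by rewrite /path_rect !big_nil preimage_setT.
rewrite !path_rect_cons preimage_setI IH; last first.
  by move=> q ql; apply: hl; rewrite inE ql orbT.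
congr (_ `&` _); have [p0 _] := hl p (mem_head _ _).
by apply/seteqP; split => w /=; rewrite add0r (path_shift mX)// addrC.
Qed.

(** The function found by the induction is identified by taking [s = 0]: it
    is the probability of the rectangle. *)
Lemma markov_path_rect D : path_rects (path X) nonneg D ->
  measurable_fun setT ((fun y => law X y D) : UE -> \bar R) /\
  forall s x A, (0 <= s)%R -> filt X s A ->
    law X x (A `&` alive s `&` shift X s @^-1` D) =
    \int[law X x]_(w in A) ext (fun y => law X y D) (path X s w).
Proof.
move=> [l [sl hl ->]].
have pl : path.path (@time_le R E) (0%R, setT) l.
  by case: l sl hl => //= p l -> /(_ p (mem_head _ _))[p0 _]; rewrite andbT.
have [h [mh h01 hP]] := markov_path_rect_aux (lexx _) pl hl.
have h0 y : 0 <= h y by case/andP: (h01 y).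
have mD : measurable (path_rect (path X) 0 l).
  apply: pf_measurable; apply: path_field_rect hl; first exact: path_field_sigma.
  by move=> t B t0 mB; rewrite add0r; exact: path_field_gen.
have -> : (fun y => law X y (path_rect (path X) 0 l)) = h.
  apply/funext => x; rewrite -[RHS](integral_start x mh h0).
  rewrite -(hP 0%R x setT)//; last first.
    by apply: sigma_algebra_T; exact: (filt_sigma (usual mX)).
  rewrite subr0 setTI.
  apply: (@measure_agree_off _ _ _ _ _ _ (~` (path X 0 @^-1` [set Some x]))) => //.
  + by apply: measurableI => //; exact: path_measurable.
  + apply: measurableC; rewrite -image_set1; apply: path_measurable => //.
    by apply: borel_univ; exact: measurable_set1_radon (state_radon mX) x.
  + exact: ae_start.
  + move=> w /=; rewrite notK => w0; split => [|[]//]; split => //=.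
    by rewrite w0; exists x.
split => // s x A s0 sA; rewrite -hP// subr0; congr (law X x (_ `&` _)).
exact: path_rect_shift.
Qed.

Lemma path_rects_pf : pf = <<s path_rects (path X) nonneg>>.
Proof. exact: path_rects_generate. Qed.

Lemma pf_sigma_measurable : pf = @measurable _ (g_sigma_algebraType pf).
Proof. by apply: sigma_algebra_measurableE; exact: path_field_sigma. Qed.

Lemma pf_restriction : exists q : E -> probability (g_sigma_algebraType pf) R,
  forall x A, pf A -> q x A = law X x A.
Proof.
have h x : exists q : probability (g_sigma_algebraType pf) R,
    forall A, <<s pf>> A -> q A = law X x A.
  apply: restriction_exists; rewrite sigma_algebra_id; last exact: path_field_sigma.
  exact: pf_measurable.
have [q qE] := choice h; exists q => x A pA; apply: qE.
exact: sub_sigma_algebra.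
Qed.

Lemma law_measurable_pf D : pf D ->
  measurable_fun setT ((fun y => law X y D) : UE -> \bar R).
Proof.
have [q qE] := pf_restriction => pD.
rewrite (_ : (fun y => _) = q ^~ D); last by apply/funext => x; rewrite qE.
apply: (@pi_kernel_measurable _ _ UE (g_sigma_algebraType pf) R
  (path_rects (path X) nonneg)).
- by rewrite -pf_sigma_measurable path_rects_pf.
- exact: path_rectsI.
- move=> A rA; have [+ _] := markov_path_rect rA.
  rewrite (_ : (fun y => _) = q ^~ A)//; apply/funext => x; rewrite qE//.
  by rewrite path_rects_pf; exact: sub_sigma_algebra.
- by rewrite -pf_sigma_measurable.
Qed.

(** Undefined where the process is dead at time [s], so that its laws only
    charge survival. *)
Definition shift_opt (s : R) (w : sample X) : option (sample X) :=
  omap (fun=> shift X s w) (path X s w).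

Lemma shift_optE s D :
  shift_opt s @^-1` (Some @` D) = alive s `&` shift X s @^-1` D.
Proof.
apply/seteqP; split => w /=; rewrite /shift_opt.
  case: (path X s w) => [y|] /= [v Dv] // [vE].
  by rewrite -vE; split => //; exists y.
by move=> [[y _ <-] Dw] /=; exists (shift X s w).
Qed.

Lemma shift_opt_pf s D : (0 <= s)%R -> pf D ->
  pf (shift_opt s @^-1` (Some @` D)).
Proof.
move=> s0 pD; rewrite shift_optE.
apply: (sigma_algebra_I (path_field_sigma (path X) nonneg)).
- exact: path_field_alive.
- apply: path_field_preimage pD => [|t B t0 mB]; first exact: path_field_sigma.
  rewrite (_ : _ @^-1` _ = path X (t + s) @^-1` (Some @` B)).
    by apply: path_field_gen => //=; rewrite addr_ge0.
  by apply/seteqP; split => w /=; rewrite (path_shift mX).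
Qed.

(** Both sides are finite measures in [D] and agree on rectangles. *)
Lemma markov_pf s x A D : (0 <= s)%R -> filt X s A -> pf D ->
  law X x (A `&` shift_opt s @^-1` (Some @` D)) =
  \int[law X x]_(w in A) ext (fun y => law X y D) (path X s w).
Proof.
move=> s0 sA pD; have [q qE] := pf_restriction.
have mA := filt_sub (usual mX) s0 sA.
have mTh (B : set (g_sigma_algebraType pf)) : measurable B ->
    measurable (shift_opt s @^-1` (Some @` B)).
  rewrite -pf_sigma_measurable => pB; apply: pf_measurable; exact: shift_opt_pf.
have mZ (B : set UE) : measurable B ->
  measurable (path X s @^-1` (Some @` B)) by exact: path_measurable.
have [m1 [m1E _]] := hitting_law_measure (law X x) mA mTh.
have [la [laE laI]] := hitting_law_measure (law X x) mA mZ.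
have mq (B : set (g_sigma_algebraType pf)) : measurable B ->
    measurable_fun setT ((fun y => q y B) : UE -> \bar R).
  rewrite -pf_sigma_measurable => pB.
  by under eq_fun do rewrite qE//; exact: law_measurable_pf.
have [m2 m2E] := @mixture_measure _ _ UE _ R la
  (q : UE -> {measure set (g_sigma_algebraType pf) -> \bar R}) mq.
have m2E' (B : set (g_sigma_algebraType pf)) : pf B ->
    m2 B = \int[law X x]_(w in A) ext (fun y => law X y B) (path X s w).
  move=> pB; rewrite m2E laI//; last exact: law_measurable_pf.
  by apply: eq_integral => y _; apply: qE.
rewrite -m1E -m2E'//.
apply: (@pi_measure_eq _ (g_sigma_algebraType pf) R (path_rects (path X) nonneg)).
- by rewrite -pf_sigma_measurable path_rects_pf.
- exact: path_rectsI.
- rewrite m1E; apply: le_lt_trans (ltry 1); apply: probability_le1.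
  by apply: measurableI => //; exact: mTh.
- rewrite m1E m2E'; last exact: (sigma_algebra_T (path_field_sigma (path X) nonneg)).
  rewrite (_ : (fun y => law X y setT) = cst 1); last first.
    by apply/funext => y; exact: probability_setT.
  by rewrite integral_ext1_path// shift_optE preimage_setT setIT.
- move=> B rB; have pB : pf B by rewrite path_rects_pf; exact: sub_sigma_algebra.
  have [_ hB] := markov_path_rect rB.
  by rewrite m1E m2E'// -hB// shift_optE setIA.
- by rewrite -pf_sigma_measurable.
Qed.

End markov_path_fields.

Arguments shift_opt {R E} X s w.

(** * Left germ variables *)

Lemma augmentation_mono (R : realType) (E : ptopologicalType) (W : Type)
    (G : set (set W)) (null : E -> set W -> Prop) (F F' : set (set W)) :
  F `<=` F' -> augmentation R G null F `<=` augmentation R G null F'.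
Proof.
move=> FF' A hA mu; apply: sub_sigma_algebra2 (hA mu).
exact: setSU.
Qed.

Lemma sub_augmentation (R : realType) (E : ptopologicalType) (W : Type)
    (G : set (set W)) (null : E -> set W -> Prop) (F : set (set W)) :
  F `<=` augmentation R G null F.
Proof. by move=> A FA mu; apply: sub_sigma_algebra; left. Qed.

Lemma integral_restriction d (T : measurableType d) (R : realType)
    (G : set (set T)) (p : {measure set T -> \bar R})
    (q : {measure set (g_sigma_algebraType G) -> \bar R}) (f : T -> \bar R) :
  <<s G>> `<=` measurable -> (forall A, <<s G>> A -> q A = p A) ->
  measurable_fun setT (f : g_sigma_algebraType G -> \bar R) ->
  (forall w, 0 <= f w) -> \int[q]_w f w = \int[p]_w f w.
Proof.
move=> GT qE mf f0.
have mZ (B : set (g_sigma_algebraType G)) : measurable B ->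
    measurable ((Some : T -> option (g_sigma_algebraType G)) @^-1` (Some @` B)).
  move=> mB; rewrite (_ : _ @^-1` _ = B); first exact: GT.
  by apply/seteqP; split => w /= => [[v Bv [<-]]//|Bw]; exists w.
have [l [lE lI]] := hitting_law_measure p (@measurableT _ T) mZ.
transitivity (\int[l]_w f w).
  apply: eq_measure_integral => A mA _; rewrite lE setTI qE//.
  congr (p _); apply/seteqP; split => w /= => [Aw|[v Av [<-]]//].
  by exists w.
by rewrite -lI.
Qed.

Section intrinsic_field.
Context (R : realType) (E : ptopologicalType) (X : process R E).
Hypothesis mX : markov_process X.
Notation UE := (univType R E).
Notation BE := (borelType E).
Notation nonneg := [set t : R | (0 <= t)%R].
Notation pf := (path_field (path X) nonneg).
Notation alive t := (path X t @^-1` (Some @` setT)).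

(** Only null sets of the path field are added. By the Markov property these
    are stable under the shift, which null sets of [sample X] that the path
    does not see need not be. *)
Definition intrinsic_field : set (set (sample X)) :=
  augmentation R pf (law_null X) pf.

Notation NN := intrinsic_field.

Lemma law_null0 y : law_null X y set0.
Proof. exact: measure0. Qed.

Lemma law_null_bigcup y (B : nat -> set (sample X)) :
  (forall n, measurable (B n)) ->
  (forall n, law_null X y (B n)) -> law_null X y (\bigcup_n B n).
Proof. exact: measure_null_bigcup. Qed.

Lemma law_null_bigcup_pf y (B : nat -> set (sample X)) :
  (forall n, pf (B n)) ->
  (forall n, law_null X y (B n)) -> law_null X y (\bigcup_n B n).
Proof.
by move=> pB; apply: law_null_bigcup => n; apply: (pf_measurable mX); exact: pB.
Qed.

Lemma intrinsic_sigma : sigma_algebra setT NN.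
Proof. exact: augmentation_sigma. Qed.

Lemma pf_intrinsic : pf `<=` NN.
Proof. exact: sub_augmentation. Qed.

Lemma intrinsic_approx D (la : {measure set BE -> \bar R}) : NN D ->
  la setT < +oo ->
  exists D' B, [/\ pf D', pf B, agree_off B D D' & {ae la, forall y, law X y B = 0}].
Proof.
move=> hD lafin; apply: (augmentation_measure _ _ _ _ hD lafin).
- exact: path_field_sigma.
- exact: law_null0.
- exact: law_null_bigcup_pf.
- exact: path_field_sigma.
Qed.

Lemma intrinsic_measurable : NN `<=` measurable.
Proof.
move=> D hD; apply: (ambient_augmented (usual mX)).
apply/augmentationP.
- exact: sigma_algebra_measurable.
- exact: law_null0.
- exact: law_null_bigcup.
- exact: sigma_algebra_measurable.
move=> mu; have [|D' [B [pD' pB DD' nB]]] := @intrinsic_approx D mu hD.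
  exact: probability_lty.
exists D'; first exact: (pf_measurable mX).
by exists B; split => //; exact: (pf_measurable mX).
Qed.

Lemma intrinsic_sigma_measurable : NN = @measurable _ (g_sigma_algebraType NN).
Proof. by apply: sigma_algebra_measurableE; exact: intrinsic_sigma. Qed.

Lemma law_measurable_intrinsic D : NN D ->
  measurable_fun setT ((fun y => law X y D) : UE -> \bar R).
Proof.
move=> hD; apply: univ_measurable_ae => mu.
have [|D' [B [pD' pB DD' nB]]] := @intrinsic_approx D mu hD.
  exact: probability_lty.
exists (fun y => law X y D'); split; first exact: law_measurable_pf.
apply: (@filterS _ _ (ae_filter_ringOfSetsType mu) _ _ _ nB) => y yB;
  apply: measure_agree_off yB DD'.
- exact: intrinsic_measurable.
- exact: pf_measurable.
- exact: pf_measurable.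
Qed.

Lemma intrinsic_restriction :
  exists q : E -> probability (g_sigma_algebraType NN) R,
  forall x A, NN A -> q x A = law X x A.
Proof.
have h x : exists q : probability (g_sigma_algebraType NN) R,
    forall A, <<s NN>> A -> q A = law X x A.
  apply: restriction_exists; rewrite sigma_algebra_id; last exact: intrinsic_sigma.
  exact: intrinsic_measurable.
have [q qE] := choice h; exists q => x A pA; apply: qE.
exact: sub_sigma_algebra.
Qed.

(** By the Markov property at time [s], the probability in question is the
    mean of the probabilities of [B] from the state at time [s]. *)
Lemma shift_opt_null s x (B : set (sample X)) (N : set BE) : (0 <= s)%R -> pf B ->
  measurable N -> (forall y, ~ N y -> law X y B = 0) ->
  law X x (path X s @^-1` (Some @` N)) = 0 ->
  law X x (shift_opt X s @^-1` (Some @` B)) = 0.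
Proof.
move=> s0 pB mN NB xN.
have := markov_pf mX x s0 (sigma_algebra_T (filt_sigma (usual mX) s0)) pB.
rewrite setTI => ->.
transitivity (\int[law X x]_w (cst 0 w)); last by rewrite integral0.
apply: ge0_ae_eq_integral => //.
- by apply: measurable_ext_path => //; exact: law_measurable_pf.
- by move=> w _; apply: ext_ge0 => y; exact: measure_ge0.
- exists (path X s @^-1` (Some @` N)); split => //.
    by apply: path_measurable => //; exact: borel_univ.
  move=> w /= /not_implyP[_]; case: (path X s w) => [y|] //= yB.
  by exists y => //; apply: contrapT => /NB.
Qed.

Lemma shift_opt_agree s (B D D' : set (sample X)) : agree_off B D D' ->
  agree_off (shift_opt X s @^-1` (Some @` B)) (shift_opt X s @^-1` (Some @` D))
    (shift_opt X s @^-1` (Some @` D')).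
Proof.
move=> DD' w Bw; split => -[v Dv vw] /=; exists v => //; apply/(DD' v) => // Bv;
  by apply: Bw => /=; exists v.
Qed.

Lemma path_law s x : (0 <= s)%R -> exists la : {measure set BE -> \bar R},
  (forall B, la B = law X x (path X s @^-1` (Some @` B))) /\ la setT < +oo.
Proof.
move=> s0; have mZ (B : set BE) : measurable B ->
  measurable (path X s @^-1` (Some @` B)).
  by move=> mB; apply: path_measurable => //; exact: borel_univ.
have [la [laE _]] := hitting_law_measure (law X x) measurableT mZ.
exists la; split; first by move=> B; rewrite laE setTI.
rewrite laE setTI; apply: le_lt_trans (ltry 1); apply: probability_le1.
by apply: mZ; exact: measurableT.
Qed.

(** The set [D] has to be approximated for the law of the state at time [s],
    and not for the initial distribution. *)
Lemma shift_opt_intrinsic s D : (0 <= s)%R -> NN D ->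
  NN (shift_opt X s @^-1` (Some @` D)).
Proof.
move=> s0 hD; apply/augmentationP.
- exact: path_field_sigma.
- exact: law_null0.
- exact: law_null_bigcup_pf.
- exact: path_field_sigma.
move=> mu.
have [m [mE _]] := univ_extension mu.
have /choice[l lP] : forall x : UE, exists la : {measure set BE -> \bar R},
    (forall B, la B = law X x (path X s @^-1` (Some @` B))) /\ la setT < +oo.
  by move=> x; exact: path_law.
have ml (B : set BE) : measurable B -> measurable_fun setT (l ^~ B).
  move=> mB; rewrite (_ : l ^~ B = fun x => law X x (path X s @^-1` (Some @` B))).
    by apply: (law_measurable mX s0); exact: borel_univ.
  by apply/funext => x; exact: (lP x).1.
have [la laE] := @mixture_measure _ _ UE BE R m l ml.
have lafin : la setT < +oo.
  rewrite laE; apply: le_lt_trans (ltry 1).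
  rewrite -(integral_cst_probability m 1).
  apply: ge0_le_integral => //; first exact: ml.
  move=> x _; rewrite (lP x).1; apply: probability_le1.
  by apply: path_measurable => //; exact: measurableT.
have [D' [B [pD' pB DD' [N [mN N0 NB]]]]] := intrinsic_approx hD lafin.
exists (shift_opt X s @^-1` (Some @` D')); first exact: shift_opt_pf.
exists (shift_opt X s @^-1` (Some @` B)); split.
- exact: shift_opt_pf.
- exact: shift_opt_agree.
- apply: (univ_ae mE).
  have : \int[m]_x `|l x N| = 0.
    by rewrite -N0 laE; apply: eq_integral => x _; rewrite gee0_abs.
  move/(ae_eq_integral_abs _ measurableT (ml N mN)); apply: filterS => x /(_ I) lx.
  apply: (shift_opt_null s0 pB mN).
    by move=> y; apply: contra_notP => yB; apply: NB.
  exact: etrans (esym ((lP x).1 N)) lx.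
Qed.

Lemma markov_intrinsic s x A D : (0 <= s)%R -> filt X s A -> NN D ->
  law X x (A `&` shift_opt X s @^-1` (Some @` D)) =
  \int[law X x]_(w in A) ext (fun y => law X y D) (path X s w).
Proof.
move=> s0 sA hD; have mA := filt_sub (usual mX) s0 sA.
have [la [laE lafin]] := path_law x s0.
have [D' [B [pD' pB DD' [N [mN N0 NB]]]]] := intrinsic_approx hD lafin.
have NB' y : ~ N y -> law X y B = 0.
  by apply: contra_notP => yB; apply: NB.
have mpf S : pf S -> measurable (shift_opt X s @^-1` (Some @` S)).
  by move=> pS; apply: (pf_measurable mX); exact: shift_opt_pf.
transitivity (law X x (A `&` shift_opt X s @^-1` (Some @` D'))).
  apply: (@measure_agree_off _ _ _ (law X x) _ _ (shift_opt X s @^-1` (Some @` B))).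
  - by apply: measurableI => //; apply: intrinsic_measurable; exact: shift_opt_intrinsic.
  - by apply: measurableI => //; exact: mpf.
  - exact: mpf.
  - by apply: (shift_opt_null s0 pB mN NB'); exact: etrans (esym (laE N)) N0.
  - by apply: agree_offI => //; exact: shift_opt_agree.
rewrite (markov_pf mX)//.
apply: ge0_ae_eq_integral => //.
- apply: measurable_funTS; apply: measurable_ext_path => //; exact: law_measurable_pf.
- apply: measurable_funTS; apply: measurable_ext_path => //.
  exact: law_measurable_intrinsic.
- by move=> w _; apply: ext_ge0 => y; exact: measure_ge0.
- by move=> w _; apply: ext_ge0 => y; exact: measure_ge0.
- exists (path X s @^-1` (Some @` N)); split.
  + by apply: path_measurable => //; exact: borel_univ.
  + exact: etrans (esym (laE N)) N0.
  + move=> w /= /not_implyP[_]; case: (path X s w) => [y|] //= yB.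
    exists y => //; apply: contrapT => Ny; apply: yB.
    apply/esym/(measure_agree_off _ _ _ (NB' y Ny) DD').
    * exact: intrinsic_measurable.
    * exact: (pf_measurable mX).
    * exact: (pf_measurable mX).
Qed.

Lemma integral_intrinsic x (q : {measure set (g_sigma_algebraType NN) -> \bar R})
    (f : sample X -> \bar R) :
  (forall A, NN A -> q A = law X x A) ->
  measurable_fun setT (f : g_sigma_algebraType NN -> \bar R) ->
  (forall w, 0 <= f w) -> \int[q]_w f w = \int[law X x]_w f w.
Proof.
move=> qE mf f0; apply: integral_restriction => //.
  rewrite sigma_algebra_id; last exact: intrinsic_sigma.
  exact: intrinsic_measurable.
by move=> A; rewrite sigma_algebra_id; [exact: qE|exact: intrinsic_sigma].
Qed.

Lemma integral_law_measurable (f : sample X -> \bar R) :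
  measurable_fun setT (f : g_sigma_algebraType NN -> \bar R) ->
  (forall w, 0 <= f w) ->
  measurable_fun setT ((fun y => \int[law X y]_w f w) : UE -> \bar R).
Proof.
move=> mf f0; have [q qE] := intrinsic_restriction.
rewrite (_ : (fun y => _) = fun y => \int[q y]_w f w); last first.
  by apply/funext => y; rewrite (integral_intrinsic (qE y)).
apply: (@measurable_fun_integral_kernel _ _ UE (g_sigma_algebraType NN)) => // U.
rewrite -intrinsic_sigma_measurable => hU.
rewrite (_ : (fun y => _) = (fun y => law X y U)); last first.
  by apply/funext => y; exact: qE.
exact: law_measurable_intrinsic.
Qed.

Lemma markov_intrinsic_fun s x A (f : sample X -> \bar R) : (0 <= s)%R ->
  filt X s A -> measurable_fun setT (f : g_sigma_algebraType NN -> \bar R) ->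
  (forall w, 0 <= f w) ->
  \int[law X x]_(w in A) ext f (shift_opt X s w) =
  \int[law X x]_(w in A) ext (fun y => \int[law X y]_v f v) (path X s w).
Proof.
move=> s0 sA mf f0; have [q qE] := intrinsic_restriction.
have mA := filt_sub (usual mX) s0 sA.
have mTh (B : set (g_sigma_algebraType NN)) : measurable B ->
    measurable (shift_opt X s @^-1` (Some @` B)).
  rewrite -intrinsic_sigma_measurable => hB; apply: intrinsic_measurable.
  exact: shift_opt_intrinsic.
have mZ (B : set UE) : measurable B ->
  measurable (path X s @^-1` (Some @` B)) by exact: path_measurable.
have [m1 [m1E m1I]] := hitting_law_measure (law X x) mA mTh.
have [la [laE laI]] := hitting_law_measure (law X x) mA mZ.
rewrite m1I// laI//; [|exact: integral_law_measurable|]; last first.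
  by move=> y; exact: integral_ge0.
rewrite (@integral_mixture _ _ UE (g_sigma_algebraType NN) R la q m1)//.
- by apply: eq_integral => y _; exact: (integral_intrinsic (qE y) mf f0).
- move=> U mU; have hU : NN U by rewrite intrinsic_sigma_measurable.
  rewrite (_ : (fun y => _) = (fun y => law X y U)); last first.
    by apply/funext => y; exact: qE.
  exact: law_measurable_intrinsic.
- move=> U mU; have hU : NN U by rewrite intrinsic_sigma_measurable.
  rewrite m1E; apply: (etrans (markov_intrinsic x s0 sA hU)).
  rewrite laI//; last exact: law_measurable_intrinsic.
  by apply: eq_integral => y _; exact/esym/qE.
Qed.

Lemma natural_filtration_intrinsic t : natural_filtration X t `<=` NN.
Proof.
apply: augmentation_mono; apply: path_fieldS => s /=.
by move=> /andP[].
Qed.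

Lemma strict_past_intrinsic : <<s strict_past X (lifetime X)>> `<=` NN.
Proof.
rewrite /strict_past; apply: smallest_sub; first exact: intrinsic_sigma.
apply: smallest_sub; first exact: intrinsic_sigma.
move=> _ [t [A [t0 nA ->]]]; apply: (sigma_algebra_I intrinsic_sigma).
  exact: natural_filtration_intrinsic nA.
rewrite (_ : [set _ | _] = alive t).
  by apply: pf_intrinsic; exact: path_field_alive.
apply/seteqP; split => w h; first exact: (lifetime_gtP mX w t0).2.
exact: (lifetime_gtP mX w t0).1.
Qed.

(** Left germ variables are functions of the path up to null sets, and shifts
    before the lifetime leave them unchanged. Both properties pass to the
    generated sigma-algebra, with one exceptional set for each time. *)
Lemma left_germ_sets A : <<s left_germ_field X (lifetime X)>> A ->
  NN A /\ forall t, (0 <= t)%R -> almost_surely X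
    [set w | t%:E < lifetime X w -> (A (shift X t w) <-> A w)].
Proof.
suff : <<s left_germ_field X (lifetime X)>> `<=` [set A | NN A /\
    forall t, (0 <= t)%R -> almost_surely X
    [set w | t%:E < lifetime X w -> (A (shift X t w) <-> A w)]] by apply.
apply: smallest_sub => [|B [mB hB]] /=.
- split => /=.
  + split; first by case: intrinsic_sigma.
    by move=> t t0; exists set0; split => // w h; exfalso; apply: h.
  + move=> B [hB hs]; split; first by rewrite setTD; exact: sigma_algebra_C intrinsic_sigma hB.
    move=> t t0; have [N [mN N0 NB]] := hs t t0; exists N; split => // w h.
    apply: NB => /= h'; apply: h => /= tw; rewrite /setD /=.
    by have := h' tw; tauto.
  + move=> B hB; split.
      by case: intrinsic_sigma => _ _; apply => n; have [] := hB n.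
    move=> t t0.
    have /choice[N NP] : forall n, exists N : set (sample X),
        [/\ measurable N, forall x, law X x N = 0 &
        ~` [set w | t%:E < lifetime X w -> (B n (shift X t w) <-> B n w)] `<=` N].
      by move=> n; have [_] := hB n; exact.
    exists (\bigcup_n N n); split.
    * by apply: bigcup_measurable => n _; have [] := NP n.
    * move=> x; apply: (@measure_null_bigcup _ _ _ (law X x)) => n;
      have [mN N0 _] := NP n; first [exact: mN|exact: N0].
    * move=> w h; apply: contrapT => Nw; apply: h => /= tw.
      have h n : B n (shift X t w) <-> B n w.
        apply: contrapT => h; apply: Nw; exists n => //; have [_ _] := NP n.
        by apply => /= /(_ tw).
      by split => -[n _ Bn]; exists n => //; apply/h.
- split.
    apply: strict_past_intrinsic.
    have := mB measurableT [set 1%R] (measurable_set1 _); rewrite setTI.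
    rewrite (_ : _ @^-1` _ = B)//; apply/seteqP; split => w /=; rewrite indicE.
      by case: (boolP (w \in B)) => [/set_mem//|_ /eqP]; rewrite eq_sym oner_eq0.
    by move=> Bw; rewrite mem_set.
  move=> t t0; have [N [mN N0 NB]] := hB t t0; exists N; split => // w h.
  apply: NB => /= h'; apply: h => /= tw; have := h' tw; rewrite !indicE.
  case: (boolP (shift X t w \in B)) => [/set_mem|/negP] h1;
    case: (boolP (w \in B)) => [/set_mem|/negP] h2 //= /eqP.
  - by rewrite oner_eq0.
  - by rewrite eq_sym oner_eq0.
  - move=> _; split => h3; exfalso; [apply: h1|apply: h2]; exact/mem_set.
Qed.

Lemma left_germ_intrinsic (k : sample X -> \bar R) :
  measurable_fun setT (k : g_sigma_algebraType (left_germ_field X (lifetime X)) -> \bar R) ->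
  measurable_fun setT (k : g_sigma_algebraType NN -> \bar R).
Proof.
move=> mk _ A mA; rewrite setTI -intrinsic_sigma_measurable.
by have := mk measurableT A mA; rewrite setTI => /left_germ_sets[].
Qed.

(** A function is determined by its level sets above rational numbers. *)
Lemma left_germ_shift (k : sample X -> \bar R) t :
  measurable_fun setT (k : g_sigma_algebraType (left_germ_field X (lifetime X)) -> \bar R) ->
  (forall w, 0 <= k w <= 1) -> (0 <= t)%R ->
  almost_surely X [set w | t%:E < lifetime X w -> k (shift X t w) = k w].
Proof.
move=> mk k01 t0.
(* An enumeration of the rationals; codes of no rational give [0]. *)
pose q (n : nat) : R := ratr (odflt 0%R (@choice.unpickle rat n)).
pose A n := [set w | (q n)%:E < k w].
have hA n : <<s left_germ_field X (lifetime X)>> (A n).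
  pose GT := g_sigma_algebraType (left_germ_field X (lifetime X)).
  have : measurable ([set: GT] `&` [set w : GT | (q n)%:E < k w]).
    exact: emeasurable_fun_o_infty.
  by rewrite setTI.
have /choice[N NP] : forall n, exists N : set (sample X),
    [/\ measurable N, forall x, law X x N = 0 &
    ~` [set w | t%:E < lifetime X w -> (A n (shift X t w) <-> A n w)] `<=` N].
  by move=> n; have [_] := left_germ_sets (hA n); exact.
exists (\bigcup_n N n); split.
- by apply: bigcup_measurable => n _; have [] := NP n.
- move=> x; apply: (@measure_null_bigcup _ _ _ (law X x)) => n;
      have [mN N0 _] := NP n; first [exact: mN|exact: N0].
move=> w h; apply: contrapT => Nw; apply: h => /= tw.
have h n : A n (shift X t w) <-> A n w.
  apply: contrapT => h; apply: Nw; exists n => //; have [_ _] := NP n.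
  by apply => /= /(_ tw).
have kfin v : k v \is a fin_num.
  by case/andP: (k01 v) => k0 k1; rewrite ge0_fin_numE//; exact: le_lt_trans k1 (ltry 1).
have key u v : (forall n, A n u -> A n v) -> k u <= k v.
  move=> uv; rewrite leNgt; apply/negP.
  rewrite -(fineK (kfin u)) -(fineK (kfin v)) lte_fin => /rat_in_itvoo[r].
  rewrite in_itv/= => /andP[vr ru].
  have := uv (choice.pickle r); rewrite /A /q choice.pickleK /= -(fineK (kfin u))
    -(fineK (kfin v)) !lte_fin => /(_ ru) /lt_trans /(_ vr).
  by rewrite ltxx.
by apply/eqP; rewrite eq_le !key// => n; case: (h n).
Qed.

End intrinsic_field.

Arguments intrinsic_field {R E} X.

(** * Revived paths *)

Section concatenated_paths.
Context (R : realType) (E : ptopologicalType) (Y : process R E).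
Hypothesis mY : markov_process Y.
Notation W := (nat -> sample Y).
Notation zeta := (lifetime Y).

Definition cons_leg (v : sample Y) (w : W) : W :=
  fun n => if n is m.+1 then w m else v.

Definition tail_legs (w : W) : W := fun n => w n.+1.

Definition leg_end (n : nat) (w : W) : \bar R :=
  @lifetime_sum R (fun=> E) (fun=> Y) n w.

Definition on_leg (n : nat) (t : R) (w : W) : Prop :=
  leg_end n w <= t%:E < leg_end n.+1 w.

Definition revived_path (t : R) (w : W) : option E :=
  omap (fun z : {n : nat & E} => projT2 z)
    (@concat_path R (fun=> E) (fun=> Y) t w).

Definition revived_shift (t : R) (w : W) : W :=
  @concat_shift R (fun=> E) (fun=> Y) t w.

Local Notation Z := revived_path.
Local Notation theta := revived_shift.

Lemma leg_end0 w : leg_end 0 w = 0.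
Proof. by rewrite /leg_end /lifetime_sum big_ord0. Qed.

Lemma leg_endS n w : leg_end n.+1 w = leg_end n w + zeta (w n).
Proof. by rewrite /leg_end /lifetime_sum big_ord_recr. Qed.

Lemma leg_end_recl n w : leg_end n.+1 w = zeta (w 0%N) + leg_end n (tail_legs w).
Proof. by rewrite /leg_end /lifetime_sum big_ord_recl. Qed.

Lemma leg_end_ge0 n w : 0 <= leg_end n w.
Proof. by apply: sume_ge0 => i _; exact: lifetime_ge0. Qed.

Lemma leg_end_mono m n w : (m <= n)%N -> leg_end m w <= leg_end n w.
Proof.
elim: n => [|n IH]; first by rewrite leqn0 => /eqP ->.
rewrite leq_eqVlt => /orP[/eqP -> //|]; rewrite ltnS => /IH h.
by apply: le_trans h _; rewrite leg_endS leeDl// lifetime_ge0.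
Qed.

Lemma on_leg_unique m n t w : on_leg m t w -> on_leg n t w -> m = n.
Proof.
wlog mn : m n / (m <= n)%N.
  move=> h mw nw; have [mn|/ltnW nm] := leqP m n; first exact: h.
  by apply/esym/h.
move=> /andP[_ tm] /andP[nt _]; apply/eqP; rewrite eqn_leq mn/= leqNgt.
apply/negP => mn'; have := leg_end_mono w mn'.
by rewrite leNgt (le_lt_trans nt tm).
Qed.

Lemma on_leg_ge0 n t w : on_leg n t w -> (0 <= t)%R.
Proof. by move=> /andP[+ _]; rewrite -lee_fin; apply: le_trans (leg_end_ge0 n w). Qed.

Lemma on_leg_fin n t w : on_leg n t w -> leg_end n w \is a fin_num.
Proof.
by move=> /andP[nt _]; rewrite ge0_fin_numE ?leg_end_ge0//; exact: le_lt_trans nt (ltry _).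
Qed.

Lemma no_leg t w : (0 <= t)%R -> ~ (exists n, on_leg n t w) ->
  forall n, leg_end n w <= t%:E.
Proof.
move=> t0 h; elim=> [|n IH]; first by rewrite leg_end0 lee_fin.
by rewrite leNgt; apply/negP => tn; apply: h; exists n; rewrite /on_leg IH tn.
Qed.

Lemma revived_path_leg n t w : on_leg n t w ->
  Z t w = path Y (t - fine (leg_end n w)) (w n).
Proof.
move=> nt; rewrite /Z /concat_path; case: pselect => [h|h]; last by exfalso; apply: h;
  exists n.
have -> : projT1 (cid h) = n by apply: (on_leg_unique (projT2 (cid h)) nt).
by rewrite -/(leg_end n w); case: (path Y _ _).
Qed.

Lemma revived_path_none t w : ~ (exists n, on_leg n t w) -> Z t w = None.
Proof. by move=> h; rewrite /Z /concat_path; case: pselect. Qed.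

Lemma revived_shift_leg n t w : on_leg n t w ->
  theta t w = fun i => if (i < n)%N then dead Y
    else if i == n then shift Y (t - fine (leg_end n w)) (w n) else w i.
Proof.
move=> nt; rewrite /theta /concat_shift; case: pselect => [h|h]; last by exfalso; apply: h;
  exists n.
have -> : projT1 (cid h) = n by apply: (on_leg_unique (projT2 (cid h)) nt).
by apply/funext => i; case: ltnP => // _; case: eqP => // ->.
Qed.

Lemma revived_shift_none t w : ~ (exists n, on_leg n t w) ->
  theta t w = fun=> dead Y.
Proof. by move=> h; rewrite /theta /concat_shift; case: pselect. Qed.

Lemma on_leg0 t w : on_leg 0 t w <-> (0 <= t)%R /\ t%:E < zeta (w 0%N).
Proof.
rewrite /on_leg leg_end0 leg_endS leg_end0 add0e lee_fin.
by split => [/andP[]|[-> ->]].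
Qed.

Lemma on_legS n t w : on_leg n.+1 t w <-> zeta (w 0%N) <= t%:E /\
  on_leg n (t - fine (zeta (w 0%N))) (tail_legs w).
Proof.
have z0 := lifetime_ge0 (w 0%N).
have e1 : zeta (w 0%N) <= t%:E -> zeta (w 0%N) \is a fin_num.
  by move=> zt; rewrite ge0_fin_numE//; exact: le_lt_trans zt (ltry _).
rewrite /on_leg !leg_end_recl; split.
- move=> /andP[h1 h2].
  have zt : zeta (w 0%N) <= t%:E.
    by apply: le_trans h1; rewrite leeDl// leg_end_ge0.
  split => //; rewrite EFinB fineK ?e1//.
  by rewrite leeBrDl ?e1// h1/= lteBlDl ?e1.
- move=> [zt]; rewrite EFinB fineK ?e1// leeBrDl ?e1// lteBlDl ?e1//.
Qed.

Lemma revived_path_before t w : (0 <= t)%R -> t%:E < zeta (w 0%N) ->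
  Z t w = path Y t (w 0%N).
Proof.
move=> t0 tz; rewrite (@revived_path_leg 0) ?leg_end0 ?subr0//.
exact/on_leg0.
Qed.

Lemma revived_shift_before t w : (0 <= t)%R -> t%:E < zeta (w 0%N) ->
  theta t w = cons_leg (shift Y t (w 0%N)) (tail_legs w).
Proof.
move=> t0 tz; rewrite (@revived_shift_leg 0) ?leg_end0 ?subr0//; last exact/on_leg0.
by apply/funext => -[|i].
Qed.

Lemma leg_after t w : zeta (w 0%N) <= t%:E -> (exists n, on_leg n t w) <->
  exists n, on_leg n (t - fine (zeta (w 0%N))) (tail_legs w).
Proof.
move=> zt; split => [[[|n]]|[n nt]].
- by move=> /on_leg0[_]; rewrite ltNge zt.
- by move=> /on_legS[_ ?]; exists n.
- by exists n.+1; apply/on_legS.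
Qed.

Lemma revived_path_after t w : zeta (w 0%N) <= t%:E ->
  Z t w = Z (t - fine (zeta (w 0%N))) (tail_legs w).
Proof.
move=> zt; have [[n nt]|h] := pselect (exists n, on_leg n (t - fine (zeta (w 0%N))) (tail_legs w)).
- have nt' : on_leg n.+1 t w by apply/on_legS.
  rewrite (revived_path_leg nt) (revived_path_leg nt') leg_end_recl fineD.
  + by rewrite opprD addrA.
  + by rewrite ge0_fin_numE ?lifetime_ge0//; exact: le_lt_trans zt (ltry _).
  + exact: on_leg_fin nt.
- by rewrite (revived_path_none h) revived_path_none// => /(leg_after zt).
Qed.

Lemma revived_shift_after t w : zeta (w 0%N) <= t%:E ->
  theta t w = cons_leg (dead Y) (theta (t - fine (zeta (w 0%N))) (tail_legs w)).
Proof.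
move=> zt; have [[n nt]|h] := pselect (exists n, on_leg n (t - fine (zeta (w 0%N))) (tail_legs w)).
- have nt' : on_leg n.+1 t w by apply/on_legS.
  rewrite (revived_shift_leg nt) (revived_shift_leg nt') leg_end_recl fineD.
  + by apply/funext => -[|i]; rewrite //= ltnS eqSS opprD addrA.
  + by rewrite ge0_fin_numE ?lifetime_ge0//; exact: le_lt_trans zt (ltry _).
  + exact: on_leg_fin nt.
- rewrite (revived_shift_none h) revived_shift_none; last by move=> /(leg_after zt).
  by apply/funext => -[|i].
Qed.

Lemma lifetime_dead : zeta (dead Y) = 0.
Proof. exact: dead_lifetime mY. Qed.

(** A leg that is dead from the start takes no time. *)
Lemma revived_path_cons_dead t w : (0 <= t)%R -> Z t (cons_leg (dead Y) w) = Z t w.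
Proof.
by move=> t0; rewrite revived_path_after /= lifetime_dead ?lee_fin// subr0.
Qed.

Lemma revived_path_dead t : (0 <= t)%R -> Z t (fun=> dead Y) = None.
Proof.
move=> t0; apply: revived_path_none => -[n /andP[_]].
rewrite /leg_end /lifetime_sum big1; first by rewrite ltNge lee_fin t0.
by move=> i _; exact: lifetime_dead.
Qed.

Lemma revived_path_shift s t w : (0 <= s)%R -> (0 <= t)%R ->
  Z s (theta t w) = Z (s + t) w.
Proof.
move=> s0 t0; have [[n]|h] := pselect (exists n, on_leg n t w); last first.
  rewrite revived_shift_none// revived_path_dead// revived_path_none//.
  move=> [n nst]; have st : (t <= s + t)%R by rewrite lerDr.
  have /(_ n.+1) := no_leg t0 h; case/andP: nst => _ h1 h2.
  have := lt_le_trans h1 h2; rewrite lte_fin => /(le_lt_trans st).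
  by rewrite ltxx.
elim: n t t0 w => [|n IH] t t0 w.
- move=> /on_leg0[_ tz].
  rewrite revived_shift_before//.
  have zs := lifetime_shift mY t0 tz.
  have [sz|zs'] := ltP s%:E (zeta (shift Y t (w 0%N))).
  + rewrite revived_path_before// revived_path_before ?addr_ge0//.
      by rewrite /= (path_shift mY).
    by move: sz; rewrite zs lteBrDr// -EFinD.
  + have zst : zeta (w 0%N) <= (s + t)%:E by move: zs'; rewrite zs leeBlDr.
    rewrite revived_path_after// [RHS]revived_path_after//=; congr (Z _ _).
    have zf : zeta (w 0%N) \is a fin_num.
      by rewrite ge0_fin_numE ?lifetime_ge0//; exact: le_lt_trans zst (ltry _).
    by rewrite zs fineB// opprB addrA.
- move=> /on_legS[zt nt]; rewrite revived_shift_after//.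
  rewrite revived_path_cons_dead// IH//; last exact: on_leg_ge0 nt.
  rewrite [RHS]revived_path_after ?addrA//.
  by apply: le_trans zt _; rewrite lee_fin lerDr.
Qed.

Lemma revived_path_some n t w : on_leg n t w -> exists y, Z t w = Some y.
Proof.
move=> nt; rewrite (revived_path_leg nt).
case pt : (path Y _ _) => [y|]; first by exists y.
have n0 : (0 <= t - fine (leg_end n w))%R.
  by case/andP: nt (nt) => h _ /on_leg_fin f; rewrite subr_ge0 -lee_fin fineK.
have /(path_noneP mY _ n0) := pt.
rewrite EFinB fineK ?(on_leg_fin nt)// leNgt => /negP[].
by case/andP: nt (on_leg_fin nt) => _; rewrite leg_endS => h f; rewrite lteBlDl.
Qed.

Lemma revived_path_noneP t w : (0 <= t)%R ->
  Z t w = None <-> forall n, leg_end n w <= t%:E.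
Proof.
move=> t0; split => [zt|h].
  by apply: no_leg => // -[n /revived_path_some[y]]; rewrite zt.
by apply: revived_path_none => -[n /andP[_]]; rewrite ltNge h.
Qed.

Lemma on_leg_right n t w : on_leg n t w -> exists2 d : R, (0 < d)%R &
  forall s, (t <= s)%R -> (s < t + d)%R -> on_leg n s w.
Proof.
move=> /andP[nt tn].
have leg s : (t <= s)%R -> s%:E < leg_end n.+1 w -> on_leg n s w.
  by move=> ts sn; apply/andP; split => //; apply: le_trans nt _; rewrite lee_fin.
case En : (leg_end n.+1 w) (leg_end_ge0 n.+1 w) => [r| |] // _.
  exists (r - t)%R; first by rewrite subr_gt0 -lte_fin -En.
  by move=> s ts; rewrite addrC subrK => sr; apply: leg => //; rewrite En lte_fin.
by exists 1%R => // s ts _; apply: leg => //; rewrite En ltry.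
Qed.

Lemma no_leg_after t s w : (0 <= t)%R -> ~ (exists n, on_leg n t w) ->
  (t <= s)%R -> Z s w = None.
Proof.
move=> t0 h ts; apply/revived_path_noneP; first exact: le_trans ts.
by move=> n; apply: le_trans (no_leg t0 h n) _; rewrite lee_fin.
Qed.

Lemma revived_path_right w : right_continuous_path (fun t => Z t w).
Proof.
move=> t t0; have [[n nt]|h] := pselect (exists n, on_leg n t w); last first.
  rewrite revived_path_none//; near=> s; apply: (no_leg_after t0 h).
  by near: s; exact: nbhs_right_ge.
have nf := on_leg_fin nt.
have [y yt] := revived_path_some nt; rewrite yt => U yU.
pose a := fine (leg_end n w).
have ta : (0 <= t - a)%R by rewrite subr_ge0 -lee_fin fineK//; case/andP: nt.
have yta : path Y (t - a) (w n) = Some y by rewrite -(revived_path_leg nt).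
have := right_continuous_some ta (path_right mY (w n)) yta yU.
move=> /near_rightP[e e0 eP]; have [d d0 dP] := on_leg_right nt.
near=> s.
have ts : (t < s)%R by near: s; exact: nbhs_right_gt.
rewrite (@revived_path_leg n); last first.
  apply: dP; first exact: ltW.
  by near: s; apply: nbhs_right_lt; rewrite ltrDl.
apply: eP; first by rewrite ltrD2r.
rewrite addrAC ltrD2r; near: s; apply: nbhs_right_lt.
by rewrite ltrDl.
Unshelve. all: by end_near. Qed.

End concatenated_paths.

Arguments tail_legs {R E Y} w.

(** * The product of the path fields *)

Section product_field.
Context (R : realType) (E : ptopologicalType) (Y : process R E).
Hypothesis mY : markov_process Y.
Notation W := (nat -> sample Y).
Notation zeta := (lifetime Y).
Notation nonneg := [set t : R | (0 <= t)%R].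
Notation pf := (path_field (path Y) nonneg).
Notation Z := (@revived_path R E Y).

(** The fields of the legs are taken before any completion: laws are then
    determined by their values on rectangles of path events. *)
Definition leg_cylinders : set (set W) :=
  [set C | exists n A, pf A /\ C = (fun w : W => w n) @^-1` A].

Notation prodf := <<s leg_cylinders>>.
Notation WP := (g_sigma_algebraType leg_cylinders).

Lemma prodf_coord n A : pf A -> prodf ((fun w : W => w n) @^-1` A).
Proof. by move=> pA; apply: sub_sigma_algebra; exists n, A. Qed.

Lemma measurable_lifetime :
  measurable_fun setT (zeta : g_sigma_algebraType pf -> \bar R).
Proof.
apply: (measurability _ (ErealGenOInfty.measurableE R)) => _ /= -[_ [r ->] <-].
rewrite setTI -pf_sigma_measurable.
have [r0|r0] := ltP r 0%R.
  rewrite (_ : _ @^-1` _ = setT);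
    first exact: sigma_algebra_T (path_field_sigma (path Y) nonneg).
  apply/seteqP; split => w //= _; rewrite in_itv/= andbT.
  by apply: lt_le_trans (lifetime_ge0 w); rewrite lte_fin.
rewrite (_ : _ @^-1` _ = path Y r @^-1` (Some @` setT)).
  exact: path_field_alive.
apply/seteqP; split => w; rewrite /= in_itv/= andbT; first exact: (lifetime_gtP mY w r0).2.
exact: (lifetime_gtP mY w r0).1.
Qed.

Lemma measurable_leg_end n : measurable_fun setT (leg_end n : WP -> \bar R).
Proof.
elim: n => [|n IH].
  rewrite (_ : leg_end 0 = cst 0)//.
  by apply/funext => w; exact: leg_end0.
rewrite (_ : leg_end n.+1 = fun w => leg_end n w + zeta (w n)); last first.
  by apply/funext => w; exact: leg_endS.
apply: emeasurable_funD => // _ A mA; rewrite setTI.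
rewrite (_ : _ @^-1` A = (fun w : W => w n) @^-1` (zeta @^-1` A))//.
apply: prodf_coord; rewrite pf_sigma_measurable.
by have := measurable_lifetime measurableT mA; rewrite setTI.
Qed.

Lemma measurable_on_leg n t : measurable ([set w : WP | on_leg n t w]).
Proof.
rewrite (_ : [set w | _] = (setT `&` [set w : WP | leg_end n w <= t%:E]) `&`
    (setT `&` [set w : WP | t%:E < leg_end n.+1 w])).
  apply: measurableI.
    apply: emeasurable_fun_infty_c => //; exact: measurable_leg_end.
  apply: emeasurable_fun_o_infty => //; exact: measurable_leg_end.
by rewrite !setTI; apply/seteqP; split => w /=; rewrite /on_leg => /andP.
Qed.

(** On leg [n] the revived path is the path of that leg at a random time, the
    time elapsed since the leg began. *)
Lemma measurable_revived_path t (B : set (borelType E)) : (0 <= t)%R ->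
  measurable B -> prodf (Z t @^-1` (Some @` B)).
Proof.
move=> t0 mB.
(* The maximum keeps the random time nonnegative where leg [n] has not begun. *)
pose rho n (w : WP) := Num.max 0%R (t - fine (leg_end n w))%R.
rewrite (_ : _ @^-1` _ = \bigcup_n ([set w : WP | on_leg n t w] `&`
    [set w : WP | (Some @` B) (path Y (rho n w) (w n))])).
  apply: (@bigcup_measurable _ WP) => n _; apply: measurableI.
    exact: measurable_on_leg.
  apply: (measurable_random_time (state_radon mY)
    (X := fun s (w : WP) => path Y s (w n))) => //.
  - by move=> w; exact: (path_right mY).
  - move=> s C s0 mC.
    rewrite (_ : _ @^-1` _ = (fun w : W => w n) @^-1` (path Y s @^-1` (Some @` C)))//.
    by apply: prodf_coord; exact: path_field_gen.
  - apply: measurable_maxr => //; apply: measurable_funB => //.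
    by apply: measurableT_comp => //; exact: measurable_leg_end.
  - by move=> w; rewrite /rho le_max lexx.
have rhoE n w : on_leg n t w -> rho n w = (t - fine (leg_end n w))%R.
  move=> nt; rewrite /rho; apply/max_idPr.
  by rewrite subr_ge0 -lee_fin fineK ?(on_leg_fin nt)//; case/andP: nt.
apply/seteqP; split => w.
- move=> [y By yw]; have [[n nt]|h] := pselect (exists n, on_leg n t w).
    by exists n => //; split => //=; rewrite rhoE// -(revived_path_leg nt); exists y.
  by move: yw; rewrite revived_path_none.
- by move=> [n _ [nt]]; rewrite /= rhoE// (revived_path_leg nt).
Qed.

Lemma revived_field_prodf I : I `<=` nonneg -> path_field Z I `<=` prodf.
Proof.
move=> I0; apply: path_field_sub => [|t B It mB]; first exact: sigma_algebra_generated.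
by apply: measurable_revived_path => //; exact: I0.
Qed.

Definition leg_rect (A : nat -> set (sample Y)) : set W :=
  [set w | forall i, A i (w i)].

(** Only finitely many legs are constrained: this is the pi-system on which
    laws of sequences of legs are compared. *)
Definition leg_rects : set (set W) :=
  [set C | exists A N, [/\ forall i, pf (A i),
    forall i, (N <= i)%N -> A i = setT & C = leg_rect A]].

Lemma leg_rectsI : setI_closed leg_rects.
Proof.
move=> _ _ [A [N [pA AN ->]]] [A' [N' [pA' AN' ->]]].
exists (fun i => A i `&` A' i), (maxn N N'); split.
- move=> i; exact: (sigma_algebra_I (path_field_sigma (path Y) nonneg)).
- by move=> i; rewrite geq_max => /andP[Ni N'i]; rewrite AN// AN'// setTI.
- apply/seteqP; split => w; first by move=> [h h'] i; split.
  by move=> h; split => i; have [] := h i.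
Qed.

Lemma leg_rect_prodf A : (forall i, pf (A i)) -> prodf (leg_rect A).
Proof.
move=> pA; rewrite (_ : leg_rect A = \bigcap_i ((fun w : W => w i) @^-1` A i)).
  apply: (@bigcapT_measurable _ WP) => i; exact: prodf_coord.
by apply/seteqP; split => w h i; [move=> _|]; exact: h.
Qed.

Lemma leg_rects_generate : prodf = <<s leg_rects>>.
Proof.
apply/seteqP; split; apply: smallest_sub; try exact: sigma_algebra_generated.
- move=> _ [n [A [pA ->]]]; apply: sub_sigma_algebra.
  exists (fun i => if i == n then A else setT), n.+1; split.
  + move=> i; case: eqP => // _.
    exact: (sigma_algebra_T (path_field_sigma (path Y) nonneg)).
  + by move=> i ni; rewrite gtn_eqF.
  + apply/seteqP; split => w /=; first by move=> Aw i; case: eqP => // ->.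
    by move=> /(_ n); rewrite eqxx.
- by move=> _ [A [N [pA _ ->]]]; exact: leg_rect_prodf.
Qed.

Lemma cons_leg_rect v A : cons_leg v @^-1` leg_rect A =
  if `[< A 0%N v >] then leg_rect (fun i => A i.+1) else set0.
Proof.
case: asboolP => Av; apply/seteqP; split => w //=.
- by move=> h i; exact: (h i.+1).
- by move=> h [|i] //=; exact: h.
Qed.

Lemma prodf_cons_leg v G : prodf G -> prodf (cons_leg v @^-1` G).
Proof.
apply: sigma_algebra_preimage => [|_ [n [A [pA ->]]]]; first exact: sigma_algebra_generated.
case: n => [|n]; last exact: prodf_coord.
have [Av|Av] := pselect (A v).
  rewrite (_ : _ @^-1` _ = setT); last by apply/seteqP; split.
  by apply: sigma_algebra_T; exact: sigma_algebra_generated.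
rewrite (_ : _ @^-1` _ = set0); last by apply/seteqP; split.
exact: sigma_algebra0.
Qed.

Lemma measurable_cons_leg v : measurable_fun setT (cons_leg v : WP -> WP).
Proof. by move=> _ A mA; rewrite setTI; exact: prodf_cons_leg. Qed.

End product_field.

Arguments leg_cylinders {R E} Y.
Arguments leg_rects {R E} Y.

(** * Conditioning on the first leg *)

Lemma measure_probability d (T : measurableType d) (R : realType)
    (m : {measure set T -> \bar R}) : m setT = 1 ->
  exists q : probability T R, forall A, q A = m A.
Proof.
move=> mT; exists (mnormalize m (dirac point)) => A.
rewrite /= /mnormalize mT ifF ?fineK//= ?invr1 ?mule1//.
by rewrite onee_eq0.
Qed.

Section first_leg.
Context (R : realType) (E : ptopologicalType) (Y : process R E).
Hypothesis mY : markov_process Y.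
Context (K : transfer_kernel E Y).
Context (P : {n : nat & E} ->
  probability (@concat_sample R (fun=> E) (fun=> Y)) R).
Hypothesis hP : @concat_law R (fun=> E) (fun=> Y) (fun=> K) P.
Notation W := (nat -> sample Y).
Notation UE := (univType R E).
Notation nonneg := [set t : R | (0 <= t)%R].
Notation pf := (path_field (path Y) nonneg).
Notation NN := (intrinsic_field Y).
Notation prodf := <<s leg_cylinders Y>>.
Notation WP := (g_sigma_algebraType (leg_cylinders Y)).

Lemma prodf_concat : prodf `<=` (measurable :
  set (set (@concat_sample R (fun=> E) (fun=> Y)))).
Proof.
apply: smallest_sub; first exact: sigma_algebra_measurable.
move=> _ [n [A [pA ->]]]; apply: sub_sigma_algebra; exists n, A; split => //.
exact: sub_augmentation.
Qed.

(** The probability that the first [k + 1] legs lie in the sides of a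
    rectangle when the first one starts at [x]. *)
Fixpoint rect_weight (k : nat) (A : nat -> set (sample Y)) (x : E) : \bar R :=
  if k is k'.+1 then \int[law Y x]_v ((\1_(A 0%N) v)%:E *
      \int[K v]_y rect_weight k' (fun i => A i.+1) y)
  else law Y x (A 0%N).

Definition cyl (N : nat) (A : nat -> set (sample Y)) : set W :=
  [set w | forall i, (i <= N)%N -> A i (w i)].

Lemma leg_integral_rect k n N x (w : W) (A : nat -> set (sample Y)) :
  N = (n + k)%N -> (forall i, measurable (A i)) ->
  @leg_integral R (fun=> E) (fun=> Y) (fun=> K) k n x w
    (fun w => (\1_(cyl N A) w)%:E) =
  if `[< forall i, (i < n)%N -> A i (w i) >] then
    rect_weight k (fun i => A (n + i)%N) x else 0.
Proof.
move=> NE mA; elim: k n N x w NE => [|k IH] n N x w NE /=.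
- rewrite addn0 in NE; subst N.
  case: asboolP => h.
  + rewrite addn0 -(setIT (A n)) -integral_indic//.
    apply: eq_integral => v _; congr (_%:E); rewrite !indicE.
    congr (nat_of_bool _)%:R; apply/idP/idP => /set_mem hv; apply/mem_set.
      by have := hv n (leqnn n); rewrite dfwithin.
    move=> i; rewrite leq_eqVlt => /orP[/eqP ->|ni]; first by rewrite dfwithin.
    by rewrite dfwithout ?gtn_eqF//; exact: h.
  + rewrite integral0_eq// => v _; rewrite indicE memNset// => hv; apply: h => i ni.
    by have := hv i (ltnW ni); rewrite dfwithout ?gtn_eqF.
- have NE' : N = (n.+1 + k)%N by rewrite NE addSnnS.
  under eq_integral do under eq_integral do rewrite (IH _ _ _ _ NE').
  case: asboolP => h.
  + apply: eq_integral => v _; rewrite addn0 indicE.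
    have [Av|Av] := pselect (A n v).
      rewrite mem_set// mul1e; apply: eq_integral => y _.
      rewrite ifT; first by congr rect_weight; apply/funext => i; rewrite addSnnS.
      apply/asboolP => i; rewrite ltnS leq_eqVlt => /orP[/eqP ->|ni].
        by rewrite dfwithin.
      by rewrite dfwithout ?gtn_eqF//; exact: h.
    rewrite memNset// mul0e integral0_eq// => y _; rewrite ifF//.
    by apply/asboolP => /(_ n (leqnn _)); rewrite dfwithin.
  + rewrite integral0_eq// => v _; rewrite integral0_eq// => y _.
    rewrite ifF//; apply/asboolP => h'; apply: h => i ni.
    by have := h' i (ltnW ni); rewrite dfwithout ?gtn_eqF.
Qed.

(** The legs before [n] are dead, so their sides are tested on the dead path. *)
Lemma law_leg_rect n N k x (A : nat -> set (sample Y)) :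
  (forall i, pf (A i)) -> (forall i, (N <= i)%N -> A i = setT) -> (N <= n + k)%N ->
  P (existT _ n x) (leg_rect A) =
  if `[< forall i, (i < n)%N -> A i (dead Y) >] then
    rect_weight k (fun i => A (n + i)%N) x else 0.
Proof.
move=> pA AN Nnk.
have cE : leg_rect A = cyl (n + k) A.
  apply/seteqP; split => w h i; first by move=> _; exact: h.
  have [/h //|nki] := leqP i (n + k).
  by rewrite AN//; apply: leq_trans Nnk _; exact: ltnW.
have mc : <<s @cylinders R (fun=> E) (fun=> Y) [set i | (i <= n + k)%N] >> (cyl (n + k) A).
  rewrite (_ : cyl _ _ = \bigcap_i (if (i <= n + k)%N then (fun w : W => w i) @^-1` A i else setT)).
    apply: sigma_algebra_bigcap => [|i]; first exact: sigma_algebra_generated.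
    case: leqP => ik; last exact: (sigma_algebra_T (@sigma_algebra_generated W _)).
    apply: sub_sigma_algebra; exists i, (A i); split => //.
    exact: sub_augmentation.
  apply/seteqP; split => w h i => [_|ik]; first by case: leqP => // /h.
  by have := h i I; rewrite ik.
pose T0 := g_sigma_algebraType
  (@cylinders R (fun=> E) (fun=> Y) [set i | (i <= n + k)%N]).
have := @hP n x k \1_(cyl (n + k) A) _ _.
rewrite integral_indic// ?setIT; last first.
  by rewrite -cE; apply: prodf_concat; exact: leg_rect_prodf.
rewrite cE => ->.
- by apply: leg_integral_rect => // i; exact: (pf_measurable mY).
- by apply: (@measurable_indic _ T0).
- exists 1%R => w; rewrite indicE; case: (_ \in _); rewrite ?normr0 ?normr1//.
Qed.

(** On the product field the laws will depend measurably on the starting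
    point. *)
Lemma revived_law_exists : exists pp : E -> probability WP R,
  forall x A, prodf A -> pp x A = P (existT _ 0%N x) A.
Proof.
have h x : exists q : probability WP R,
    forall A, prodf A -> q A = P (existT _ 0%N x) A.
  exact: (@restriction_exists _ (@concat_sample R (fun=> E) (fun=> Y)) R
    (P (existT _ 0%N x)) (leg_cylinders Y) prodf_concat).
by have [pp ppE] := choice h; exists pp.
Qed.

Context (pp : E -> probability WP R).
Hypothesis ppE : forall x A, prodf A -> pp x A = P (existT _ 0%N x) A.

Lemma revived_law_rect x N (A : nat -> set (sample Y)) :
  (forall i, pf (A i)) -> (forall i, (N <= i)%N -> A i = setT) ->
  pp x (leg_rect A) = rect_weight N A x.
Proof.
move=> pA AN; rewrite ppE; last exact: leg_rect_prodf.
by rewrite (@law_leg_rect 0 N N)//; case: asboolP => // h; exfalso; apply: h.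
Qed.

(** All legs have the same law and the same transfer kernel, so the weight of
    a rectangle does not depend on the number of the leg it begins with. *)
Lemma law_next_leg n (x : E) G : prodf G ->
  P (existT _ n.+1 x) G = P (existT _ n x) (cons_leg (dead Y) @^-1` G).
Proof.
have h z : exists q : probability WP R, forall A, prodf A -> q A = P z A.
  exact: (@restriction_exists _ (@concat_sample R (fun=> E) (fun=> Y)) R
    (P z) (leg_cylinders Y) prodf_concat).
have [q qE] := choice h.
have [l [lE _]] := image_measure_exists (q (existT _ n x))
  (@measurable_cons_leg R E Y (dead Y)).
move=> pG; transitivity (q (existT _ n.+1 x) G); first exact/esym/qE.
transitivity (q (existT _ n x) (cons_leg (dead Y) @^-1` G)); last first.
  by apply: qE; exact: prodf_cons_leg.
rewrite -lE; apply: (@pi_measure_eq _ WP R (leg_rects Y)) => //.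
- exact: leg_rects_generate.
- exact: leg_rectsI.
- exact: probability_lty.
- rewrite lE preimage_setT; transitivity (1 : \bar R); first exact: probability_setT.
  exact: esym (probability_setT _).
move=> _ [A [N [pA AN ->]]]; rewrite lE.
transitivity (P (existT _ n.+1 x) (leg_rect A)).
  by apply: qE; exact: leg_rect_prodf.
transitivity (P (existT _ n x) (cons_leg (dead Y) @^-1` leg_rect A)); last first.
  by apply/esym/qE; apply: prodf_cons_leg; exact: leg_rect_prodf.
rewrite cons_leg_rect (@law_leg_rect n.+1 N N)//; last by rewrite leq_addl.
have -> : `[< forall i, (i < n.+1)%N -> A i (dead Y) >] =
    `[< A 0%N (dead Y) >] && `[< forall i, (i < n)%N -> A i.+1 (dead Y) >].
  apply/asboolP/andP => [h'|[/asboolP h0 /asboolP h']].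
    by split; apply/asboolP; [exact: h'|move=> i ni; exact: h'].
  by move=> [|i] //; exact: h'.
case: asboolP => /= h0; last by rewrite measure0.
rewrite (@law_leg_rect n N N)//.
- by move=> i Ni; apply: AN; exact: leqW.
- by rewrite leq_addl.
Qed.

(** Dead legs are invisible in the revived path, so the number of the
    starting leg has no influence on its law. This is where the equality of
    the two processes and of the two kernels enters. *)
Lemma law_any_leg n (x : E) G : path_field (@revived_path R E Y) nonneg G ->
  P (existT _ n x) G = pp x G.
Proof.
move=> zG; have pG : prodf G by apply: revived_field_prodf zG.
elim: n => [|n IH]; first by rewrite ppE.
rewrite law_next_leg// -IH; congr (P _ _); apply/seteqP.
by split => w; apply (path_field_determined zG) => t t0;
  rewrite revived_path_cons_dead.
Qed.

Lemma rect_weight_ge0 k A x : 0 <= rect_weight k A x.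
Proof.
elim: k A x => [|k IH] A x /=; first exact: measure_ge0.
apply: integral_ge0 => v _; rewrite mule_ge0 ?lee_fin//.
by apply: integral_ge0 => y _; exact: IH.
Qed.

Lemma measurable_kernel_integral (u : E -> \bar R) :
  measurable_fun setT (u : UE -> \bar R) -> (forall y, 0 <= u y) ->
  measurable_fun setT ((fun v => \int[K v]_y u y) :
    g_sigma_algebraType (left_germ_field Y (lifetime Y)) -> \bar R).
Proof.
move=> mu u0; apply: measurable_fun_integral_kernel => // U mU.
exact: measurable_kernel.
Qed.

Lemma measurable_first_leg (A : set (sample Y)) (u : E -> \bar R) : pf A ->
  measurable_fun setT (u : UE -> \bar R) -> (forall y, 0 <= u y) ->
  measurable_fun setT ((fun v => (\1_A v)%:E * \int[K v]_y u y) :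
    g_sigma_algebraType NN -> \bar R).
Proof.
move=> pA mu u0; apply: emeasurable_funM.
  apply/measurable_EFinP; apply: measurable_indic.
  by rewrite -intrinsic_sigma_measurable; exact: pf_intrinsic.
by apply: (left_germ_intrinsic mY); exact: measurable_kernel_integral.
Qed.

Lemma measurable_rect_weight k A : (forall i, pf (A i)) ->
  measurable_fun setT (rect_weight k A : UE -> \bar R).
Proof.
elim: k A => [|k IH] A pA /=; first exact: law_measurable_pf.
apply: (integral_law_measurable mY).
  apply: measurable_first_leg => //; first exact: IH.
  by move=> y; exact: rect_weight_ge0.
move=> v; rewrite mule_ge0 ?lee_fin//; apply: integral_ge0 => y _.
exact: rect_weight_ge0.
Qed.

Lemma measurable_revived_law G : prodf G ->
  measurable_fun setT ((fun y => pp y G) : UE -> \bar R).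
Proof.
move=> pG; apply: (@pi_kernel_measurable _ _ UE WP R (leg_rects Y)) => //.
- exact: leg_rects_generate.
- exact: leg_rectsI.
move=> _ [A [N [pA AN ->]]].
rewrite (_ : (fun y => _) = rect_weight N A); first exact: measurable_rect_weight.
by apply/funext => y; exact: revived_law_rect.
Qed.

Lemma measurable_integral_revived (phi : W -> \bar R) :
  measurable_fun setT (phi : WP -> \bar R) -> (forall w, 0 <= phi w) ->
  measurable_fun setT ((fun y => \int[pp y]_w phi w) : UE -> \bar R).
Proof.
move=> mphi phi0; apply: (@measurable_fun_integral_kernel _ _ UE WP) => // U mU.
exact: measurable_revived_law.
Qed.

(** The law of the legs after the first one, given the first one. *)
Lemma next_legs_law : exists kappa : sample Y -> probability WP R,
  forall v A, kappa v A = \int[K v]_y pp y A.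
Proof.
suff h v : exists q : probability WP R, forall A, q A = \int[K v]_y pp y A.
  by have [kappa kappaE] := choice h; exists kappa.
have mpp (A : set WP) : measurable A ->
    measurable_fun setT ((pp : UE -> {measure set WP -> \bar R}) ^~ A).
  exact: measurable_revived_law.
have [m mE] := mixture_measure (K v) mpp.
have mT : m setT = 1.
  rewrite mE; transitivity (\int[K v]_y (cst 1 y)).
    by apply: eq_integral => y _; exact: probability_setT.
  by rewrite integral_cst// mul1e; exact: prob_kernel.
by have [q qE] := measure_probability mT; exists q => A; rewrite qE mE.
Qed.

(** Given the first leg, the sequence consists of this leg followed by legs
    with the law above. *)
Lemma first_leg_kernel : exists kappa : sample Y -> probability WP R,
  [/\ forall G, prodf G -> measurable_fun setT
        ((fun v => kappa v G) : g_sigma_algebraType NN -> \bar R),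
      forall x G, prodf G -> pp x G = \int[law Y x]_v kappa v G &
      forall v phi, measurable_fun setT (phi : WP -> \bar R) ->
        (forall w, 0 <= phi w) -> \int[kappa v]_w phi w =
        \int[K v]_y \int[pp y]_w phi (cons_leg v w)].
Proof.
have [ka kaE] := next_legs_law.
suff h v : exists q : probability WP R,
    (forall B, q B = ka v (cons_leg v @^-1` B)) /\
    forall phi, measurable_fun setT (phi : WP -> \bar R) ->
        (forall w, 0 <= phi w) ->
        \int[q]_w phi w = \int[ka v]_w phi (cons_leg v w).
  have [kc kcP] := choice h.
  have kcE v A : (forall i, pf (A i)) -> kc v (leg_rect A) =
      (\1_(A 0%N) v)%:E * \int[K v]_y pp y (leg_rect (fun i => A i.+1)).
    move=> pA; rewrite (kcP v).1 cons_leg_rect indicE.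
    case: asboolP => Av; first by rewrite mem_set// mul1e kaE.
    by rewrite memNset// mul0e measure0.
  have mrect (A : nat -> set (sample Y)) : (forall i, pf (A i)) ->
      measurable_fun setT ((fun y => pp y (leg_rect A)) : UE -> \bar R).
    by move=> pA; apply: measurable_revived_law; exact: leg_rect_prodf.
  have mkc G : prodf G -> measurable_fun setT
        ((fun v => kc v G) : g_sigma_algebraType NN -> \bar R).
    move=> pG; apply: (@pi_kernel_measurable _ _ (g_sigma_algebraType NN) WP R
      (leg_rects Y)) => //.
    - exact: leg_rects_generate.
    - exact: leg_rectsI.
    move=> _ [A [N [pA AN ->]]].
    rewrite (_ : (fun v => _) = fun v =>
      (\1_(A 0%N) v)%:E * \int[K v]_y pp y (leg_rect (fun i => A i.+1))).
      by apply: measurable_first_leg => //; exact: mrect.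
    by apply/funext => v; exact: kcE.
  exists kc; split => //.
  - move=> x G pG; have [q qE] := intrinsic_restriction mY.
    have [m mE] := mixture_measure (q x)
      (mkc : forall A, measurable A -> measurable_fun setT
        ((kc : g_sigma_algebraType NN -> {measure set WP -> \bar R}) ^~ A)).
    have mE' B : prodf B -> m B = \int[law Y x]_v kc v B.
      move=> pB; rewrite mE; apply: (integral_intrinsic mY (qE x)) => //.
      exact: mkc.
    rewrite -mE'//; apply: (@pi_measure_eq _ WP R (leg_rects Y)) => //.
    + exact: leg_rects_generate.
    + exact: leg_rectsI.
    + exact: probability_lty.
    + rewrite mE'; last exact: (sigma_algebra_T (@sigma_algebra_generated W _)).
      apply: (etrans (probability_setT (pp x))).
      rewrite -[LHS](integral_cst_probability (law Y x)).
      by apply: eq_integral => v _; exact: esym (probability_setT _).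
    + move=> _ [A [N [pA AN ->]]]; rewrite mE'; last exact: leg_rect_prodf.
      apply: (etrans (@revived_law_rect x N.+1 A pA _)).
        by move=> i Ni; apply: AN; exact: ltnW.
      apply: eq_integral => v _; rewrite kcE//; congr (_ * _).
      apply: eq_integral => y _; apply/esym/revived_law_rect => // i Ni.
      by apply: AN; exact: leqW.
  - move=> v phi mphi phi0; rewrite (kcP v).2//.
    have mpp (A : set WP) : measurable A ->
      measurable_fun setT ((pp : UE -> {measure set WP -> \bar R}) ^~ A).
      exact: measurable_revived_law.
    rewrite (@integral_mixture _ _ UE WP R (K v) pp (ka v) mpp) => [//|A mA| |w].
    + exact: kaE.
    + exact: measurableT_comp mphi (@measurable_cons_leg R E Y v).
    + exact: phi0.
have [l [lE lI]] := image_measure_exists (ka v) (@measurable_cons_leg R E Y v).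
have lT : l setT = 1.
  by rewrite lE preimage_setT; exact: probability_setT.
have [q qE] := measure_probability lT; exists q; split.
  by move=> B; rewrite qE lE.
move=> phi mphi phi0; rewrite -lI//; apply: eq_measure_integral => A _ _.
exact: qE.
Qed.

Lemma first_leg_integral x (phi : W -> \bar R) :
  measurable_fun setT (phi : WP -> \bar R) -> (forall w, 0 <= phi w) ->
  \int[pp x]_w phi w =
  \int[law Y x]_v \int[K v]_y \int[pp y]_w phi (cons_leg v w).
Proof.
move=> mphi phi0; have [kc [mkc ppkc kcE]] := first_leg_kernel.
have [q qE] := intrinsic_restriction mY.
rewrite (@integral_mixture _ _ (g_sigma_algebraType NN) WP R (q x) kc (pp x)).
- rewrite (integral_intrinsic mY (qE x)).
  + by apply: eq_integral => v _; exact: kcE.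
  + apply: (@measurable_fun_integral_kernel _ _ (g_sigma_algebraType NN) WP) => //.
  + by move=> v; exact: integral_ge0.
- exact: mkc.
- move=> A pA; apply: (etrans (ppkc x A pA)).
  apply/esym/(integral_intrinsic mY (qE x)) => //.
  exact: mkc.
- exact: mphi.
- exact: phi0.
Qed.

Lemma first_leg_measurable (phi : W -> \bar R) :
  measurable_fun setT (phi : WP -> \bar R) -> (forall w, 0 <= phi w) ->
  measurable_fun setT
    ((fun v => \int[K v]_y \int[pp y]_w phi (cons_leg v w)) :
      g_sigma_algebraType NN -> \bar R).
Proof.
move=> mphi phi0; have [kc [mkc ppkc kcE]] := first_leg_kernel.
rewrite (_ : (fun v => _) = fun v => \int[kc v]_w phi w).
  by apply: (@measurable_fun_integral_kernel _ _ (g_sigma_algebraType NN) WP).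
by apply/funext => v; rewrite kcE.
Qed.

End first_leg.

(** * The Markov property leg by leg *)

Section revived_markov.
Context (R : realType) (E : ptopologicalType) (Y : process R E).
Hypothesis mY : markov_process Y.
Context (K : transfer_kernel E Y).
Context (P : {n : nat & E} ->
  probability (@concat_sample R (fun=> E) (fun=> Y)) R).
Hypothesis hP : @concat_law R (fun=> E) (fun=> Y) (fun=> K) P.
Notation W := (nat -> sample Y).
Notation UE := (univType R E).
Notation BE := (borelType E).
Notation nonneg := [set t : R | (0 <= t)%R].
Notation upto s := [set t : R | (0 <= t <= s)%R].
Notation pf := (path_field (path Y) nonneg).
Notation NN := (intrinsic_field Y).
Notation prodf := <<s leg_cylinders Y>>.
Notation WP := (g_sigma_algebraType (leg_cylinders Y)).
Notation Z := (@revived_path R E Y).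
Notation theta := (@revived_shift R E Y).
Notation zeta := (lifetime Y).
Context (pp : E -> probability WP R).
Hypothesis ppE : forall x A, prodf A -> pp x A = P (existT _ 0%N x) A.

(** Events known just after [t], before completion. The Markov property is
    proved for this larger field, because the right continuity of the
    completed filtration will be deduced from it. *)
Definition right_past (t : R) : set (set W) :=
  [set A | forall s, (t < s)%R -> path_field Z (upto s) A].

Lemma right_past_prodf t A : right_past t A -> prodf A.
Proof.
move=> /(_ (t + 1)%R); rewrite ltrDl => /(_ ltr01); apply: revived_field_prodf => //.
by move=> s /= /andP[].
Qed.

Lemma revived_path_single u v : (0 <= u)%R ->
  Z u (cons_leg v (fun=> dead Y)) = path Y u v.
Proof.
move=> u0; have [uz|zu] := ltP u%:E (zeta v).
  by rewrite revived_path_before.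
rewrite revived_path_after//= revived_path_dead//; last first.
  by rewrite subr_ge0 -lee_fin fineK// ge0_fin_numE ?lifetime_ge0//;
    exact: le_lt_trans zu (ltry _).
by apply/esym/(path_noneP mY).
Qed.

Lemma prodf_shift t G : (0 <= t)%R -> path_field Z nonneg G ->
  prodf (theta t @^-1` G).
Proof.
move=> t0; apply: path_field_preimage => [|s B s0 mB]; first exact: sigma_algebra_generated.
rewrite (_ : _ @^-1` _ = Z (s + t) @^-1` (Some @` B)).
  by apply: measurable_revived_path => //; rewrite addr_ge0.
by apply/seteqP; split => w /=; rewrite revived_path_shift.
Qed.

Lemma path_field_cons_dead G w : path_field Z nonneg G ->
  G (cons_leg (dead Y) w) <-> G w.
Proof.
by move=> zG; apply: (path_field_determined zG) => t t0; rewrite revived_path_cons_dead.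
Qed.

Lemma first_leg_rect x (C : set (sample Y)) G : pf C -> prodf G ->
  pp x [set w | C (w 0%N) /\ G (tail_legs w)] =
  \int[law Y x]_v ((\1_C v)%:E * \int[K v]_y pp y G).
Proof.
move=> pC pG.
pose S : set W := [set w | C (w 0%N) /\ G (tail_legs w)].
have mS : prodf S.
  rewrite (_ : S = (fun w : W => w 0%N) @^-1` C `&` tail_legs @^-1` G)//.
  apply: (sigma_algebra_I (@sigma_algebra_generated W _)); first exact: prodf_coord.
  move: G pG {S}; apply: sigma_algebra_preimage => [|_ [n [A [pA ->]]]].
    exact: sigma_algebra_generated.
  by rewrite (_ : _ @^-1` _ = (fun w : W => w n.+1) @^-1` A)//; exact: prodf_coord.
rewrite -/S -(setIT S) -integral_indic//.
rewrite (first_leg_integral mY hP ppE); last 2 first.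
- by apply/measurable_EFinP; exact: (@measurable_indic _ WP).
- by move=> w; rewrite lee_fin.
apply: eq_integral => v _.
transitivity (\int[K v]_y ((\1_C v)%:E * pp y G)).
  apply: eq_integral => y _; rewrite indicE; have [Cv|Cv] := pselect (C v).
    rewrite mem_set// mul1e -(setIT G) -integral_indic//.
    apply: eq_integral => w _; rewrite !indicE; congr (nat_of_bool _)%:R%:E.
    by apply/idP/idP => /set_mem h; apply/mem_set; [case: h|split].
  rewrite memNset// mul0e integral0_eq// => w _.
  by rewrite indicE memNset// => -[].
rewrite ge0_integralZl//; exact: (measurable_revived_law mY hP ppE).
Qed.

Section first_leg_markov.
Variables (x : E) (t : R) (A : set (sample Y)).
Hypotheses (t0 : (0 <= t)%R) (pA : pf A) (tA : filt Y t A).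

Let shift_leg (w : W) : option W :=
  omap (fun=> cons_leg (shift Y t (w 0%N)) (tail_legs w)) (path Y t (w 0%N)).

Let shift_legE B : shift_leg @^-1` (Some @` leg_rect B) =
  [set w | (shift_opt Y t @^-1` (Some @` B 0%N)) (w 0%N) /\
           leg_rect (fun i => B i.+1) (tail_legs w)].
Proof.
apply/seteqP; split => w; rewrite /shift_leg /shift_opt /=; case: (path Y t _) => [y|] /=.
- move=> [w' Bw [wE]]; rewrite wE in Bw; split; last by move=> i; exact: (Bw i.+1).
  by exists (shift Y t (w 0%N)) => //; exact: (Bw 0%N).
- by move=> [].
- move=> [[s Bs [sE]] Bw]; rewrite sE in Bs.
  exists (cons_leg (shift Y t (w 0%N)) (tail_legs w)) => //.
  by move=> [|i] //=; exact: Bw.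
- by move=> [[]].
Qed.

Let measurable_shift_leg :
  prodf `<=` [set B | prodf (shift_leg @^-1` (Some @` B))].
Proof.
have al : prodf (shift_leg @^-1` (Some @` setT)).
  rewrite (_ : _ @^-1` _ = shift_leg @^-1` (Some @` leg_rect (fun=> setT))); last first.
    by congr (_ @^-1` (_ @` _)); apply/seteqP; split.
  rewrite shift_legE (_ : [set w | _] =
    (fun w : W => w 0%N) @^-1` (shift_opt Y t @^-1` (Some @` setT))).
    have pT := shift_opt_pf mY t0 (sigma_algebra_T (path_field_sigma (path Y) nonneg)).
    exact: (prodf_coord 0%N pT).
  by apply/seteqP; split => w /=; [case|].
apply: smallest_sub.
- split => /=.
  + rewrite (_ : _ @^-1` _ = set0); last by apply/seteqP; split => w // [].
    exact: sigma_algebra0.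
  + move=> B mB; rewrite (_ : _ @^-1` _ =
      shift_leg @^-1` (Some @` setT) `\` shift_leg @^-1` (Some @` B)).
      exact: (sigma_algebra_D (@sigma_algebra_generated W _)).
    apply/seteqP; split => w /=.
      move=> [y [_ By] <-]; split; first by exists y.
      by move=> [y' By' [yy]]; apply: By; rewrite -yy.
    move=> [[y _ <-] h]; exists y => //; split => // By; apply: h; by exists y.
  + move=> B mB; rewrite preimage_some_bigcup.
    exact: (sigma_algebra_bigcup (G := leg_cylinders Y)).
- move=> _ [n [B [pB ->]]] /=.
  pose B' i := if i == n then B else setT.
  have pB' i : pf (B' i).
    rewrite /B'; case: eqP => // _.
    exact: (sigma_algebra_T (path_field_sigma (path Y) nonneg)).
  rewrite (_ : _ @^-1` B = leg_rect B').
    rewrite shift_legE (_ : [set w | _] =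
      (fun w : W => w 0%N) @^-1` (shift_opt Y t @^-1` (Some @` B' 0%N)) `&`
      \bigcap_i ((fun w : W => w i.+1) @^-1` B' i.+1)).
      apply: (sigma_algebra_I (@sigma_algebra_generated W _)).
        exact: (prodf_coord 0%N (shift_opt_pf mY t0 (pB' 0%N))).
      apply: sigma_algebra_bigcap => [|i]; first exact: sigma_algebra_generated.
      exact: prodf_coord.
    apply/seteqP; split => w /= [h1 h2]; split => //.
      by move=> i _; exact: h2.
    by move=> i; exact: h2.
  apply/seteqP; split => w /=; first by move=> Bw i; rewrite /B'; case: eqP => // ->.
  by move=> /(_ n); rewrite /B' eqxx.
Qed.

(** Before the end of the first leg the shift acts on that leg only. The legs
    after it keep their conditional law, because the transfer kernel is a
    left germ variable and is not changed by the shift. *)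
Lemma first_leg_markov G : prodf G ->
  pp x ([set w | A (w 0%N)] `&` shift_leg @^-1` (Some @` G)) =
  \int[law Y x]_(v in A) ext (fun y => pp y G) (path Y t v).
Proof.
move=> pG.
have mA : measurable A by exact: (pf_measurable mY).
have mA' : measurable ([set w | A (w 0%N)] : set WP) by exact: prodf_coord.
have mZ (B : set UE) : measurable B ->
  measurable (path Y t @^-1` (Some @` B)) by exact: path_measurable.
have mSh (B : set WP) : measurable B ->
  measurable (shift_leg @^-1` (Some @` B) : set WP) by exact: measurable_shift_leg.
have [m1 [m1E _]] := hitting_law_measure (pp x) mA' mSh.
have [la [laE laI]] := hitting_law_measure (law Y x) mA mZ.
have mpp (B : set WP) : measurable B ->
  measurable_fun setT ((pp : UE -> {measure set WP -> \bar R}) ^~ B).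
  exact: (measurable_revived_law mY hP ppE).
have [m2 m2E] := mixture_measure la mpp.
have m2E' B : prodf B -> m2 B = \int[law Y x]_(v in A) ext (fun y => pp y B) (path Y t v).
  by move=> pB; rewrite m2E laI//; exact: (measurable_revived_law mY hP ppE).
rewrite -m1E -m2E'//.
apply: (@pi_measure_eq _ WP R (leg_rects Y)) => //.
- exact: leg_rects_generate.
- exact: leg_rectsI.
- rewrite m1E; apply: le_lt_trans (ltry 1); apply: probability_le1.
  by apply: measurableI => //; apply: mSh; exact: measurableT.
- rewrite m1E m2E'; last exact: (sigma_algebra_T (@sigma_algebra_generated W _)).
  rewrite (_ : (fun y => pp y setT) = cst 1); last first.
    by apply/funext => y; exact: probability_setT.
  rewrite integral_ext1_path//.
  transitivity (pp x [set w | (A `&` path Y t @^-1` (Some @` setT)) (w 0%N) /\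
      setT (tail_legs w)]).
    congr (pp x _); apply/seteqP; split => w /=; rewrite /shift_leg.
      move=> [Aw [w' _]]; case: (path Y t _) => [y|//] _.
      by split => //; split => //; exists y.
    move=> [[Aw [y _ <-]] _]; split => //; eexists; last by [].
    by [].
  rewrite first_leg_rect//; last 2 first.
  + apply: (sigma_algebra_I (path_field_sigma (path Y) nonneg)) => //.
    exact: path_field_alive.
  + exact: (sigma_algebra_T (@sigma_algebra_generated W _)).
  rewrite -(setIT (A `&` _)) -integral_indic//; last by apply: measurableI => //; exact: mZ.
  rewrite setIT; apply: eq_integral => v _; rewrite -[RHS]mule1; congr (_ * _).
  transitivity (\int[K v]_y (cst 1 y)).
    by apply: eq_integral => y _; exact: probability_setT.
  by rewrite integral_cst// mul1e; exact: prob_kernel.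
move=> _ [B [N [pB BN ->]]].
rewrite m1E m2E'; last exact: leg_rect_prodf.
pose u y := pp y (leg_rect (fun i => B i.+1)).
have mrB : prodf (leg_rect (fun i => B i.+1)) by exact: leg_rect_prodf.
have mu : measurable_fun setT (u : UE -> \bar R).
  exact: (measurable_revived_law mY hP ppE).
have u0 y : 0 <= u y by exact: measure_ge0.
pose k (v : sample Y) := \int[K v]_y u y.
have k01 v : 0 <= k v <= 1.
  apply/andP; split; first exact: integral_ge0.
  have -> : 1 = \int[K v]_y (cst 1 y) :> \bar R.
    by rewrite integral_cst// mul1e; exact/esym/prob_kernel.
  by apply: ge0_le_integral => // y _; exact: probability_le1.
have mk := measurable_kernel_integral K mu u0.
have [N' [mN' N'0 N'P]] := left_germ_shift mY mk k01 t0.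
pose psi (v : sample Y) := (\1_(B 0%N) v)%:E * k v.
have psi0 v : 0 <= psi v by rewrite mule_ge0 ?lee_fin//; case/andP: (k01 v).
have mpsi : measurable_fun setT (psi : g_sigma_algebraType NN -> \bar R).
  by rewrite /psi /k; apply: (measurable_first_leg mY _ (pB 0%N) mu u0).
have mpsi' : measurable_fun setT psi.
  move=> _ S mS; rewrite setTI; apply: (intrinsic_measurable mY).
  by rewrite intrinsic_sigma_measurable; have := mpsi measurableT S mS; rewrite setTI.
have mk' : measurable_fun setT k.
  move=> _ S mS; rewrite setTI; apply: (intrinsic_measurable mY).
  rewrite intrinsic_sigma_measurable.
  by have := left_germ_intrinsic mY mk measurableT mS; rewrite setTI.
have mTh (S : set (g_sigma_algebraType NN)) : measurable S ->
    measurable (shift_opt Y t @^-1` (Some @` S)).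
  rewrite -intrinsic_sigma_measurable => hS; apply: (intrinsic_measurable mY).
  exact: shift_opt_intrinsic.
pose C := A `&` shift_opt Y t @^-1` (Some @` B 0%N).
have pC : pf C.
  apply: (sigma_algebra_I (path_field_sigma (path Y) nonneg)) => //.
  exact: (shift_opt_pf mY t0).
transitivity (\int[law Y x]_v ((\1_C v)%:E * k v)).
  rewrite -first_leg_rect//; congr (pp x _).
  by rewrite shift_legE; apply/seteqP; split => w => [[h1 [h2 h3]]|[[h1 h2] h3]].
transitivity (\int[law Y x]_(v in A) ext psi (shift_opt Y t v)).
  rewrite [RHS]integral_mkcond; apply: ge0_ae_eq_integral => //.
  - apply: emeasurable_funM => //; apply/measurable_EFinP; apply: measurable_indic.
    exact: (pf_measurable mY).
  - apply/(measurable_restrictT _ mA); apply: measurable_funTS.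
    exact: (measurable_ext mTh).
  - by move=> v _; rewrite mule_ge0 ?lee_fin//; case/andP: (k01 v).
  - by move=> v _; rewrite erestrict_ge0// => w _; exact: ext_ge0.
  - exists N'; split; [exact: mN'|exact: N'0|].
    move=> v /= /not_implyP[_ h]; apply: N'P => /= h'; apply: h.
    rewrite patchE /C indicE in_setI.
    case: ifPn => vA; last by rewrite mul0e.
    case pv : (path Y t v) => [y|].
      have sv : shift_opt Y t v = Some (shift Y t v) by rewrite /shift_opt pv.
      rewrite sv /= /psi /k h'; last first.
        by apply/(lifetime_gtP mY v t0); rewrite pv; exists y.
      rewrite indicE; congr ((nat_of_bool _)%:R%:E * _).
      apply/idP/idP => /set_mem h1; apply/mem_set.
        by case: h1 => z Bz; rewrite sv => -[<-].
      by exists (shift Y t v).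
    have sv : shift_opt Y t v = None by rewrite /shift_opt pv.
    by rewrite sv /= memNset ?mul0e// => -[z _]; rewrite sv.
rewrite (markov_intrinsic_fun mY)//; apply: eq_integral => v _.
case: (path Y t v) => [y|//] /=.
rewrite /psi -first_leg_rect//; congr (pp y _); apply/seteqP; split => w /=.
  by move=> [h1 h2] [|i] //; exact: h2.
by move=> h; split => [|i]; exact: h.
Qed.

End first_leg_markov.
Lemma path_field_filt s : (0 <= s)%R -> path_field (path Y) (upto s) `<=` filt Y s.
Proof.
move=> s0; apply: path_field_sub => [|u B /andP[u0 us] mB].
  exact: (filt_sigma (usual mY)).
apply: (filt_mono (usual mY) u0 us); apply: (path_adapted mY u0).
exact: borel_univ.
Qed.

(** On the first leg an event of the right past belongs to [filt Y s] for
    every [s] after [t], hence to [filt Y t] by the right continuity of this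
    filtration. *)
Lemma first_leg_event t A : (0 <= t)%R -> right_past t A ->
  let A0 := [set v | A (cons_leg v (fun=> dead Y))] in
  [/\ pf A0, filt Y t A0 & forall w, t%:E < zeta (w 0%N) -> (A w <-> A0 (w 0%N))].
Proof.
move=> t0 rA A0.
have hA s : (t < s)%R -> path_field (path Y) (upto s) A0.
  move=> ts; apply: path_field_preimage (rA s ts) => [|u B us mB].
    exact: path_field_sigma.
  rewrite (_ : _ @^-1` _ = path Y u @^-1` (Some @` B)); first exact: path_field_gen.
  by apply/seteqP; split => v /=; rewrite revived_path_single//; case/andP: us.
split.
- have /hA : (t < t + 1)%R by rewrite ltrDl.
  by apply: path_fieldS => u /= /andP[].
- apply: (filt_right (usual mY) t0) => s /= ts.
  by apply: path_field_filt; [exact: le_trans (ltW ts)|exact: hA].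
- move=> w tw.
  have [s ts sw] : exists2 s : R, (t < s)%R & s%:E < zeta (w 0%N).
    case: (zeta (w 0%N)) tw => [r| |] //.
      rewrite lte_fin => tr; exists ((t + r) / 2)%R; first by rewrite midf_lt.
      by rewrite lte_fin midf_lt.
    by move=> _; exists (t + 1)%R; [rewrite ltrDl|exact: ltry].
  apply: (path_field_determined (rA s ts)) => u /andP[u0 us].
  rewrite revived_path_single// revived_path_before//.
  by apply: le_lt_trans sw; rewrite lee_fin.
Qed.

(** Once the first leg is over it is a parameter, and the remaining legs have
    spent the remaining time. *)
Lemma next_leg_event t v A : right_past t A -> zeta v <= t%:E ->
  right_past (t - fine (zeta v)) (cons_leg v @^-1` A).
Proof.
move=> rA vt s; rewrite ltrBlDr => /rA.
have vf : zeta v \is a fin_num.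
  by rewrite ge0_fin_numE ?lifetime_ge0//; exact: le_lt_trans vt (ltry _).
apply: path_field_preimage => [|u B /andP[u0 us] mB]; first exact: path_field_sigma.
have [uv|vu] := ltP u%:E (zeta v).
  have [By|By] := pselect ((Some @` B) (path Y u v)).
    rewrite (_ : _ @^-1` _ = setT).
      exact: (sigma_algebra_T (path_field_sigma Z (upto s))).
    by apply/seteqP; split => w //= _; rewrite revived_path_before.
  rewrite (_ : _ @^-1` _ = set0); first exact: sigma_algebra0.
  by apply/seteqP; split => w //=; rewrite revived_path_before.
rewrite (_ : _ @^-1` _ = Z (u - fine (zeta v)) @^-1` (Some @` B)).
  apply: path_field_gen => //=; rewrite subr_ge0 lerBlDr us andbT.
  by rewrite -lee_fin fineK.
by apply/seteqP; split => w; rewrite /preimage /= (@revived_path_after _ _ Y u (cons_leg v w)).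
Qed.

Lemma measurable_ext_revived t (u : E -> \bar R) : (0 <= t)%R ->
  measurable_fun setT (u : BE -> \bar R) ->
  measurable_fun setT ((fun w => ext u (Z t w)) : WP -> \bar R).
Proof.
move=> t0 mu; have mZ (B : set BE) : measurable B ->
  measurable (Z t @^-1` (Some @` B) : set WP) by exact: measurable_revived_path.
exact: (measurable_ext mZ).
Qed.

Lemma integral_kernel_cst v (c : \bar R) : \int[K v]_y c = c.
Proof.
by rewrite integral_cst// prob_kernel mule1.
Qed.

(** The Markov property on the [n]-th leg, by induction on [n], the first leg
    being conditioned on. It is an inequality with a Borel majorant of the
    universally measurable function [y |-> pp y G], so that all integrands
    stay measurable for the product field. Applied to [G] and to its
    complement, the inequality turns into an equality. *)
Lemma leg_markov n x t A G (u : E -> \bar R) : (0 <= t)%R -> right_past t A ->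
  path_field Z nonneg G -> measurable_fun setT (u : BE -> \bar R) ->
  (forall y, pp y G <= u y) ->
  pp x (A `&` [set w | on_leg n t w] `&` theta t @^-1` G) <=
  \int[pp x]_(w in A `&` [set w | on_leg n t w]) ext u (Z t w).
Proof.
move=> + + zG mu Gu.
have u0 y : 0 <= u y by apply: le_trans (Gu y); exact: measure_ge0.
have pG : prodf G by apply: revived_field_prodf zG.
elim: n t A x => [|n IH] t A x t0 rA.
- pose A0 := [set v | A (cons_leg v (fun=> dead Y))].
  have [pA0 tA0 AA0] : [/\ pf A0, filt Y t A0 &
    forall w, t%:E < zeta (w 0%N) -> (A w <-> A0 (w 0%N))] := first_leg_event t0 rA.
  have mA0 : measurable A0 by exact: (pf_measurable mY).
  have -> : A `&` [set w | on_leg 0 t w] `&` theta t @^-1` G =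
      [set w | A0 (w 0%N)] `&` (fun w : W => omap (fun=> cons_leg (shift Y t (w 0%N))
        (tail_legs w)) (path Y t (w 0%N))) @^-1` (Some @` G).
    apply/seteqP; split => w.
    + move=> [[Aw /on_leg0[_ tw]]]; rewrite /preimage /= revived_shift_before// => Gw.
      split; first exact/(AA0 w tw).
      have [y _ <-] := (lifetime_gtP mY (w 0%N) t0).2 tw.
      by exists (cons_leg (shift Y t (w 0%N)) (tail_legs w)).
    + move=> [A0w [w' Gw' w'E]].
      have tw : t%:E < zeta (w 0%N).
        apply/(lifetime_gtP mY (w 0%N) t0); case: (path Y t (w 0%N)) w'E => [y _|//].
        by exists y.
      split; first by split; [exact/(AA0 w tw)|exact/on_leg0].
      rewrite /preimage /= revived_shift_before//.
      by case: (path Y t (w 0%N)) w'E => [y /= [<-]|//].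
  rewrite (first_leg_markov _ t0 pA0 tA0 pG).
  have mext : measurable_fun setT (fun v => ext u (path Y t v)).
    by apply: measurable_ext_path => //; exact: borel_univ_fun.
  rewrite [leRHS](_ : _ = \int[law Y x]_(v in A0) ext u (path Y t v)).
    apply: ge0_le_integral => //.
    + by move=> v _; apply: ext_ge0 => y; exact: measure_ge0.
    + apply: measurable_funTS; apply: measurable_ext_path => //.
      exact: (measurable_revived_law mY hP ppE).
    + exact: measurable_funTS.
    + by move=> v _; case: (path Y t v) => //= y.
  pose phi (w : W) := ((fun v => ext u (path Y t v)) \_ A0) (w 0%N).
  have phi0 w : 0 <= phi w by apply: erestrict_ge0 => v _; exact: ext_ge0.
  have mphi : measurable_fun setT (phi : WP -> \bar R).
    have mr : measurable_fun setT ((fun v => ext u (path Y t v)) \_ A0 :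
        g_sigma_algebraType pf -> \bar R).
      have mA0' : measurable (A0 : set (g_sigma_algebraType pf)).
        by rewrite -pf_sigma_measurable.
      apply/(measurable_restrictT _ mA0'); apply: measurable_funTS.
      have mZ (B : set BE) : measurable B ->
          measurable (path Y t @^-1` (Some @` B) : set (g_sigma_algebraType pf)).
        by move=> mB; rewrite -pf_sigma_measurable; exact: path_field_gen.
      exact: (measurable_ext mZ).
    move=> _ S mS; rewrite setTI.
    rewrite (_ : phi @^-1` S = (fun w : W => w 0%N) @^-1`
      (((fun v => ext u (path Y t v)) \_ A0) @^-1` S))//.
    apply: prodf_coord; rewrite pf_sigma_measurable.
    by have := mr measurableT S mS; rewrite setTI.
  transitivity (\int[pp x]_w phi w).
    rewrite integral_mkcond; apply: eq_integral => w _.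
    rewrite /phi !patchE; case: ifPn => [/set_mem[Aw /on_leg0[_ tw]]|wA].
      by rewrite mem_set; [rewrite revived_path_before|exact/(AA0 w tw)].
    case: ifPn => // /set_mem A0w; case pw : (path Y t (w 0%N)) => [y|//].
    have tw : t%:E < zeta (w 0%N).
      by apply/(lifetime_gtP mY (w 0%N) t0); rewrite pw; exists y.
    exfalso; move/negP: wA; apply; apply/mem_set; split; last exact/on_leg0.
    exact/(AA0 w tw).
  rewrite (first_leg_integral mY hP ppE _ mphi phi0) [RHS]integral_mkcond.
  apply: eq_integral => v _.
  transitivity (\int[K v]_y (phi (cons_leg v (fun=> dead Y)))).
    apply: eq_integral => y _.
    exact: (integral_cst_probability (pp y) (phi (cons_leg v (fun=> dead Y)))).
  exact: integral_kernel_cst.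
- pose S := A `&` [set w | on_leg n.+1 t w] `&` theta t @^-1` G.
  have pA : prodf A := right_past_prodf rA.
  have pL : prodf [set w | on_leg n.+1 t w] := measurable_on_leg mY n.+1 t.
  have pAL : prodf (A `&` [set w | on_leg n.+1 t w]).
    exact: (sigma_algebra_I (@sigma_algebra_generated W _)).
  have pS : prodf S.
    apply: (sigma_algebra_I (@sigma_algebra_generated W _)) => //.
    exact: prodf_shift.
  pose phi1 (w : W) : \bar R := (\1_S w)%:E.
  pose phi2 := (fun w => ext u (Z t w)) \_ (A `&` [set w | on_leg n.+1 t w]).
  have mphi1 : measurable_fun setT (phi1 : WP -> \bar R).
    by apply/measurable_EFinP; exact: (@measurable_indic _ WP).
  have mphi2 : measurable_fun setT (phi2 : WP -> \bar R).
    have mAL : measurable (A `&` [set w | on_leg n.+1 t w] : set WP) by [].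
    apply/(measurable_restrictT _ mAL); apply: measurable_funTS.
    exact: measurable_ext_revived.
  have phi10 w : 0 <= phi1 w by rewrite lee_fin.
  have phi20 w : 0 <= phi2 w by apply: erestrict_ge0 => v _; exact: ext_ge0.
  rewrite -/S -(setIT S) -integral_indic// [leRHS]integral_mkcond -/phi2.
  rewrite (first_leg_integral mY hP ppE _ mphi1 phi10).
  rewrite (first_leg_integral mY hP ppE _ mphi2 phi20).
  have le_next v y : \int[pp y]_w phi1 (cons_leg v w) <= \int[pp y]_w phi2 (cons_leg v w).
    have [vt|tv] := leP (zeta v) t%:E; last first.
      rewrite integral0_eq; first exact: integral_ge0.
      move=> w _; rewrite /phi1 indicE memNset// => -[[_ /on_legS[/=]]].
      by rewrite leNgt tv.
    have vf : zeta v \is a fin_num.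
      by rewrite ge0_fin_numE ?lifetime_ge0//; exact: le_lt_trans vt (ltry _).
    have r0 : (0 <= t - fine (zeta v))%R by rewrite subr_ge0 -lee_fin fineK.
    pose A' := cons_leg v @^-1` A `&` [set w | on_leg n (t - fine (zeta v)) w].
    pose S' := A' `&` theta (t - fine (zeta v)) @^-1` G.
    have h : pp y S' <= \int[pp y]_(w in A') ext u (Z (t - fine (zeta v)) w) :=
      IH _ _ y r0 (next_leg_event rA vt).
    have pS' : prodf S'.
      apply: (sigma_algebra_I (@sigma_algebra_generated W _)); last exact: prodf_shift.
      apply: (sigma_algebra_I (@sigma_algebra_generated W _)); first exact: prodf_cons_leg.
      exact: measurable_on_leg.
    have eL w : on_leg n.+1 t (cons_leg v w) <-> on_leg n (t - fine (zeta v)) w.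
      by split => [/on_legS[]//|h']; apply/on_legS.
    rewrite (_ : \int[pp y]_w phi1 _ = pp y S').
      apply: (le_trans h); rewrite integral_mkcond le_eqVlt; apply/orP; left; apply/eqP.
      apply: eq_integral => w _; rewrite /phi2 !patchE.
      rewrite (@revived_path_after _ _ Y t (cons_leg v w))//=.
      congr (if _ then _ else _); apply/idP/idP => /set_mem[h1 h2]; apply/mem_set;
        split => //; first [exact: (eL w).1|exact: (eL w).2].
    rewrite -(setIT S') -integral_indic//; apply: eq_integral => w _.
    rewrite /phi1 !indicE; congr (nat_of_bool _)%:R%:E.
    apply/idP/idP => /set_mem[[h1 h2] h3]; apply/mem_set; (split; first by split => //;
      apply/eL).
      move: h3; rewrite /preimage /= (@revived_shift_after _ _ Y t (cons_leg v w))//=.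
      by rewrite path_field_cons_dead.
    rewrite /preimage /= (@revived_shift_after _ _ Y t (cons_leg v w))//=.
    by rewrite path_field_cons_dead.
  have mv phi : measurable_fun setT (phi : WP -> \bar R) -> (forall w, 0 <= phi w) ->
      measurable_fun setT ((fun v : sample Y => \int[K v]_y \int[pp y]_w phi (cons_leg v w))).
    move=> mphi phi0 _ B mB; rewrite setTI; apply: (intrinsic_measurable mY).
    rewrite intrinsic_sigma_measurable.
    by have := first_leg_measurable mY hP ppE mphi phi0 measurableT mB; rewrite setTI.
  have my v phi : measurable_fun setT (phi : WP -> \bar R) -> (forall w, 0 <= phi w) ->
      measurable_fun setT ((fun y => \int[pp y]_w phi (cons_leg v w)) : UE -> \bar R).
    move=> mphi phi0; apply: (measurable_integral_revived mY hP ppE) => //.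
    exact: measurableT_comp mphi (@measurable_cons_leg R E Y v).
  apply: ge0_le_integral => //.
  + by move=> v _; apply: integral_ge0 => y _; exact: integral_ge0.
  + exact: mv.
  + exact: mv.
  + move=> v _; apply: ge0_le_integral => //.
    * by move=> y _; exact: integral_ge0.
    * exact: my.
    * exact: my.
Qed.

End revived_markov.

Arguments right_past {R E} Y t _.

(** * The right past *)

Lemma addeI_fin (R : realDomainType) (z x y : \bar R) :
  z \is a fin_num -> z + x = z + y -> x = y.
Proof.
move=> zf e; apply/eqP; rewrite eq_le.
by rewrite -(leeD2lE x y zf) e lexx -(leeD2lE y x zf) e lexx.
Qed.

Section revived_markov_mixture.
Context (R : realType) (E : ptopologicalType) (Y : process R E).
Hypothesis mY : markov_process Y.
Context (K : transfer_kernel E Y).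
Context (P : {n : nat & E} ->
  probability (@concat_sample R (fun=> E) (fun=> Y)) R).
Hypothesis hP : @concat_law R (fun=> E) (fun=> Y) (fun=> K) P.
Notation W := (nat -> sample Y).
Notation UE := (univType R E).
Notation BE := (borelType E).
Notation nonneg := [set t : R | (0 <= t)%R].
Notation upto s := [set t : R | (0 <= t <= s)%R].
Notation prodf := <<s leg_cylinders Y>>.
Notation WP := (g_sigma_algebraType (leg_cylinders Y)).
Notation Z := (@revived_path R E Y).
Notation theta := (@revived_shift R E Y).
Notation alive t := (Z t @^-1` (Some @` setT)).
Context (pp : E -> probability WP R).
Hypothesis ppE : forall x A, prodf A -> pp x A = P (existT _ 0%N x) A.

Let prodfI A B : prodf A -> prodf B -> prodf (A `&` B).
Proof. exact: (sigma_algebra_I (@sigma_algebra_generated W _)). Qed.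

Lemma alive_legs t : (0 <= t)%R -> alive t = \bigcup_n [set w | on_leg n t w].
Proof.
move=> t0; apply/seteqP; split => w.
- move=> [y _ yw]; have [[n nt]|h] := pselect (exists n, on_leg n t w); first by exists n.
  by move: yw; rewrite revived_path_none.
- by move=> [n _ nt]; have [y yt] := revived_path_some mY nt; exists y.
Qed.

(** Sum over the number of the leg that is running at time [t]. *)
Lemma revived_markov_point x t A G (u : E -> \bar R) : (0 <= t)%R ->
  right_past Y t A -> path_field Z nonneg G ->
  measurable_fun setT (u : BE -> \bar R) -> (forall y, pp y G <= u y) ->
  pp x (A `&` alive t `&` theta t @^-1` G) <=
  \int[pp x]_(w in A) ext u (Z t w).
Proof.
move=> t0 rA zG mu Gu.
have u0 y : 0 <= u y by apply: le_trans (Gu y); exact: measure_ge0.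
have pA := right_past_prodf mY rA.
have pG := prodf_shift mY t0 zG.
pose F n := A `&` [set w | on_leg n t w].
have pF n : prodf (F n) by apply: prodfI => //; exact: measurable_on_leg.
have tF : trivIset setT F.
  by move=> i j _ _ [w [[_ wi] [_ wj]]]; exact: on_leg_unique wi wj.
have AE : A `&` alive t = \bigcup_n F n by rewrite alive_legs// setI_bigcupr.
have mext := measurable_ext_revived mY t0 mu.
have -> : \int[pp x]_(w in A) ext u (Z t w) = \int[pp x]_(w in A `&` alive t) ext u (Z t w).
  rewrite integral_mkcondr; apply: eq_integral => w _; rewrite patchE.
  case: ifPn => // /negP h; case zw : (Z t w) => [y|//].
  by exfalso; apply: h; apply/mem_set; exists y.
rewrite AE setI_bigcupl.
rewrite measure_bigcup//; last 2 first.
- by move=> n _; exact: prodfI.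
- by move=> i j _ _ [w [[wi _] [wj _]]]; apply: tF => //; exists w.
rewrite ge0_integral_bigcup//; last 2 first.
- exact: measurable_funTS.
- by move=> w _; exact: ext_ge0.
rewrite (eq_eseriesl (Q := xpredT)); last by move=> i; rewrite in_setT.
apply: lee_nneseries => [i _ _|i _]; first exact: measure_ge0.
exact: (leg_markov mY hP ppE).
Qed.

Variables (nu : probability UE R) (m : probability WP R).
Hypothesis mE : forall G, prodf G -> m G = \int[nu]_y pp y G.

Lemma integral_revived_mixture (phi : W -> \bar R) :
  measurable_fun setT (phi : WP -> \bar R) -> (forall w, 0 <= phi w) ->
  \int[m]_w phi w = \int[nu]_y \int[pp y]_w phi w.
Proof.
move=> mphi phi0.
have mpp (B : set WP) : measurable B ->
  measurable_fun setT ((pp : UE -> {measure set WP -> \bar R}) ^~ B).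
  exact: (measurable_revived_law mY hP ppE).
exact: (@integral_mixture _ _ UE WP R nu pp m mpp mE phi mphi phi0).
Qed.

Lemma revived_markov_le t A G (u : E -> \bar R) : (0 <= t)%R ->
  right_past Y t A -> path_field Z nonneg G ->
  measurable_fun setT (u : BE -> \bar R) -> (forall y, pp y G <= u y) ->
  m (A `&` alive t `&` theta t @^-1` G) <= \int[m]_(w in A) ext u (Z t w).
Proof.
move=> t0 rA zG mu Gu.
have u0 y : 0 <= u y by apply: le_trans (Gu y); exact: measure_ge0.
have pA : measurable (A : set WP) := right_past_prodf mY rA.
have mext := measurable_ext_revived mY t0 mu.
have mr : measurable_fun setT (((fun w => ext u (Z t w)) \_ A) : WP -> \bar R).
  by apply/(measurable_restrictT _ pA); exact: measurable_funTS.
have r0 w : 0 <= ((fun w => ext u (Z t w)) \_ A) w.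
  by apply: erestrict_ge0 => v _; exact: ext_ge0.
have pS : prodf (A `&` alive t `&` theta t @^-1` G).
  apply: prodfI; last exact: prodf_shift.
  by apply: prodfI => //; apply: measurable_revived_path => //; exact: measurableT.
rewrite mE//.
have -> := etrans (@integral_mkcond _ WP R m A (fun w => ext u (Z t w)))
  (integral_revived_mixture mr r0).
apply: ge0_le_integral => //.
- exact: (measurable_revived_law mY hP ppE).
- exact: (measurable_integral_revived mY hP ppE).
- by move=> y _; rewrite -integral_mkcond; exact: revived_markov_point.
Qed.

(** The two inequalities for [G] and its complement add up to an equality.
    The version [u] of [y |-> pp y G] is Borel. *)
Lemma revived_markov_version t G : (0 <= t)%R -> path_field Z nonneg G ->
  exists (u : E -> \bar R) (N : set BE),
  [/\ measurable_fun setT (u : BE -> \bar R), forall y, 0 <= u y <= 1,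
      measurable N /\ m (Z t @^-1` (Some @` N)) = 0,
      forall y, ~ N y -> u y = pp y G &
      forall A, right_past Y t A ->
        m (A `&` alive t `&` theta t @^-1` G) = \int[m]_(w in A) ext u (Z t w)].
Proof.
move=> t0 zG.
have zGC : path_field Z nonneg (~` G).
  exact: (sigma_algebra_C (path_field_sigma Z nonneg)).
have pG : prodf G by apply: revived_field_prodf zG.
have pGC : prodf (~` G) by apply: revived_field_prodf zGC.
have mZ (B : set BE) : measurable B ->
  measurable (Z t @^-1` (Some @` B) : set WP) by exact: measurable_revived_path.
have [la [laE _]] := hitting_law_measure m measurableT mZ.
have lafin : la setT < +oo.
  by rewrite laE setTI; apply: le_lt_trans (ltry 1); apply: probability_le1; apply: mZ;
    exact: measurableT.
have h (H : set W) : prodf H -> exists (u : E -> \bar R) (N : set BE),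
    [/\ measurable_fun setT (u : BE -> \bar R), measurable N, la N = 0,
        forall y, pp y H <= u y <= 1 & forall y, ~ N y -> u y = pp y H].
  move=> pH; apply: (univ_borel_majorant (u := fun y => pp y H) lafin).
    exact: (measurable_revived_law mY hP ppE).
  by move=> y; rewrite measure_ge0 probability_le1.
have [u [N [mu mN N0 Gu uN]]] := h G pG.
have [u' [N' [mu' mN' N'0 Gu' uN']]] := h _ pGC.
exists u, (N `|` N'); split => //.
- move=> y; have /andP[h1 ->] := Gu y; rewrite andbT.
  by apply: le_trans h1; exact: measure_ge0.
- split; first exact: measurableU.
  have := measure_setU0 mN mN' N0 N'0; rewrite laE setTI; exact.
- by move=> y NN'; apply: uN => Ny; apply: NN'; left.
move=> A rA; have pA : measurable (A : set WP) := right_past_prodf mY rA.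
have u0 y : 0 <= u y by have /andP[+ _] := Gu y; apply: le_trans; exact: measure_ge0.
have u'0 y : 0 <= u' y by have /andP[+ _] := Gu' y; apply: le_trans; exact: measure_ge0.
have mal : measurable (A `&` alive t : set WP).
  by apply: measurableI => //; apply: mZ; exact: measurableT.
have mth : measurable (theta t @^-1` G : set WP) := prodf_shift mY t0 zG.
have le1 := revived_markov_le t0 rA zG mu (fun y => (andP (Gu y)).1).
have le2 := revived_markov_le t0 rA zGC mu' (fun y => (andP (Gu' y)).1).
have mext := measurable_ext_revived mY t0 mu.
have mext' := measurable_ext_revived mY t0 mu'.
have sumE : \int[m]_(w in A) ext u (Z t w) + \int[m]_(w in A) ext u' (Z t w) =
    m (A `&` alive t).
  rewrite -ge0_integralD//; first last.
  - exact: measurable_funTS.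
  - by move=> w _; exact: ext_ge0.
  - exact: measurable_funTS.
  - by move=> w _; exact: ext_ge0.
  rewrite -(integral_ext1 _ pA mZ).
  apply: ge0_ae_eq_integral => //.
  - by apply: emeasurable_funD; exact: measurable_funTS.
  - apply: measurable_funTS; apply: (measurable_ext mZ) => //.
  - by move=> w _; rewrite adde_ge0//; exact: ext_ge0.
  - by move=> w _; exact: ext_ge0.
  - exists (Z t @^-1` (Some @` (N `|` N'))); split.
    + by apply: mZ; exact: measurableU.
    + by have := measure_setU0 mN mN' N0 N'0; rewrite laE setTI.
    + move=> w /= /not_implyP[_]; case: (Z t w) => [y|] /=; last by rewrite adde0.
      move=> yE; exists y => //; apply: contrapT => NN'; apply: yE.
      rewrite uN => [|?]; last by apply: NN'; left.
      rewrite uN' => [|?]; last by apply: NN'; right.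
      by rewrite [X in _ + X]probability_setC// addeC subeK// fin_num_measure.
have sumG : m (A `&` alive t `&` theta t @^-1` G) +
    m (A `&` alive t `&` theta t @^-1` (~` G)) = m (A `&` alive t).
  rewrite -measureU.
  - by rewrite -setIUr -preimage_setU setUv preimage_setT setIT.
  - exact: measurableI.
  - by apply: measurableI => //; rewrite -preimage_setC; exact: measurableC.
  - by apply/seteqP; split => w // [[_ ?] [_ ?]].
have fin1 : m (A `&` alive t `&` theta t @^-1` (~` G)) \is a fin_num.
  rewrite fin_num_measure//; apply: measurableI => //.
  by rewrite -preimage_setC; exact: measurableC.
apply/eqP; rewrite eq_le le1/=.
by rewrite -(leeD2rE _ _ fin1) sumG -sumE; apply: leeD2l.
Qed.

Notation zf := (path_field Z nonneg).
Notation ZF t := (g_sigma_algebraType (path_field Z (upto t))).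

Lemma path_field_upto_prodf t : path_field Z (upto t) `<=` prodf.
Proof. by apply: revived_field_prodf => // s /= /andP[]. Qed.

Lemma measurable_upto t : path_field Z (upto t) = @measurable _ (ZF t).
Proof. by apply: sigma_algebra_measurableE; exact: path_field_sigma. Qed.

Lemma measurable_fun_upto t (g : W -> \bar R) :
  measurable_fun setT (g : ZF t -> \bar R) -> measurable_fun setT (g : WP -> \bar R).
Proof.
move=> mg _ B mB; rewrite setTI; apply: (@path_field_upto_prodf t).
by rewrite measurable_upto; have := mg measurableT B mB; rewrite setTI.
Qed.

Lemma upto_right_past t A : path_field Z (upto t) A -> right_past Y t A.
Proof.
move=> tA s ts; apply: path_fieldS tA => u /= /andP[-> ut].
exact: le_trans (ltW ts).
Qed.

Lemma right_past_sigma t : sigma_algebra setT (right_past Y t).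
Proof.
split.
- by move=> s _; case: (path_field_sigma Z (upto s)).
- by move=> A hA s ts; case: (path_field_sigma Z (upto s)) => _ h _; apply: h; exact: hA.
- move=> A hA s ts; case: (path_field_sigma Z (upto s)) => _ _ h; apply: h => n.
  exact: hA.
Qed.

Definition is_past_version (t : R) (D : set W) (g : W -> \bar R) : Prop :=
  [/\ measurable_fun setT (g : ZF t -> \bar R), forall w, 0 <= g w <= 1 &
    forall A, right_past Y t A -> m (A `&` D) = \int[m]_(w in A) g w].

(** The conditional probability of [D] given the right past has a version
    that only depends on the past. *)
Definition past_version (t : R) (D : set W) : Prop :=
  exists g, is_past_version t D g.

Lemma past_version_past t C : path_field Z (upto t) C -> past_version t C.
Proof.
move=> tC; exists (fun w => (\1_C w)%:E); split.
- apply/measurable_EFinP; apply: (@measurable_indic _ (ZF t)).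
  by rewrite -measurable_upto.
- by move=> w; rewrite indicE; case: (_ \in _); rewrite /= ?lee_fin ?lexx ?ler01.
- move=> A rA; have pA : measurable (A : set WP) := right_past_prodf mY rA.
  have pC : measurable (C : set WP) := path_field_upto_prodf tC.
  by rewrite integral_indic// setIC.
Qed.

(** By the Markov property the version is a function of the state at time
    [t], restricted to [C]. *)
Lemma past_version_future t C G : (0 <= t)%R -> path_field Z (upto t) C -> zf G ->
  past_version t (C `&` (alive t `&` theta t @^-1` G)).
Proof.
move=> t0 tC zG; have [u [N [mu u01 _ _ uP]]] := revived_markov_version t0 zG.
exists ((fun w => ext u (Z t w)) \_ C).
have mC : measurable (C : set (ZF t)) by rewrite -measurable_upto.
split.
- apply/(measurable_restrictT _ mC); apply: measurable_funTS.
  have mZ (B : set BE) : measurable B -> measurable (Z t @^-1` (Some @` B) : set (ZF t)).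
    by move=> mB; rewrite -measurable_upto; apply: path_field_gen => //=; rewrite t0 lexx.
  exact: (measurable_ext mZ).
- move=> w; rewrite patchE; case: ifP => _; last by rewrite lexx lee01.
  by case: (Z t w) => [y|] /=; [exact: u01|rewrite lexx lee01].
- move=> A rA; have rAC : right_past Y t (A `&` C).
    by apply: (sigma_algebra_I (right_past_sigma t)) => //; exact: upto_right_past.
  rewrite -integral_mkcondr -uP//; congr (m _).
  by rewrite !setIA.
Qed.

Lemma past_version_setC t D g : prodf D -> is_past_version t D g ->
  is_past_version t (~` D) (fun w => 1 - g w).
Proof.
move=> pD [mg g01 gP].
have mg' := measurable_fun_upto mg.
have g0 w : 0 <= g w by case/andP: (g01 w).
have g'0 w : 0 <= 1 - g w.
  by rewrite sube_ge0; case/andP: (g01 w) => // h h';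
    rewrite ge0_fin_numE// (le_lt_trans h')// ltry.
split.
- by apply: emeasurable_funB.
- move=> w; rewrite g'0/= leeBlDr; last first.
    by rewrite ge0_fin_numE//; case/andP: (g01 w) => _ h; exact: le_lt_trans h (ltry _).
  by rewrite leeDl.
- move=> A rA; have pA : measurable (A : set WP) := right_past_prodf mY rA.
  have mD : measurable (D : set WP) by [].
  have finD : m (A `&` D) \is a fin_num by rewrite fin_num_measure//; exact: measurableI.
  apply: (addeI_fin finD); rewrite -measureU//; last 3 first.
  + exact: measurableI.
  + by apply: measurableI => //; exact: measurableC.
  + by apply/seteqP; split => w // [[_ ?] [_ ?]].
  rewrite -setIUr setUv setIT gP// -ge0_integralD//; last 2 first.
  + exact: measurable_funTS.
  + by apply: measurable_funTS; apply: emeasurable_funB.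
  transitivity (\int[m]_(w in A) (cst 1 w)); first by rewrite integral_cst// mul1e.
  apply: eq_integral => w _; rewrite addeC subeK//.
  by rewrite ge0_fin_numE//; case/andP: (g01 w) => _ h; exact: le_lt_trans h (ltry _).
Qed.

(** The sum of the versions may exceed [1], but only on a null event of the
    past, so it can be truncated. *)
Lemma past_version_bigcup t (D : nat -> set W) : (forall n, prodf (D n)) ->
  trivIset setT D -> (forall n, past_version t (D n)) ->
  past_version t (\bigcup_n D n).
Proof.
move=> pD tD /choice[g gP].
have mg n : measurable_fun setT (g n : ZF t -> \bar R) by have [] := gP n.
have mg' n := measurable_fun_upto (mg n).
have g0 n w : 0 <= g n w by have [_ /(_ w)/andP[]] := gP n.
pose S w := \sum_(n <oo) g n w.
have mS : measurable_fun setT (S : ZF t -> \bar R) by exact: ge0_emeasurable_sum.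
have mS' := measurable_fun_upto mS.
have S0 w : 0 <= S w by exact: nneseries_ge0.
have mD n : measurable (D n : set WP) := pD n.
have mUD : measurable (\bigcup_n D n : set WP) by exact: bigcup_measurable.
have SP A : right_past Y t A -> m (A `&` \bigcup_n D n) = \int[m]_(w in A) S w.
  move=> rA; have pA : measurable (A : set WP) := right_past_prodf mY rA.
  rewrite integral_nneseries//; last by move=> n; exact: measurable_funTS.
  rewrite setI_bigcupr measure_bigcup//; last 2 first.
  - by move=> n _; exact: measurableI.
  - by move=> i j _ _ [w [[_ wi] [_ wj]]]; apply: tD => //; exists w.
  rewrite (eq_eseriesl (Q := xpredT)); last by move=> i; rewrite in_setT.
  by apply: eq_eseriesr => n _; have [_ _] := gP n; apply.
pose Bad := [set w | 1 < S w].
have tBad : path_field Z (upto t) Bad.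
  rewrite measurable_upto (_ : Bad = setT `&` [set w : ZF t | 1 < S w]); last by rewrite setTI.
  exact: emeasurable_fun_o_infty.
have pBad : measurable (Bad : set WP) := path_field_upto_prodf tBad.
exists (fun w => mine 1 (S w)); split.
- exact: measurable_mine.
- by move=> w; rewrite le_min lee01 S0/= ge_min lexx.
move=> A rA; have pA : measurable (A : set WP) := right_past_prodf mY rA.
have mmin : measurable_fun setT ((fun w => mine 1 (S w)) : WP -> \bar R).
  exact: measurable_mine.
have min0 w : 0 <= mine 1 (S w) by rewrite le_min lee01 S0.
have rAB : right_past Y t (A `&` Bad).
  by apply: (sigma_algebra_I (right_past_sigma t)) => //; exact: upto_right_past.
have split_int (f : W -> \bar R) : measurable_fun setT (f : WP -> \bar R) ->
    (forall w, 0 <= f w) -> \int[m]_(w in A) f w =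
    \int[m]_(w in A `&` Bad) f w + \int[m]_(w in A `\` Bad) f w.
  move=> mf f0; rewrite -ge0_integral_setU//.
  - by rewrite setUIDK.
  - exact: measurableI.
  - exact: measurableD.
  - exact: measurable_funTS.
  - by apply/disj_setPS => w [[_ ?] [_ ?]].
rewrite SP// split_int// [RHS]split_int//; congr (_ + _); last first.
  apply: eq_integral => w /set_mem[_ /= /negP]; rewrite -leNgt => S1.
  by rewrite min_r.
have mAB : measurable (A `&` Bad : set WP) by exact: measurableI.
transitivity (m (A `&` Bad)); last first.
  transitivity (\int[m]_(w in A `&` Bad) (cst 1 w)).
    by rewrite integral_cst// mul1e.
  by apply: eq_integral => w /set_mem[_ /= S1]; rewrite min_l// ltW.
apply/eqP; rewrite eq_le; apply/andP; split.
  by rewrite -SP//; apply: measureIl.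
rewrite -[leLHS]mul1e -integral_cst//; apply: ge0_le_integral => //.
- exact: measurable_funTS.
- by move=> w [_ /ltW].
Qed.

(** The intersections of an event of the past with an event of the future
    after survival at time [t] form, together with the events of the past, a
    pi-system that generates the path field. *)
Lemma past_versionP t D : (0 <= t)%R -> zf D -> past_version t D.
Proof.
move=> t0.
pose G : set (set W) := [set S | path_field Z (upto t) S \/ exists C H,
  [/\ path_field Z (upto t) C, zf H & S = C `&` (alive t `&` theta t @^-1` H)]].
have tal : path_field Z (upto t) (alive t).
  by apply: path_field_alive => /=; rewrite t0 lexx.
have uz : path_field Z (upto t) `<=` zf by apply: path_fieldS => s /= /andP[].
have zth H : zf H -> zf (theta t @^-1` H).
  apply: path_field_preimage => [|s B s0 mB]; first exact: path_field_sigma.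
  rewrite (_ : _ @^-1` _ = Z (s + t) @^-1` (Some @` B)).
    by apply: path_field_gen => //=; rewrite addr_ge0.
  by apply/seteqP; split => w /=; rewrite revived_path_shift.
have Gz : G `<=` zf.
  move=> S [/uz//|[C [H [tC zH ->]]]].
  apply: (sigma_algebra_I (path_field_sigma Z nonneg)); first exact: uz.
  apply: (sigma_algebra_I (path_field_sigma Z nonneg)); first exact: uz.
  exact: zth.
have GI : setI_closed G.
  move=> S S' [tS|[C [H [tC zH ->]]]] [tS'|[C' [H' [tC' zH' ->]]]].
  - by left; apply: (sigma_algebra_I (path_field_sigma Z (upto t))).
  - right; exists (S `&` C'), H'; split => //; last by rewrite setIA.
    exact: (sigma_algebra_I (path_field_sigma Z (upto t))).
  - right; exists (C `&` S'), H; split => //; last by rewrite setIAC.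
    exact: (sigma_algebra_I (path_field_sigma Z (upto t))).
  - right; exists (C `&` C'), (H `&` H'); split.
    + exact: (sigma_algebra_I (path_field_sigma Z (upto t))).
    + exact: (sigma_algebra_I (path_field_sigma Z nonneg)).
    + by rewrite preimage_setI; apply/seteqP; split => w /=; tauto.
have zG : zf = <<s G>>.
  apply/seteqP; split; last first.
    by apply: smallest_sub => //; exact: path_field_sigma.
  apply: path_field_sub => [|s B s0 mB]; first exact: sigma_algebra_generated.
  apply: sub_sigma_algebra; have [st|ts] := leP s t.
    by left; apply: path_field_gen => //=; rewrite st andbT.
  right; exists setT, (Z (s - t) @^-1` (Some @` B)); split.
  - exact: (sigma_algebra_T (path_field_sigma Z (upto t))).
  - by apply: path_field_gen => //=; rewrite subr_ge0 ltW.
  - have st0 : (0 <= s - t)%R by rewrite subr_ge0 ltW.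
    rewrite setTI; apply/seteqP; split => w /=.
      move=> [y By yw]; split; last by rewrite revived_path_shift// subrK; exists y.
      have : alive t w.
        case zt : (Z t w) => [z|]; first by exists z.
        have /(revived_path_noneP mY _ t0) h := zt.
        have : Z s w = None.
          by apply/(revived_path_noneP mY _ s0) => n; apply: le_trans (h n) _;
            rewrite lee_fin ltW.
        by rewrite -yw.
      by [].
    by move=> [_]; rewrite revived_path_shift// subrK.
pose T := g_sigma_algebraType zf.
have zT : @measurable _ T = <<s G>> by rewrite -zG /measurable/= sigma_algebra_id//;
  exact: path_field_sigma.
have zp : zf `<=` prodf by exact: revived_field_prodf.
move=> zD; rewrite zG in zD.
apply: (@dynkin_induction _ T G (past_version t)) => //.
- apply: past_version_past; exact: (sigma_algebra_T (path_field_sigma Z (upto t))).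
- move=> S [tS|[C [H [tC zH ->]]]]; first exact: past_version_past.
  exact: past_version_future.
- move=> S; rewrite zT -zG => zS [g gP]; exists (fun w => 1 - g w).
  by apply: past_version_setC => //; exact: zp.
- move=> F mF tF h; apply: past_version_bigcup => // n; apply: zp.
  by have := mF n; rewrite zT -zG.
Qed.

(** The zero-one law of Blumenthal. For an event [A] of the right past, the
    version [g] of its conditional probability given the right past is the
    indicator of [A] almost everywhere, so [A] is the past event [g = 1] up
    to a null set. *)
Lemma right_past_trivial t A : (0 <= t)%R -> right_past Y t A ->
  exists A' B, [/\ path_field Z (upto t) A', prodf B, m B = 0 & agree_off B A A'].
Proof.
move=> t0 rA; have pA : measurable (A : set WP) := right_past_prodf mY rA.
have zA : zf A.
  have := rA (t + 1)%R; rewrite ltrDl => /(_ ltr01).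
  by apply: path_fieldS => s /= /andP[].
have [g [mg g01 gP]] := past_versionP t0 zA.
have mg' := measurable_fun_upto mg.
have g0 w : 0 <= g w by case/andP: (g01 w).
have [mh h01 hgP] := past_version_setC pA (And3 mg g01 gP).
have mh' := measurable_fun_upto mh.
pose A' := [set w | g w = 1].
have tA' : path_field Z (upto t) A'.
  rewrite measurable_upto (_ : A' = setT `&` g @^-1` [set 1]); last by rewrite setTI.
  by apply: mg => //; exact: measurable_set1.
pose B := (A `\` A') `|` (A' `\` A).
have mA' : measurable (A' : set WP) := path_field_upto_prodf tA'.
have rA' := upto_right_past tA'.
exists A', B; split => //.
- by apply: (@measurableU _ WP); exact: measurableD.
- apply: measure_setU0; [exact: measurableD|exact: measurableD| |].
  + have rB : right_past Y t (A `\` A').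
      by apply: (sigma_algebra_D (right_past_sigma t)).
    have mB : measurable (A `\` A' : set WP) := right_past_prodf mY rB.
    have : \int[m]_(w in A `\` A') `|1 - g w| = 0.
      rewrite (eq_integral (fun w : WP => 1 - g w)); last first.
        by move=> w _; rewrite gee0_abs//; case/andP: (h01 w).
      rewrite -hgP// (_ : _ `&` _ = set0) ?measure0//.
      by apply/seteqP; split => w // [[? _]].
    have mf : measurable_fun (A `\` A' : set WP) (fun w => 1 - g w).
      exact: measurable_funTS.
    move=> /(ae_eq_integral_abs _ mB mf)[N [mN N0 NP]].
    apply: (measure_nullS mB mN _ N0) => w [Aw A'w]; apply: NP => /= h; apply: (A'w).
    have gf : g w \is a fin_num.
      by rewrite ge0_fin_numE//; case/andP: (g01 w) => _ g1; exact: le_lt_trans g1 (ltry _).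
    rewrite /A' /= -(fineK gf).
    have := h (conj Aw A'w); rewrite -[X in 1 - X](fineK gf) -EFinB => -[/eqP].
    by rewrite subr_eq0 => /eqP <-.
  + have rB : right_past Y t (A' `\` A).
      by apply: (sigma_algebra_D (right_past_sigma t)).
    have mB : measurable (A' `\` A : set WP) := right_past_prodf mY rB.
    transitivity (\int[m]_(w in A' `\` A) (cst 1 w)).
      by rewrite integral_cst// mul1e.
    rewrite (eq_integral (g : WP -> \bar R)); last by move=> w /set_mem[/= -> _].
    rewrite -gP// (_ : _ `&` _ = set0) ?measure0//.
    by apply/seteqP; split => w // [[_ ?]].
- move=> w Bw; split => [Aw|A'w].
    by apply: contrapT => A'w; apply: Bw; left.
  by apply: contrapT => Aw; apply: Bw; right.
Qed.

End revived_markov_mixture.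

(** * The completed image field *)

Section image_of_concatenation.
Context (R : realType) (E : ptopologicalType) (Y : process R E).
Hypothesis mY : markov_process Y.
Context (K : transfer_kernel E Y).
Context (P : {n : nat & E} ->
  probability (@concat_sample R (fun=> E) (fun=> Y)) R).
Hypothesis hP : @concat_law R (fun=> E) (fun=> Y) (fun=> K) P.

Notation W := (nat -> sample Y).
Notation UE := (univType R E).
Notation BE := (borelType E).
Notation nonneg := [set t : R | (0 <= t)%R].
Notation upto s := [set t : R | (0 <= t <= s)%R].
Notation prodf := <<s leg_cylinders Y>>.
Notation WP := (g_sigma_algebraType (leg_cylinders Y)).
Notation Z := (@revived_path R E Y).
Notation zf := (path_field Z nonneg).
Notation CS := (@concat_sample R (fun=> E) (fun=> Y)).
Notation X := (@concatenation R (fun=> E) (fun=> Y) P).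
Notation pi := (fun z : {n : nat & E} => projT2 z).
Notation cm := (measurable : set (set CS)).
Notation inull := (@image_null R {n : nat & E} E X pi).
Notation IF := (@image_field R {n : nat & E} E X pi).

Context (pp : E -> probability WP R).
Hypothesis ppE : forall x A, prodf A -> pp x A = P (existT _ 0%N x) A.

Lemma image_null0 y : inull y set0.
Proof. by move=> z _; exact: measure0. Qed.

Lemma image_null_bigcup y (B : nat -> set CS) : (forall n, cm (B n)) ->
  (forall n, inull y (B n)) -> inull y (\bigcup_n B n).
Proof.
by move=> mB nB z zy; apply: measure_null_bigcup => // n; exact: nB.
Qed.

Lemma image_nullU y (A B : set CS) : cm A -> cm B -> inull y A -> inull y B ->
  inull y (A `|` B).
Proof.
by move=> mA mB nA nB z zy; apply: measure_setU0 => //; [exact: nA|exact: nB].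
Qed.

Lemma concat_sigma : sigma_algebra setT cm.
Proof.
split; first exact: measurable0.
- by move=> A mA; exact: measurableD.
- by move=> A mA; exact: bigcup_measurable.
Qed.

Lemma zf_prodf : zf `<=` prodf.
Proof. exact: revived_field_prodf. Qed.

Lemma zf_concat : zf `<=` cm.
Proof. by move=> A /zf_prodf; exact: prodf_concat. Qed.

(** A path event has the same probability from all points above [y], whatever
    the starting leg. *)
Lemma image_null_zf y (A : set CS) : zf A -> inull y A <-> pp y A = 0.
Proof.
move=> zA; split => [h|h].
  by apply: (etrans (ppE y (zf_prodf zA))); exact: h.
by move=> [n x] /= xy; subst y; exact: etrans (law_any_leg mY hP ppE n x zA) h.
Qed.

Lemma image_field_sigma : sigma_algebra setT IF.
Proof. exact: augmentation_sigma. Qed.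

Lemma zf_image : zf `<=` IF.
Proof. exact: sub_augmentation. Qed.

Lemma image_measurable (A : set (g_sigma_algebraType IF)) : measurable A <-> IF A.
Proof. by rewrite -(sigma_algebra_measurableE image_field_sigma). Qed.

Lemma ae_dirac (y : E) (Q : E -> Prop) :
  {ae (dirac (y : BE) : probability BE R), forall x, Q x} -> Q y.
Proof.
move=> [N [mN + QN]]; rewrite /= diracE => N0; apply: contrapT => nQ.
have : (y : BE) \in N by apply: mem_set; exact: QN.
by move=> yN; move: N0; rewrite yN => -[] /eqP; rewrite oner_eq0.
Qed.

Lemma image_augmentationP F A : sigma_algebra setT F ->
  augmentation R cm inull F A <->
  forall mu : probability BE R, exists2 A', F A' & agree_ae cm inull mu A A'.
Proof.
exact: augmentationP concat_sigma image_null0 image_null_bigcup _ _.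
Qed.

(** The initial distribution to use is the Dirac measure at [y]. *)
Lemma image_approx F y A : sigma_algebra setT F ->
  augmentation R cm inull F A ->
  exists A' B, [/\ F A', cm B, agree_off B A A' & inull y B].
Proof.
move=> sF hA.
have [A' FA' [B [mB AB /ae_dirac nB]]] :=
  (image_augmentationP A sF).1 hA (dirac (y : BE) : probability BE R).
by exists A', B.
Qed.

(** Events of the image field are path events up to sets that are null from
    all points above [y]; on path events the laws started from these points
    agree, hence so do their completions. *)
Lemma image_law_exists : exists P' : E -> probability (g_sigma_algebraType IF) R,
  @image_law R _ E X pi P'.
Proof.
have h y : exists q : probability (g_sigma_algebraType IF) R,
    forall A, q A = ((P (existT _ 0%N y))^*)%mu A.
  apply: completion_exists => A sA.
  have IA : IF A by move: sA; apply: smallest_sub => //; exact: image_field_sigma.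
  have [A' [B [zA' mB AB nB]]] := image_approx y (path_field_sigma _ _) IA.
  by exists A', B; split => //; [exact: zf_concat|exact: nB].
have [q qE] := choice h; exists q => -[n x] A IA /=.
apply: (etrans (qE x A)).
have [A' [B [zA' mB AB nB]]] := image_approx x (path_field_sigma _ _) IA.
have mA' := zf_concat zA'.
transitivity (P (existT _ 0%N x) A'); first by apply: outer_agree_off AB => //; exact: nB.
transitivity (P (existT _ n x) A'); last first.
  by apply/esym; apply: outer_agree_off AB => //; exact: nB.
apply: (etrans (esym (ppE x (zf_prodf zA')))).
exact: esym (law_any_leg mY hP ppE n x zA').
Qed.

(** [m] is the law started from [mu]. The extension [nu] of [mu] is needed to
    integrate laws that are only universally measurable in the starting
    point. *)
Lemma initial_mixture (mu : probability BE R) :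
  exists (nu : probability UE R) (m : probability WP R),
    (forall G, prodf G -> m G = \int[nu]_y pp y G) /\
    (forall S, zf S -> m S = 0 -> {ae mu, forall y, inull y S}).
Proof.
have [nu [nuE _]] := univ_extension mu.
have mk (G : set WP) : measurable G -> measurable_fun setT ((fun y => pp y G) : UE -> \bar R).
  by move=> mG; exact: (measurable_revived_law mY hP ppE mG).
have [m mE] := mixture_probability nu mk.
exists nu, m; split => [G _|S zS]; first exact: mE.
rewrite mE => h; have mS := zf_prodf zS.
apply: (univ_ae nuE).
have : {ae nu, forall y, pp y S = 0}.
  have h0 : \int[nu]_(y in setT) `|pp y S| = 0.
    by rewrite -[RHS]h; apply: eq_integral => y _; rewrite gee0_abs.
  have := (ae_eq_integral_abs nu measurableT (mk S mS)).1 h0.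
  by apply: (@filterS _ _ (ae_filter_ringOfSetsType nu)) => y /(_ I).
by apply: (@filterS _ _ (ae_filter_ringOfSetsType nu)) => y ?; exact/image_null_zf.
Qed.

Lemma first_leg_law x (C : set (sample Y)) :
  path_field (path Y) nonneg C -> pp x [set w | C (w 0%N)] = law Y x C.
Proof.
move=> pC; have := first_leg_rect mY hP ppE x pC (@measurableT _ WP).
rewrite (eq_integral (fun v => (\1_C v)%:E)); last first.
  move=> v _; rewrite (eq_integral (cst 1)); last by move=> y _; exact: probability_setT.
  by rewrite integral_kernel_cst mule1.
rewrite integral_indic // ?setIT; last exact: pf_measurable.
move=> h; apply: etrans h; congr (pp x _).
by apply/seteqP; split => w //= -[].
Qed.

(** As long as the first leg lasts, the revived path follows it. *)
Lemma first_leg_path_le x t (B : set BE) : (0 <= t)%R -> measurable B ->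
  law Y x (path Y t @^-1` (Some @` B)) <= pp x (Z t @^-1` (Some @` B)).
Proof.
move=> t0 mB; pose C := path Y t @^-1` (Some @` B).
have pC : path_field (path Y) nonneg C by exact: path_field_gen.
rewrite -/C -(first_leg_law x pC).
apply: le_measure; [apply: mem_set|apply: mem_set|].
- exact: (prodf_coord 0%N pC).
- exact: measurable_revived_path.
- move=> w [y By yE]; exists y => //.
  have w0 : t%:E < lifetime Y (w 0%N) by apply/(lifetime_gtP mY) => //; exists y.
  by rewrite (revived_path_before _ w0).
Qed.

Section with_laws.
Context (P' : E -> probability (g_sigma_algebraType IF) R).
Hypothesis P'law : @image_law R _ E X pi P'.
Notation V := (@image_process R _ E X pi P').

Lemma image_law_approx y A A' B : IF A -> zf A' -> cm B -> inull y B ->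
  agree_off B A A' -> P' y A = pp y A'.
Proof.
move=> IA zA' mB nB AB; apply: (etrans (P'law (existT _ 0%N y) IA)).
rewrite ppE; last exact: zf_prodf.
by apply: outer_agree_off AB => //; [exact: zf_concat|exact: nB].
Qed.

Lemma image_law_path_event y A : zf A -> P' y A = pp y A.
Proof.
move=> zA; apply: (@image_law_approx y A A set0) => //; first exact: zf_image.
Qed.

Lemma image_filtration_sub t : image_filtration X pi t `<=` IF.
Proof. by apply: augmentation_mono; apply: path_fieldS => s /= /andP[]. Qed.

(** A null set of a completed law is approximated by a path event, which is
    then null as well; so a second completion adds nothing. *)
Lemma augmentation_closed F : sigma_algebra setT F ->
  augmentation R IF (law_null V) (augmentation R cm inull F) `<=`
  augmentation R cm inull F.
Proof.
move=> sF A hA; apply/image_augmentationP => // mu.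
have null0 y : law_null V y set0 by exact: measure0.
have nullU y (B : nat -> set (sample V)) : (forall n, IF (B n)) ->
    (forall n, law_null V y (B n)) -> law_null V y (\bigcup_n B n).
  by move=> mB nB; apply: measure_null_bigcup => // n; apply/image_measurable.
have [A1 hA1 [B1 [IB1 AB1 n1]]] :=
  (@augmentationP R E _ IF _ image_field_sigma null0 nullU _ A
    (augmentation_sigma _ _ _ F)).1 hA mu.
have [A2 FA2 [B2 [mB2 AB2 n2]]] := (image_augmentationP A1 sF).1 hA1 mu.
have [B3 zB3 [B4 [mB4 AB4 n4]]] := (image_augmentationP B1 (path_field_sigma _ _)).1 IB1 mu.
have mB3 := zf_concat zB3.
exists A2 => //; exists (B2 `|` (B4 `|` B3)); split.
- by apply: measurableU => //; exact: measurableU.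
- move=> w /not_orP[nB2 /not_orP[nB4 nB3]].
  rewrite (AB1 w) ?(AB2 w) // => /(AB4 w nB4); exact: nB3.
- apply: (@filterS3 _ _ (ae_filter_ringOfSetsType mu) _ _ _ _ _ n1 n2 n4) => y y1 y2 y4.
  apply: image_nullU => //; first exact: measurableU.
  apply: image_nullU => //; apply/image_null_zf => //.
  by rewrite -(image_law_approx IB1 zB3 mB4 y4 AB4).
Qed.

(** Apply universal measurability to the law of the state at time [t]. *)
Lemma univ_path_approx (mu : probability BE R) t (B : set UE) : (0 <= t)%R ->
  measurable B -> exists B' N : set BE, [/\ measurable B', measurable N,
    agree_off (Z t @^-1` (Some @` N)) (Z t @^-1` (Some @` B)) (Z t @^-1` (Some @` B')) &
    {ae mu, forall y, inull y (Z t @^-1` (Some @` N))}].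
Proof.
move=> t0 /measurable_univ mB.
have [nu [m [mE mnull]]] := initial_mixture mu.
have mZ (C : set BE) : measurable C -> measurable (Z t @^-1` (Some @` C) : set WP).
  exact: measurable_revived_path.
have [la [laE _]] := hitting_law_measure m (@measurableT _ WP) mZ.
have laT : la setT < +oo.
  rewrite laE; apply: le_lt_trans (probability_lty m).
  by apply: le_measure => //; apply: mem_set; rewrite ?setTI; [exact: mZ|exact: measurableT].
have [B' [N [mB' mN N0 BN]]] := univ_sandwich_measure laT mB.
exists B', N; split => //.
- move=> w nw; split.
  + move=> [y By yE]; exists y => //; apply/(BN y) => // Ny.
    by apply: nw; exists y.
  + move=> [y By yE]; exists y => //; apply/(BN y) => // Ny.
    by apply: nw; exists y.
- apply: mnull; first exact: path_field_gen.
  by rewrite laE setTI in N0.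
Qed.

Lemma image_adapted t (B : set UE) : (0 <= t)%R -> measurable B ->
  image_filtration X pi t (Z t @^-1` (Some @` B)).
Proof.
move=> t0 mB.
apply/image_augmentationP; first exact: path_field_sigma.
move=> mu; have [B' [N [mB' mN AB nN]]] := univ_path_approx mu t0 mB.
exists (Z t @^-1` (Some @` B')).
  by apply: path_field_gen => //=; rewrite t0 lexx.
exists (Z t @^-1` (Some @` N)); split => //.
by apply: zf_concat; exact: path_field_gen.
Qed.

Lemma image_law_measurable t (B : set UE) : (0 <= t)%R -> measurable B ->
  measurable_fun setT ((fun y => P' y (Z t @^-1` (Some @` B))) : UE -> \bar R).
Proof.
move=> t0 mB; apply: univ_measurable_ae => mu.
have [B' [N [mB' mN AB nN]]] := univ_path_approx mu t0 mB.
have zB' : zf (Z t @^-1` (Some @` B')) by exact: path_field_gen.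
exists (fun y => pp y (Z t @^-1` (Some @` B'))); split.
  exact: (measurable_revived_law mY hP ppE (zf_prodf zB')).
apply: (@filterS _ _ (ae_filter_ringOfSetsType mu) _ _ _ nN) => y ny.
apply: image_law_approx ny AB => //.
  by apply: (@image_filtration_sub t); exact: image_adapted.
by apply: zf_concat; exact: path_field_gen.
Qed.

(** An event known just after [t] is approximated by path events up to the
    times [t + 1 / (n + 1)]. Their upper limit lies in the right past, hence
    agrees with a past event off a null set. The symmetric difference of the
    two is a path event, so that being null for the mixture makes it null
    from almost every starting point. *)
Lemma image_filt_right (t : R) : (0 <= t)%R ->
  \bigcap_(s in [set s | t < s]%R) image_filtration X pi s `<=` image_filtration X pi t.
Proof.
move=> t0 A hA.
apply/image_augmentationP; first exact: path_field_sigma.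
move=> mu.
have /choice[A_ A_P] n : exists A', path_field Z (upto (t + n.+1%:R^-1)) A' /\
    agree_ae cm inull mu A A'.
  have : image_filtration X pi (t + n.+1%:R^-1) A by apply: hA; rewrite /= ltrDl.
  move=> /(image_augmentationP A (path_field_sigma _ _)).
  by move=> /(_ mu)[A' ? ?]; exists A'.
have /choice[B_ B_P] n := (A_P n).2.
pose Ainf := \bigcap_k \bigcup_n A_ (k + n)%N.
have Apast : right_past Y t Ainf.
  move=> s ts; have st : (0 < s - t)%R by rewrite subr_gt0.
  have [k _ ks] := near_infty_natSinv_lt (PosNum st).
  rewrite (_ : Ainf = \bigcap_j \bigcup_n A_ (k + j + n)%N); last first.
    apply/seteqP; split => w h j _; first exact: h.
    have [n _ An] := h j I; exists (k + n)%N => //.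
    by rewrite addnA (addnC j).
  have sg := @path_field_sigma R E W Z (upto s).
  apply: sigma_algebra_bigcap => // j; case: (sg) => _ _; apply => n.
  have [+ _] := A_P (k + j + n)%N.
  apply: path_fieldS => r /= /andP[-> /=] /le_trans; apply.
  have /= := ks (k + j + n)%N; rewrite -addnA leq_addr => /(_ isT) /ltW.
  by rewrite -lerBrDl.
have AAinf : agree_off (\bigcup_n B_ n) A Ainf.
  move=> w nB; have h n : A w <-> A_ n w.
    by have [_ + _] := B_P n; apply => Bw; apply: nB; exists n.
  split => [Aw k _|/(_ 0%N I)[n _ /h]//].
  by exists 0%N => //; apply/h.
have [nu [m [mE mnull]]] := initial_mixture mu.
have [A'' [B [zA'' mB B0 AB]]] := right_past_trivial mY hP ppE mE t0 Apast.
have zA''2 : zf A'' by move: zA''; apply: path_fieldS => s /= /andP[].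
have zAinf : zf Ainf.
  by have := Apast (t + 1)%R; rewrite ltrDl ltr01 => /(_ isT);
    apply: path_fieldS => s /= /andP[].
pose D := (Ainf `\` A'') `|` (A'' `\` Ainf).
have sz := @path_field_sigma R E W Z nonneg.
have zD : zf D by apply: (sigma_algebra_U sz); apply: (sigma_algebra_D sz).
exists A'' => //; exists (\bigcup_n B_ n `|` D); split.
- apply: measurableU; last exact: zf_concat.
  by apply: bigcup_measurable => n _; have [] := B_P n.
- move=> w /not_orP[nB nD]; rewrite (AAinf w nB); split => h; apply: contrapT => h';
  apply: nD; by [left|right].
- have h1 : {ae mu, forall y, inull y D}.
    apply: mnull => //; apply: (@measure_nullS _ _ _ m _ B) => //; first exact: zf_prodf.
    move=> w [[w1 w2]|[w1 w2]]; apply: contrapT => /(AB w)[h h'].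
      by apply: w2; exact: h.
    by apply: w2; exact: h'.
  have h2 : forall n, {ae mu, forall y, inull y (B_ n)} by move=> n; have [] := B_P n.
  move/ae_foralln : h2;
    apply: (@filterS2 _ _ (ae_filter_ringOfSetsType mu) _ _ _ _ h1) => y yD yB.
  have mBn n : cm (B_ n) by have [] := B_P n.
  apply: image_nullU => //; first by apply: bigcup_measurable => n _; exact: mBn.
    exact: zf_concat.
  exact: image_null_bigcup.
Qed.

Lemma image_law_start x : P' x [set w | Z 0 w = Some x] = 1.
Proof.
have -> : [set w | Z 0 w = Some x] = Z 0 @^-1` (Some @` [set x]).
  by apply/seteqP; split => w /=; [move=> ->; exists x|move=> [_ -> ->]].
have m1 : measurable ([set x] : set BE).
  by apply: measurable_set1_radon; exact: state_radon mY.
have z1 : zf (Z 0 @^-1` (Some @` [set x])) by apply: path_field_gen => //=.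
rewrite image_law_path_event //; apply/eqP; rewrite eq_le probability_le1 /=;
  last exact: zf_prodf.
apply: le_trans (first_leg_path_le x (lexx 0%R) m1).
rewrite -(law_start mY x) (_ : [set w | _] = path Y 0 @^-1` (Some @` [set x])) //.
by apply/seteqP; split => w /=; [move=> wx; exists x|move=> [_ -> ->]].
Qed.

End with_laws.
End image_of_concatenation.

(** * The Markov property of the image *)

Section image_markov.
Context (R : realType) (E : ptopologicalType) (Y : process R E).
Hypothesis mY : markov_process Y.
Context (K : transfer_kernel E Y).
Context (P : {n : nat & E} ->
  probability (@concat_sample R (fun=> E) (fun=> Y)) R).
Hypothesis hP : @concat_law R (fun=> E) (fun=> Y) (fun=> K) P.

Notation W := (nat -> sample Y).
Notation UE := (univType R E).
Notation BE := (borelType E).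
Notation nonneg := [set t : R | (0 <= t)%R].
Notation prodf := <<s leg_cylinders Y>>.
Notation WP := (g_sigma_algebraType (leg_cylinders Y)).
Notation Z := (@revived_path R E Y).
Notation theta := (@revived_shift R E Y).
Notation alive t := (Z t @^-1` (Some @` setT)).
Notation zf := (path_field Z nonneg).
Notation X := (@concatenation R (fun=> E) (fun=> Y) P).
Notation pi := (fun z : {n : nat & E} => projT2 z).
Notation IF := (@image_field R {n : nat & E} E X pi).

Context (pp : E -> probability WP R).
Hypothesis ppE : forall x A, prodf A -> pp x A = P (existT _ 0%N x) A.
Context (P' : E -> probability (g_sigma_algebraType IF) R).
Hypothesis P'law : @image_law R _ E X pi P'.
Notation V := (@image_process R _ E X pi P').

Let mZ t (B : set UE) : (0 <= t)%R -> measurable B ->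
  measurable (path V t @^-1` (Some @` B)).
Proof.
move=> t0 mB; apply/image_measurable.
by apply: (@image_filtration_sub _ _ _ _ t); exact: (image_adapted mY hP ppE).
Qed.

Let mlaw t (B : set UE) : (0 <= t)%R -> measurable B ->
  measurable_fun [set: UE]
    (fun x : UE => law V x (path V t @^-1` (Some @` B))).
Proof. by move=> t0 mB; exact: (image_law_measurable mY hP ppE P'law). Qed.

Lemma image_usual : usual_filtration V.
Proof.
split => /=.
- by move=> t t0; exact: augmentation_sigma.
- move=> s t s0 st; apply: augmentation_mono; apply: path_fieldS => r /= /andP[-> h].
  exact: le_trans h st.
- by move=> t t0 A hA; apply/image_measurable; exact: (@image_filtration_sub _ _ _ _ t).
- move=> t t0 A hA; apply: (augmentation_closed mY hP ppE P'law (path_field_sigma _ _)).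
  by move=> mu; have := hA mu; rewrite -(sigma_algebra_measurableE (image_field_sigma _)).
- by move=> t t0; exact: (image_filt_right mY hP ppE).
- move=> A hA; apply/image_measurable.
  apply: (augmentation_closed mY hP ppE P'law (path_field_sigma _ _)).
  by move=> mu; have := hA mu; rewrite -(sigma_algebra_measurableE (image_field_sigma _)).
Qed.

Lemma path_event_shift s t (B : set E) : (0 <= s)%R -> (0 <= t)%R ->
  Z (s + t)%R @^-1` (Some @` B) = alive s `&` theta s @^-1` (Z t @^-1` (Some @` B)).
Proof.
move=> s0 t0; apply/seteqP; split => w /=.
- move=> [y By yE]; split; last by exists y => //; rewrite revived_path_shift // addrC.
  case Zs : (Z s w) => [z|]; first by exists z.
  have : Z (s + t) w = None.
    apply/(revived_path_noneP mY) => [|n]; first exact: addr_ge0.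
    have := (revived_path_noneP mY w s0).1 Zs n; move=> /le_trans; apply.
    by rewrite lee_fin lerDl.
  by rewrite -yE.
- by move=> [_ [y By yE]]; exists y => //; rewrite yE revived_path_shift // addrC.
Qed.

(** For Borel sets of states both sides concern path events, up to a null set
    that comes from [A]. *)
Lemma image_markov_borel x s t (A : set (sample V)) (B : set BE) :
  (0 <= s)%R -> (0 <= t)%R -> measurable B -> image_filtration X pi s A ->
  law V x (A `&` path V (s + t)%R @^-1` (Some @` B)) =
  \int[law V x]_(w in A)
    ext (fun y => law V y (path V t @^-1` (Some @` B))) (path V s w).
Proof.
move=> s0 t0 mB hA.
have mA : measurable A.
  by apply/image_measurable; exact: (@image_filtration_sub _ _ _ _ s).
have mZs (D : set UE) : measurable D -> measurable (path V s @^-1` (Some @` D)).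
  exact: mZ.
have [l [lE lint]] := hitting_law_measure (law V x) mA mZs.
rewrite lint //; last exact: (mlaw t0 (borel_univ mB)).
change (P' x (A `&` Z (s + t)%R @^-1` (Some @` B)) =
  \int[l]_y P' y (Z t @^-1` (Some @` B))).
have IA : IF A by exact: (@image_filtration_sub _ _ _ _ s).
have [A' [C [pA' mC AA' nC]]] := image_approx x (path_field_sigma _ _) hA.
have zA' : zf A' by move: pA'; apply: path_fieldS => r /= /andP[].
pose G := Z t @^-1` (Some @` B).
have zG : zf G by exact: path_field_gen.
have mE (D : set W) : prodf D -> pp x D = \int[dirac (x : UE)]_y pp y D.
  by move=> mD; rewrite integral_dirac // ?diracT ?mul1e //;
    exact: (measurable_revived_law mY hP ppE).
have [u [N [mu u01 [mN N0] uN hu]]] := revived_markov_version mY hP ppE mE s0 zG.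
have st0 : (0 <= s + t)%R by exact: addr_ge0.
have Ppp r (D : set BE) : (0 <= r)%R -> measurable D ->
    P' x (A `&` Z r @^-1` (Some @` D)) = pp x (A' `&` Z r @^-1` (Some @` D)).
  move=> r0 mD; have zD : zf (Z r @^-1` (Some @` D)) by exact: path_field_gen.
  have IAD : IF (A `&` Z r @^-1` (Some @` D)).
    by apply: (sigma_algebra_I (image_field_sigma _)) => //; exact: zf_image.
  have zAD : zf (A' `&` Z r @^-1` (Some @` D)).
    exact: (sigma_algebra_I (path_field_sigma _ _)).
  apply: (image_law_approx mY ppE P'law IAD zAD mC nC).
  exact: agree_offI.
rewrite Ppp // path_event_shift // setIA hu; last exact: upto_right_past.
have mZB (D : set BE) : measurable D -> measurable (Z s @^-1` (Some @` D) : set WP).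
  exact: measurable_revived_path.
have mA' : measurable (A' : set WP) by exact: zf_prodf.
have [l' [l'E l'int]] := hitting_law_measure (pp x) mA' mZB.
rewrite l'int //; last by move=> y; have /andP[] := u01 y.
have mid : measurable_fun [set: UE] (id : UE -> BE).
  by apply: borel_univ_fun; exact: measurable_id.
have [lb [lbE lbint]] := image_measure_exists l mid.
transitivity (\int[lb]_y u y).
  apply: eq_measure_integral => D mD _.
  apply: (etrans (l'E D)); apply: (etrans (esym (Ppp s D s0 mD))).
  by apply: (etrans (esym (lE D))); exact: esym (lbE D).
rewrite lbint //; last by move=> y; have /andP[] := u01 y.
apply: ae_eq_integral => //.

- exact: borel_univ_fun.
- by have := image_law_measurable mY hP ppE P'law t0 (borel_univ mB).
exists N; split; first exact: borel_univ.
- apply: (etrans (lE N)); apply: (etrans (Ppp s N s0 mN)).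
  apply: (@measure_nullS _ _ _ (pp x) _ (Z s @^-1` (Some @` N))) => //.
  + by apply: measurableI => //; exact: mZB.
  + exact: mZB.
- move=> y /= h; apply: contrapT => nN; apply: h => _.
  by rewrite uN // (image_law_path_event mY ppE P'law).
Qed.

Lemma image_markov_ge0 x s t (f : E -> \bar R) (A : set (sample V)) :
  (0 <= s)%R -> (0 <= t)%R ->
  measurable_fun setT (f : UE -> \bar R) -> (forall y, 0 <= f y) ->
  image_filtration X pi s A ->
  \int[law V x]_(w in A) ext f (path V (s + t)%R w) =
  \int[law V x]_(w in A) ext (semigroup V t f) (path V s w).
Proof.
move=> s0 t0 mf f0 hA; apply: markov_borel_ge0 => //.
  by apply/image_measurable; exact: (@image_filtration_sub _ _ _ _ s).
by move=> B mB; exact: image_markov_borel.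
Qed.

Lemma image_law_ext_integrable x t (A : set (sample V)) (g : E -> \bar R) (M : R) :
  (0 <= t)%R -> measurable A ->
  measurable_fun setT (g : UE -> \bar R) -> (forall y, 0 <= g y <= M%:E) ->
  (law V x).-integrable A (fun w => ext g (path V t w)).
Proof.
move=> t0 mA mg gM.
have g0 y : 0 <= g y by have /andP[] := gM y.
have M0 : (0 <= M)%R by have /andP[a b] := gM point; rewrite -lee_fin (le_trans a b).
have mZt (D : set UE) : measurable D -> measurable (path V t @^-1` (Some @` D)).
  exact: mZ.
apply: (@le_integrable _ _ _ _ _ mA _ (cst M%:E)).
- by apply: measurable_funTS; exact: (measurable_ext mZt).
- move=> w _; rewrite gee0_abs; last exact: ext_ge0.
  rewrite /= ger0_norm //; case: (image_path _ _ _ _) => [y|] /=;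
    first by have /andP[] := gM y.
  by rewrite lee_fin.
- by apply: finite_measure_integrable_cst.
Qed.

Lemma image_markov_property x s t (f : E -> R) (A : set (sample V)) :
  (0 <= s)%R -> (0 <= t)%R ->
  measurable_fun setT (f : UE -> R) -> (exists M, forall y, (`|f y| <= M)%R) ->
  image_filtration X pi s A ->
  \int[law V x]_(w in A) ext (EFin \o f) (path V (s + t)%R w) =
  \int[law V x]_(w in A) ext (semigroup V t (EFin \o f)) (path V s w).
Proof.
move=> s0 t0 mf [M fM] hA; have st0 : (0 <= s + t)%R by exact: addr_ge0.
have M0 : (0 <= M)%R by apply: le_trans (fM point).
have mA : measurable A by apply/image_measurable; exact: (@image_filtration_sub _ _ _ _ s).
pose F : E -> \bar R := EFin \o f.
have mF : measurable_fun setT (F : UE -> \bar R) by exact/measurable_EFinP.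
have mFp : measurable_fun setT (F^\+ : UE -> \bar R) by exact: measurable_funepos.
have mFn : measurable_fun setT (F^\- : UE -> \bar R) by exact: measurable_funeneg.
have boundp y : 0 <= F^\+ y <= M%:E.
  rewrite funepos_ge0 /= funeposE ge_max /F /= !lee_fin M0 andbT.
  exact: le_trans (ler_norm _) (fM y).
have boundn y : 0 <= F^\- y <= M%:E.
  rewrite funeneg_ge0 /= funenegE ge_max /F /= !lee_fin M0 andbT.
  by apply: le_trans (fM y); rewrite -normrN ler_norm.
have extp r : (fun w : sample V => ext F (path V r w))^\+ = fun w => ext F^\+ (path V r w).
  by apply/funext => w; rewrite funeposE; case: (path V r w) => [y|] /=;
    rewrite ?funeposE ?maxxx.
have extn r : (fun w : sample V => ext F (path V r w))^\- = fun w => ext F^\- (path V r w).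
  by apply/funext => w; rewrite funenegE; case: (path V r w) => [y|] /=;
    rewrite ?funenegE ?oppe0 ?oppr0 ?maxxx.
have Fp0 y : 0 <= F^\+ y by have /andP[] := boundp y.
have Fn0 y : 0 <= F^\- y by have /andP[] := boundn y.
rewrite integralE extp extn !image_markov_ge0 //.
have Sle g y : (forall z, 0 <= g z <= M%:E) -> measurable_fun setT (g : UE -> \bar R) ->
    0 <= semigroup V t g y <= M%:E.
  move=> gM mg; apply/andP; split.
    by apply: semigroup_ge0 => z; have /andP[] := gM z.
  rewrite -[leRHS](integral_cst_probability (law V y)); apply: ge0_le_integral => //.
  - by move=> w _; apply: ext_ge0 => z; have /andP[] := gM z.
  - apply: (@measurable_ext _ _ _ UE) => // D; exact: mZ.
  - by move=> w _; case: (path V t w) => [z|] /=; [have /andP[] := gM z|rewrite lee_fin].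
have mS g : (forall z, 0 <= g z) -> measurable_fun setT (g : UE -> \bar R) ->
    measurable_fun setT (semigroup V t g : UE -> \bar R).
  by move=> g0 mg; exact: realization_semigroup_measurable.
rewrite -integralB //; last 2 first.
- apply: (@image_law_ext_integrable _ _ _ _ M) => //; first exact: mS.
  by move=> y; exact: Sle.
- apply: (@image_law_ext_integrable _ _ _ _ M) => //; first exact: mS.
  by move=> y; exact: Sle.
apply: eq_integral => w _; case: (path V s w) => [y|] /=; last by rewrite sube0.
by rewrite /semigroup [RHS]integralE extp extn.
Qed.

Lemma image_markov_process : markov_process V.
Proof.
split.
- exact: state_radon mY.
- exact: image_usual.
- by move=> w; exact: revived_path_right.
- by move=> t B t0 mB; exact: (image_adapted mY hP ppE).
- by move=> s t w s0 t0; exact: revived_path_shift.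
- move=> t w t0 lt.
  apply/(revived_path_noneP mY w t0) => n; rewrite leNgt; apply/negP => tn.
  suff : leg_end n w <= lifetime V w.
    by move=> /le_trans/(_ lt); rewrite leNgt tn.
  apply: le_ereal_inf_tmp => _ [r [r0 rN] <-].
  exact: (revived_path_noneP mY w r0).1 rN n.
- apply/eqP; rewrite eq_le; apply/andP; split.
    by apply: ereal_inf_lbound; exists 0%R => //; split => //; exact: revived_path_dead.
  by apply: le_ereal_inf_tmp => _ [r [r0 _] <-]; rewrite lee_fin.
- by move=> x; exact: (image_law_start mY hP ppE).
- by move=> t B t0 mB; exact: (image_law_measurable mY hP ppE P'law).
- move=> x s t f A s0 t0 mf fM hA; exact: image_markov_property.
Qed.

End image_markov.

(** * Excessive functions of a dominated process *)

Section discounted_semigroup.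
Context (R : realType) (E : ptopologicalType) (X : process R E).
Hypothesis mX : markov_process X.
Notation UE := (univType R E).
Implicit Types (f g : E -> \bar R) (x : E) (a s t : R).

Lemma semigroup_le t f g x : (0 <= t)%R ->
  measurable_fun setT (f : UE -> \bar R) -> measurable_fun setT (g : UE -> \bar R) ->
  (forall y, 0 <= f y) -> (forall y, f y <= g y) ->
  semigroup X t f x <= semigroup X t g x.
Proof.
move=> t0 mf mg f0 fg; apply: ge0_le_integral => //.
- by move=> w _; exact: ext_ge0.
- exact: measurable_ext_path.
- exact: measurable_ext_path.
- by move=> w _; case: (path X t w) => [y|] /=.
Qed.

Lemma semigroupZ t f x (c : R) : (0 <= t)%R -> (0 <= c)%R ->
  measurable_fun setT (f : UE -> \bar R) -> (forall y, 0 <= f y) ->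
  semigroup X t (fun y => c%:E * f y) x = c%:E * semigroup X t f x.
Proof.
move=> t0 c0 mf f0; rewrite /semigroup -ge0_integralZl //.
- by apply: eq_integral => w _; case: (path X t w) => [y|] //=; rewrite mule0.
- exact: measurable_ext_path.
- by move=> w _; exact: ext_ge0.
Qed.

Lemma semigroupD t f g x : (0 <= t)%R ->
  measurable_fun setT (f : UE -> \bar R) -> measurable_fun setT (g : UE -> \bar R) ->
  (forall y, 0 <= f y) -> (forall y, 0 <= g y) ->
  semigroup X t (fun y => f y + g y) x = semigroup X t f x + semigroup X t g x.
Proof.
move=> t0 mf mg f0 g0; rewrite /semigroup -ge0_integralD //.
- by apply: eq_integral => w _; case: (path X t w) => [y|] //=; rewrite adde0.
- by move=> w _; exact: ext_ge0.
- exact: measurable_ext_path.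
- by move=> w _; exact: ext_ge0.
- exact: measurable_ext_path.
Qed.

Lemma semigroup_comp s t f x : (0 <= s)%R -> (0 <= t)%R ->
  measurable_fun setT (f : UE -> \bar R) -> (forall y, 0 <= f y) ->
  semigroup X (s + t) f x = semigroup X s (semigroup X t f) x.
Proof.
move=> s0 t0 mf f0; rewrite /semigroup; apply: markov_ge0 => //.
exact: sigma_algebra_T (filt_sigma (usual mX) s0).
Qed.

Lemma semigroup_cst t x (c : R) : (0 <= t)%R -> (0 <= c)%R ->
  semigroup X t (cst c%:E) x = c%:E * law X x (path X t @^-1` (Some @` setT)).
Proof.
move=> t0 c0; have := @semigroupZ t (cst 1) x c t0 c0 (measurable_cst _) (fun=> lee01).
rewrite (_ : (fun y => _) = cst c%:E); last by apply/funext => y /=; rewrite mule1.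
by move=> ->; rewrite /semigroup integral_ext1_path // setTI.
Qed.

Lemma semigroup_bound t f x (c : R) : (0 <= t)%R -> (0 <= c)%R ->
  measurable_fun setT (f : UE -> \bar R) -> (forall y, 0 <= f y <= c%:E) ->
  0 <= semigroup X t f x <= c%:E.
Proof.
move=> t0 c0 mf fc; have f0 y : 0 <= f y by have /andP[] := fc y.
rewrite semigroup_ge0 //=; apply: (@le_trans _ _ (semigroup X t (cst c%:E) x)).
  by apply: semigroup_le => // y; have /andP[] := fc y.
rewrite semigroup_cst // -[leRHS]mule1; apply: lee_wpmul2l; first by rewrite lee_fin.
by apply: probability_le1; apply: path_measurable.
Qed.

Definition discounted a t f x : \bar R := (expR (- (a * t)))%:E * semigroup X t f x.

(** Excessivity without the convergence at time [0]. *)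
Definition supermedian a f : Prop := forall t x, (0 < t)%R -> discounted a t f x <= f x.

Lemma discounted_mono a s t f x : supermedian a f ->
  measurable_fun setT (f : UE -> \bar R) -> (forall y, 0 <= f y) ->
  (0 <= s)%R -> (s <= t)%R -> discounted a t f x <= discounted a s f x.
Proof.
move=> sf mf f0 s0; rewrite le_eqVlt => /predU1P[->//|st].
have r0 : (0 < t - s)%R by rewrite subr_gt0.
have -> : t = (s + (t - s))%R by rewrite addrC subrK.
move: (t - s)%R r0 => r r0 {st t}; have r0' := ltW r0.
have mr : measurable_fun setT (semigroup X r f : UE -> \bar R) by exact: measurable_semigroup.
have Tr0 y : 0 <= semigroup X r f y by exact: semigroup_ge0.
rewrite /discounted semigroup_comp // mulrDr opprD expRD EFinM -muleA.
apply: lee_wpmul2l; first by rewrite lee_fin expR_ge0.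
rewrite -semigroupZ ?expR_ge0 //; apply: semigroup_le => //.
- exact: measurable_funeM.
- by move=> y; rewrite mule_ge0 // lee_fin expR_ge0.
- by move=> y; exact: sf.
Qed.

Lemma excessive_supermedian a f : excessive X a f -> supermedian a f.
Proof.
move=> [mf f0 fmono flim] t x t0.
apply: cvge_ge (flim x); near=> s; apply: fmono => //.
by near: s; exact: nbhs_right_le.
Unshelve. all: by end_near. Qed.

(** The discounted semigroup decreases in time, so its limit at [0] is a
    supremum. *)
Lemma supermedian_excessive a f :
  measurable_fun setT (f : UE -> \bar R) -> (forall y, 0 <= f y) ->
  supermedian a f ->
  (forall x (M : \bar R), (forall t, (0 < t)%R -> discounted a t f x <= M) -> f x <= M) ->
  excessive X a f.
Proof.
move=> mf f0 sf fsup; split => // [x s t s0 st|x].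
  exact: discounted_mono (ltW s0) st.
have mono : {in Interval (BRight 0%R) (BLeft 1%R) &,
    nonincreasing_fun (fun t : R => discounted a t f x)}.
  move=> s t /[!in_itv]/= /andP[s0 _] _ st.
  exact: discounted_mono (ltW s0) st.
have := nonincreasing_at_right_cvge (BLeft 1%R) _ mono.
rewrite (_ : ereal_sup _ = f x); first by apply; rewrite bnd_simp.
apply/eqP; rewrite eq_le; apply/andP; split.
  apply: ge_ereal_sup => _ [t /= /[!in_itv]/= /andP[t0 _] <-]; exact: sf.
apply: fsup => t t0; pose r := (Num.min t (2^-1))%R.
have r0 : (0 < r)%R by rewrite lt_min t0 /= invr_gt0.
apply: (@le_trans _ _ (discounted a r f x)).
  by apply: discounted_mono => //; [exact: ltW|rewrite ge_min lexx].
apply: ereal_sup_ubound; exists r => //=.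
rewrite in_itv /= r0 /= gt_min [X in _ || X](_ : _ = true) ?orbT //.
by rewrite invf_lt1 // ltr1n.
Qed.

(** By right continuity a path alive at time [0] stays alive for some time. *)
Lemma alive_near_start x (e : R) : (0 < e)%R -> exists2 s : R, (0 < s)%R &
  1 - e%:E < law X x (path X s @^-1` (Some @` setT)).
Proof.
move=> e0.
pose F (n : nat) : set (sample X) := path X (n.+1%:R^-1)%R @^-1` (Some @` setT).
have mF n : measurable (F n) by apply: path_measurable.
have ndF : nondecreasing_seq F.
  move=> m n mn; apply/subsetPset => w [y _ yE].
  case En : (path X (n.+1%:R^-1)%R w) => [z|]; first by exists z.
  have h : ((n.+1%:R^-1 : R) <= m.+1%:R^-1)%R by rewrite lef_pV2 ?posrE // ler_nat.
  have n0 : (0 <= n.+1%:R^-1 :> R)%R by [].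
  by have := path_none_mono mX n0 h En; rewrite -yE.
have cF := @nondecreasing_cvg_mu _ _ _ (law X x) F mF (bigcupT_measurable F mF) ndF.
have F1 : law X x (\bigcup_n F n) = 1.
  apply/eqP; rewrite eq_le probability_le1 ?andTb; last exact: bigcupT_measurable.
  rewrite -[X in X <= _](law_start mX x); apply: le_measure; [apply: mem_set|apply: mem_set|].
  - rewrite (_ : [set w | _] = path X 0 @^-1` (Some @` [set x])).
      by apply: path_measurable => //; apply: borel_univ; apply: measurable_set1_radon;
        exact: state_radon mX.
    by apply/seteqP; split => w /=; [move=> ->; exists x|move=> [_ -> ->]].
  - exact: bigcupT_measurable.
  move=> w /= w0.
  have nT : nbhs x setT by exact: filterT.
  have [d d0 hd] := near_rightP (right_continuous_some (lexx 0%R) (path_right mX w) w0 nT).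
  have [k _ ks] := near_infty_natSinv_lt (PosNum d0).
  exists k => //; apply: hd => //.
  by rewrite add0r; apply: ks => /=.
have cF1 := eq_ind _ (fun l : \bar R => (law X x \o F) @ \oo --> l) cF _ F1.
have : \forall n \near \oo, 1 - e%:E < (law X x \o F) n.
  apply: (cF1 [set z : \bar R | 1 - e%:E < z]); apply: open_nbhs_nbhs; split;
    first exact: open_ereal_gt_ereal.
  by rewrite /= -EFinB lte_fin ltrBlDr ltrDl.
by move=> [n _ /(_ n (leqnn n)) hn]; exists (n.+1%:R^-1)%R.
Qed.

End discounted_semigroup.

Section excessive_domination.
Context (R : realType) (E : ptopologicalType) (Y V : process R E).
Hypotheses (mY : markov_process Y) (mV : markov_process V).
Notation UE := (univType R E).
Hypothesis dom : forall t x (B : set UE), (0 <= t)%R -> measurable B ->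
  law Y x (path Y t @^-1` (Some @` B)) <= law V x (path V t @^-1` (Some @` B)).
Implicit Types (f g : E -> \bar R) (x : E) (a s t : R).

Lemma semigroup_dom t f x : (0 <= t)%R ->
  measurable_fun setT (f : UE -> \bar R) -> (forall y, 0 <= f y) ->
  semigroup Y t f x <= semigroup V t f x.
Proof.
move=> t0 mf f0.
have mYt (D : set UE) : measurable D -> measurable (path Y t @^-1` (Some @` D)).
  exact: path_measurable.
have mVt (D : set UE) : measurable D -> measurable (path V t @^-1` (Some @` D)).
  exact: path_measurable.
have [l1 [l1E l1i]] := hitting_law_measure (law Y x) measurableT mYt.
have [l2 [l2E l2i]] := hitting_law_measure (law V x) measurableT mVt.
rewrite /semigroup l1i // l2i //; apply: ge0_le_measure_integral => // D mD.
by rewrite l1E l2E !setTI; exact: dom.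
Qed.

(** Domination applied to [c - g]: on bounded functions the semigroups differ
    at most by the mass that [Y] has lost by time [t]. *)
Lemma semigroup_defect t g x (c : R) : (0 <= t)%R -> (0 <= c)%R ->
  measurable_fun setT (g : UE -> \bar R) -> (forall y, 0 <= g y <= c%:E) ->
  semigroup V t g x + c%:E * law Y x (path Y t @^-1` (Some @` setT)) <=
  c%:E + semigroup Y t g x.
Proof.
move=> t0 c0 mg gc.
have g0 y : 0 <= g y by have /andP[] := gc y.
have gfin y : g y \is a fin_num.
  by rewrite ge0_fin_numE //; have /andP[_ /le_lt_trans] := gc y; apply; exact: ltry.
pose g' y := c%:E - g y.
have mg' : measurable_fun setT (g' : UE -> \bar R) by exact: emeasurable_funB.
have g'0 y : 0 <= g' y by rewrite sube_ge0 ?gfin //; have /andP[] := gc y.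
have gg' : (fun y => g y + g' y) = cst c%:E.
  by apply/funext => y; rewrite /g' addeC subeK.
have TY := semigroupD mY x t0 mg mg' g0 g'0.
have TV := semigroupD mV x t0 mg mg' g0 g'0.
rewrite gg' semigroup_cst // in TY.
have cb (y : E) : 0 <= (cst c%:E : E -> \bar R) y <= c%:E.
  by rewrite /= lee_fin c0 lexx.
have /andP[_ Vc] := semigroup_bound mV x t0 c0 (measurable_cst _) cb.
rewrite TY addeA addeAC; apply: leeD2r.
apply: le_trans Vc; rewrite -gg' TV; apply: leeD2l.
exact: semigroup_dom.
Qed.

(** Think of [Y] as [V] killed at some time. The inequality for excessive
    functions passes to the smaller semigroup. For the limit at [0], the
    truncations [mine f n] are supermedian for [V] and bounded, so that
    [semigroup_defect] compares the two semigroups up to a term that vanishes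
    at time [0]. *)
Lemma excessive_dominated a f : (0 <= a)%R -> excessive V a f -> excessive Y a f.
Proof.
move=> a0 ef; have sV := excessive_supermedian ef; have [mf f0 _ flim] := ef.
have e01 t : (0 <= t)%R -> (0 < expR (- (a * t)) <= 1)%R.
  by move=> t0; rewrite expR_gt0 /= -expR0 ler_expR oppr_le0 mulr_ge0.
apply: supermedian_excessive => //.
  move=> t x t0; apply: le_trans (sV t x t0).
  apply: lee_wpmul2l; first by rewrite lee_fin expR_ge0.
  by apply: semigroup_dom => //; exact: ltW.
move=> x M hM; rewrite leNgt; apply/negP => Mf.
have [s s0 Ms] : exists2 s, (0 < s)%R & M < discounted V a s f x.
  have : \forall s \near 0%R^'+, M < discounted V a s f x.
    apply: (flim x [set z : \bar R | M < z]); apply: open_nbhs_nbhs; split => //.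
    exact: open_ereal_gt_ereal.
  by move=> h; have [e e0 he] := near_rightP h; exists (e / 2)%R; last apply: he;
    rewrite ?divr_gt0 // add0r ltr_pdivrMr // ltr_pMr // ltr1n.
pose g (n : nat) : E -> \bar R := fun y => mine (f y) n%:R%:E.
have mg n : measurable_fun setT (g n : UE -> \bar R).
  by apply: measurable_mine => //; exact: measurable_cst.
have gb n y : 0 <= g n y <= n%:R%:E.
  by rewrite /g le_min f0 lee_fin ler0n ge_min lexx orbT.
have g0 n y : 0 <= g n y by have /andP[] := gb n y.
have gcvg y : g ^~ y @ \oo --> f y.
  case fy : (f y) => [r| |]; last by have := f0 y; rewrite fy.
  - apply: cvg_near_cst; near=> n; rewrite /g fy; apply/eqP.
    rewrite eq_le ge_min lexx /= le_min lexx lee_fin.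
    by near: n; exact: nbhs_infty_ger.
  - rewrite (_ : g ^~ y = fun n => n%:R%:E); first by apply/cvgenyP; exact: cvg_id.
    by apply/funext => n; rewrite /g fy min_r ?leey.
have gmono z : nondecreasing_seq (g ^~ z).
  move=> m n mn; by rewrite /g le_min2 // lee_fin ler_nat.
have s0' := ltW s0.
have [n Mn] : exists n, M < discounted V a s (g n) x.
  apply: contrapT => nM; move: Ms; apply/negP; rewrite -leNgt.
  have lim : discounted V a s (g n) x @[n --> \oo] --> discounted V a s f x.
    apply: cvgeZl => //; rewrite /semigroup.
    have -> : (fun w => ext f (path V s w)) = fun w => limn (fun n => ext (g n) (path V s w)).
      apply/funext => w; case: (path V s w) => [y|] /=; apply/esym/cvg_lim => //.
      exact: cvg_cst.
    apply: cvg_monotone_convergence => //.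
    - by move=> n; exact: measurable_ext_path.
    - by move=> n w _; exact: ext_ge0.
    - by move=> w _ m n mn; case: (path V s w) => [y|] //=; exact: gmono.
  apply: cvge_le lim; apply: nearW => n; rewrite leNgt; apply/negP => h.
  by apply: nM; exists n.
have sg : supermedian V a (g n).
  move=> t y t0; rewrite /g le_min; apply/andP; split.
    apply: le_trans (sV t y t0).
    apply: lee_wpmul2l; first by rewrite lee_fin expR_ge0.
    apply: semigroup_le => //; [exact: ltW|exact: mg|exact: g0|].
    by move=> z; rewrite /g ge_min lexx.
  have t0' := ltW t0; have /andP[ep e1] := e01 t t0'.
  have /andP[S0 Sn] := semigroup_bound mV y t0' (ler0n R n) (mg n) (gb n).
  apply: le_trans Sn; rewrite -[leRHS]mul1e; apply: lee_wpmul2r => //.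
have nn := ler0n R n.
have /andP[Sv0 Svn] := semigroup_bound mV x s0' nn (mg n) (gb n).
have M0 : 0 <= M.
  apply: le_trans (hM 1%R ltr01); apply: mule_ge0; first by rewrite lee_fin expR_ge0.
  exact: semigroup_ge0.
have Sfin : semigroup V s (g n) x \is a fin_num by rewrite ge0_fin_numE // (le_lt_trans Svn) ?ltry.
have Mfin : M \is a fin_num.
  by rewrite ge0_fin_numE //; apply: lt_trans Mn _;
    rewrite /discounted -(fineK Sfin) -EFinM ltry.
move: Mn hM M0; rewrite /discounted -(fineK Sfin) -EFinM -(fineK Mfin).
move: (fine M) => c; set v := (expR _ * _)%R; rewrite lte_fin => cv hM c0.
have d0 : (0 < (v - c) / n.+1%:R)%R by rewrite divr_gt0 ?subr_gt0.
have [r r0 hr] := alive_near_start mY x d0.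
pose t := Num.min r s.
have t0 : (0 < t)%R by rewrite lt_min r0.
have t0' := ltW t0.
have h1 := semigroup_defect x t0' nn (mg n) (gb n).
have /andP[St0 Stn] := semigroup_bound mV x t0' nn (mg n) (gb n).
have /andP[Tt0 Ttn] := semigroup_bound mY x t0' nn (mg n) (gb n).
have ts : (t <= s)%R by rewrite ge_min lexx orbT.
have h2 := discounted_mono mV x sg (mg n) (g0 n) t0' ts.
have h3 : discounted Y a t (g n) x <= c%:E.
  apply: le_trans (hM t t0); apply: lee_wpmul2l; first by rewrite lee_fin expR_ge0.
  by apply: semigroup_le => // z; rewrite /g ge_min lexx.
have mp u : (0 <= u)%R -> measurable (path Y u @^-1` (Some @` setT)).
  by move=> u0; exact: path_measurable.
have p1 : law Y x (path Y t @^-1` (Some @` setT)) <= 1.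
  by apply: probability_le1; exact: mp.
have h4 : 1 - ((v - c) / n.+1%:R)%:E < law Y x (path Y t @^-1` (Some @` setT)).
  apply: lt_le_trans hr _; apply: le_measure; [apply: mem_set|apply: mem_set|].
  - by apply: mp; exact: ltW.
  - exact: mp.
  - move=> w [y _ yE]; case Et : (path Y t w) => [z|]; first by exists z.
    have tr : (t <= r)%R by rewrite ge_min lexx.
    by have := path_none_mono mY t0' tr Et; rewrite -yE.
have pfin : law Y x (path Y t @^-1` (Some @` setT)) \is a fin_num.
  by rewrite ge0_fin_numE // (le_lt_trans p1) ?ltry.
have Stfin : semigroup V t (g n) x \is a fin_num by rewrite ge0_fin_numE // (le_lt_trans Stn) ?ltry.
have Ttfin : semigroup Y t (g n) x \is a fin_num by rewrite ge0_fin_numE // (le_lt_trans Ttn) ?ltry.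
move: h1 h2 h3 h4 p1;
  rewrite /discounted -(fineK Sfin) -(fineK Stfin) -(fineK Ttfin) -(fineK pfin).
rewrite -!EFinM -EFinB -!EFinD !lee_fin lte_fin.
have /andP[e0 e1] := e01 t t0'.
move: (fine (semigroup V t _ _)) (fine (semigroup Y t _ _)) (fine (law _ _ _)) e0 e1 => S T p.
rewrite -/v; move: (expR _) => e e0 e1 h1 h2 h3 h4 p1.
have h5 : (n%:R * (1 - p) <= n%:R * ((v - c) / n.+1%:R))%R.
  by apply: ler_wpM2l => //; rewrite lerBlDr -lerBlDl ltW.
have h6 : (n%:R * ((v - c) / n.+1%:R) < v - c)%R.
  by rewrite mulrCA gtr_pMr ?subr_gt0 // ltr_pdivrMr // mul1r ltr_nat.
have h7 : (e * S <= e * (n%:R * (1 - p) + T))%R.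
  apply: ler_wpM2l; first exact: ltW.
  by rewrite mulrBr mulr1 addrAC lerBrDr.
have h8 : (e * (n%:R * (1 - p)) <= n%:R * (1 - p))%R.
  by apply: ler_piMl => //; rewrite mulr_ge0 // subr_ge0.
rewrite mulrDr in h7; have h9 := le_trans h2 (le_trans h7 (lerD h8 h3)).
have : (v < v)%R.
  by apply: le_lt_trans h9 _; rewrite -ltrBrDr; exact: le_lt_trans h5 h6.
by rewrite ltxx.
Unshelve. all: by end_near. Qed.

End excessive_domination.

(** * Right continuity along excessive functions *)

Section image_right.
Context (R : realType) (E : ptopologicalType) (Y : process R E).
Hypothesis hY : right_process Y.
Let mY : markov_process Y := hY.1.
Context (K : transfer_kernel E Y).
Context (P : {n : nat & E} ->
  probability (@concat_sample R (fun=> E) (fun=> Y)) R).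
Hypothesis hP : @concat_law R (fun=> E) (fun=> Y) (fun=> K) P.

Notation W := (nat -> sample Y).
Notation UE := (univType R E).
Notation BE := (borelType E).
Notation nonneg := [set t : R | (0 <= t)%R].
Notation prodf := <<s leg_cylinders Y>>.
Notation WP := (g_sigma_algebraType (leg_cylinders Y)).
Notation Z := (@revived_path R E Y).
Notation zf := (path_field Z nonneg).
Notation CS := (@concat_sample R (fun=> E) (fun=> Y)).
Notation X := (@concatenation R (fun=> E) (fun=> Y) P).
Notation pi := (fun z : {n : nat & E} => projT2 z).
Notation cm := (measurable : set (set CS)).
Notation inull := (@image_null R {n : nat & E} E X pi).
Notation IF := (@image_field R {n : nat & E} E X pi).

Context (pp : E -> probability WP R).
Hypothesis ppE : forall x A, prodf A -> pp x A = P (existT _ 0%N x) A.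
Context (P' : E -> probability (g_sigma_algebraType IF) R).
Hypothesis P'law : @image_law R _ E X pi P'.
Notation V := (@image_process R _ E X pi P').

(** On the left the set is replaced by a Borel subset of full measure. *)
Lemma image_dominates t x (B : set UE) : (0 <= t)%R -> measurable B ->
  law Y x (path Y t @^-1` (Some @` B)) <= law V x (path V t @^-1` (Some @` B)).
Proof.
move=> t0 mB; have mV := image_markov_process mY hP ppE P'law.
have [la [laE laT]] := path_law mY x t0.
have [B' [N [mB' mN N0 BN]]] := univ_sandwich_measure laT ((measurable_univ B).1 mB).
have mC : measurable (B' `\` N : set BE) by exact: measurableD.
have CB : B' `\` N `<=` B by move=> y [B'y Ny]; apply/(BN y Ny).
have mY' (D : set UE) : measurable D -> measurable (path Y t @^-1` (Some @` D)).
  exact: path_measurable.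
have -> : law Y x (path Y t @^-1` (Some @` B)) =
    law Y x (path Y t @^-1` (Some @` (B' `\` N))).
  apply: (@measure_agree_off _ _ _ (law Y x) _ _ (path Y t @^-1` (Some @` N))).
  - exact: mY'.
  - by apply: mY'; exact: borel_univ.
  - by apply: mY'; exact: borel_univ.
  - by apply: etrans N0; rewrite laE.
  - move=> w nw; split => -[y hy yE].
      have Ny : ~ N y by move=> Ny; apply: nw; exists y.
      by exists y => //; split => //; apply/(BN y Ny).
    by exists y => //; exact: CB.
apply: (le_trans (first_leg_path_le mY hP ppE x t0 mC)).
rewrite -(image_law_path_event mY ppE P'law) ; last exact: path_field_gen.
apply: le_measure; [apply: mem_set|apply: mem_set|].
- by apply: (path_measurable mV) => //; exact: borel_univ.
- exact: (path_measurable mV).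
- by move=> w [y hy yE]; exists y => //; exact: CB.
Qed.

Lemma leg_integral_null (M : set (sample Y)) k n (x : E) (w : W) :
  measurable M -> (forall x, law Y x M = 0) ->
  @leg_integral R (fun=> E) (fun=> Y) (fun=> K) k n x w
    (fun w => (\1_[set w : W | M (w (n + k)%N)] w)%:E) = 0.
Proof.
move=> mM M0; elim: k n x w => [|k IH] n x w /=.
  rewrite -[RHS](M0 x) -[in RHS](setIT M) -integral_indic //.
  apply: eq_integral => v _; rewrite !indicE; congr (_%:R%:E); congr nat_of_bool.
  by apply/idP/idP => /set_mem h; apply: mem_set; move: h; rewrite /= addn0 dfwithin.
apply: integral0_eq => v _; apply: integral0_eq => y _.
by rewrite -[RHS](IH n.+1 y (dfwith w n v)) addSnnS.
Qed.

(** Legs before the starting one are dead and avoid [M]; later ones are in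
    [M] with probability [0], whatever the state they start from. *)
Lemma legs_null (M : set (sample Y)) : measurable M ->
  (forall x, law Y x M = 0) -> ~ M (dead Y) ->
  let N := [set w : W | exists n, M (w n)] in
  cm N /\ forall y, inull y N.
Proof.
move=> mM M0 Md N.
have NM : natural_field Y M.
  by move=> mu; apply: sub_sigma_algebra; right; exists M; split => //; exact: nearW.
have mC m : cm [set w : W | M (w m)].
  by apply: sub_sigma_algebra; exists m, M.
have NE : N = \bigcup_m [set w : W | M (w m)].
  by apply/seteqP; split => w [n]; exists n.
rewrite NE; split; first exact: bigcupT_measurable.
move=> y [n x] /= _; apply: measure_null_bigcup => // m {y}.
have hint k : (m <= n + k)%N ->
    @leg_integral R (fun=> E) (fun=> Y) (fun=> K) k n x (fun=> dead Y)
      (fun w => (\1_[set w : W | M (w m)] w)%:E) = 0 ->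
    P (existT _ n x) [set w : W | M (w m)] = 0.
  move=> mnk h0.
  have := @hP n x k \1_[set w : W | M (w m)] _ _.
  rewrite integral_indic // ?setIT => ->; first exact: h0.
  - apply: (@measurable_indic _ (g_sigma_algebraType
      (@cylinders R (fun=> E) (fun=> Y) [set i | (i <= n + k)%N]))).
    by apply: sub_sigma_algebra; exists m, M.
  - by exists 1%R => w; rewrite indicE; case: (_ \in _); rewrite ?normr1 ?normr0.
have [mn|nm] := ltnP m n.
  apply: (hint 0%N); first by rewrite addn0 ltnW.
  rewrite /=; apply: integral0_eq => v _; rewrite indicE memNset //=.
  by rewrite dfwithout ?gtn_eqF.
apply: (hint (m - n)%N); first by rewrite subnKC.
have := leg_integral_null (m - n) n x (fun=> dead Y) mM M0.
by rewrite subnKC.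
Qed.

Lemma legs_right_continuous (f : E -> \bar R) (w : W) :
  (forall n, (Some @` setT) (path Y 0 (w n)) -> forall t : R, (0 <= t)%R ->
    ext f (path Y s (w n)) @[s --> t^'+] --> ext f (path Y t (w n))) ->
  forall t : R, (0 <= t)%R -> ext f (Z s w) @[s --> t^'+] --> ext f (Z t w).
Proof.
move=> hw t t0; have [[n nt]|h] := pselect (exists n, on_leg n t w); last first.
  rewrite (revived_path_none h) /=.
  apply: cvg_near_cst; near=> s.
  have ts : (t <= s)%R by near: s; exact: nbhs_right_ge.
  by rewrite (no_leg_after mY t0 h ts).
have nf := on_leg_fin nt; have [d d0 dP] := on_leg_right nt.
pose a := fine (leg_end n w).
have ta : (0 <= t - a)%R by rewrite subr_ge0 -lee_fin fineK//; case/andP: nt.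
have w0 : (Some @` setT) (path Y 0 (w n)).
  have [y yt] := revived_path_some mY nt.
  rewrite (revived_path_leg nt) in yt.
  case E0 : (path Y 0 (w n)) => [z|]; first by exists z.
  by have := path_none_mono mY (lexx 0%R) ta E0; rewrite yt.
have := hw n w0 _ ta; rewrite (revived_path_leg nt) -/a => hcv.
move=> U hU; have [e e0 eP] := near_rightP (hcv U hU).
change (\forall s \near t^'+, U (ext f (Z s w))); near=> s.
have ts : (t < s)%R by near: s; exact: nbhs_right_gt.
rewrite /= (@revived_path_leg _ _ _ n); last first.
  apply: dP; first exact: ltW.
  by near: s; apply: nbhs_right_lt; rewrite ltrDl.
apply: eP; first by rewrite ltrD2r.
rewrite addrAC ltrD2r; near: s; apply: nbhs_right_lt.
by rewrite ltrDl.
Unshelve. all: by end_near. Qed.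

(** An excessive function of the image is excessive for [Y], the image being
    dominated from below by its first leg. The exceptional paths are those
    with a leg that is alive at its start and exceptional for [Y]. The
    condition of being alive excludes the dead path, which may belong to the
    exceptional set of [Y]. *)
Lemma image_right_process : right_process V.
Proof.
have mV := image_markov_process mY hP ppE P'law.
split => // a f a0 ef.
have eY := excessive_dominated mY mV image_dominates (ltW a0) ef.
have [N0 [mN0 N00 hN0]] := hY.2 a f a0 eY.
pose M := N0 `&` path Y 0 @^-1` (Some @` setT).
have mM : measurable M by apply: measurableI => //; exact: path_measurable.
have M0 x : law Y x M = 0 by apply: (measure_nullS mM mN0 _ (N00 x)) => w [].
have Md : ~ M (dead Y).
  have d0 : path Y 0 (dead Y) = None.
    by apply: (path_absorbed mY) => //; rewrite (dead_lifetime mY).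
  by move=> [_]; rewrite /= d0 => -[].
have [cN nN] := legs_null mM M0 Md.
set N := [set w : W | _] in cN nN.
have IN : IF N by move=> mu; apply: sub_sigma_algebra; right; exists N; split => //;
  exact: nearW.
exists N; split.
- exact/image_measurable.
- move=> x; have z0 : zf set0 by case: (@path_field_sigma R E W Z nonneg).
  have Noff : agree_off N N set0 by move=> w nw; split.
  exact: etrans (image_law_approx mY ppE P'law IN z0 cN (nN x) Noff) (measure0 _).
- move=> w /= bad; apply: contrapT => nw; apply: bad; apply: legs_right_continuous => n wn.
  apply: contrapT => hn; apply: nw; exists n; split => //; exact: hN0.
Qed.

End image_right.

(** * Identical processes and kernels *)

(** Stated for an arbitrary sequence of processes and kernels that turns out
    to be constant, so that the two equalities are used by a single
    substitution. *)
Lemma identical_legs_right_process (R : realType) (E : ptopologicalType) (X : process R E)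
    (hX : right_process X) (K : transfer_kernel E X)
    (s : nat -> {Y : process R E & transfer_kernel E Y})
    (P : {n : nat & E} ->
      probability (@concat_sample R (fun=> E) (fun n => projT1 (s n))) R) :
  s = (fun=> existT _ X K) ->
  @concat_law R (fun=> E) (fun n => projT1 (s n)) (fun n => projT2 (s n)) P ->
  let V := @concatenation R (fun=> E) (fun n => projT1 (s n)) P in
  let pi := fun z : {n : nat & E} => projT2 z in
  exists P' : E -> probability (g_sigma_algebraType (image_field V pi)) R,
    image_law P' /\ right_process (image_process P').
Proof.
move=> sE; subst s => /= hP; have mX := hX.1.
have [pp ppE] := revived_law_exists P.
have [P' P'law] := image_law_exists mX hP ppE.
exists P'; split => //.
exact: (image_right_process hX hP ppE P'law).
Qed.

Theorem theorem1p7 (R : realType) (E : ptopologicalType)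
    (Xm Xp : process R E) (hm : right_process Xm) (hp : right_process Xp)
    (Km : transfer_kernel E Xm) (Kp : transfer_kernel E Xp)
    (P : {n : nat & E} ->
         probability (@concat_sample R (fun=> E) (alternating_process Xm Xp)) R)
    (hP : @concat_law R (fun=> E) (alternating_process Xm Xp)
            (alternating_kernel Km Kp) P)
    (hX : Xm = Xp)
    (hK : ecast X (transfer_kernel E X) hX Km = Kp) :
  let X := @concatenation R (fun=> E) (alternating_process Xm Xp) P in
  let pi := fun z : {n : nat & E} => projT2 z in
  exists P' : E -> probability (g_sigma_algebraType (image_field X pi)) R,
    image_law P' /\ right_process (image_process P').
Proof.
pose s n : {Y : process R E & transfer_kernel E Y} :=
  existT _ (alternating_process Xm Xp n) (alternating_kernel Km Kp n).
apply: (@identical_legs_right_process R E Xm hm Km s P) => //.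
apply/funext => n; rewrite /s /alternating_process /alternating_kernel.
by subst Xp; rewrite /= in hK; subst Kp; case: (odd n).
Qed.
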